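(* Let $R$ be a perfectoid ring of characteristic $0$. Then the map $$J\mapsto J^{\flat} := \{\, f=(f^{(n)})_n\in R^{\flat} \mid f^{(n)}\in J \text{ for all } n\,\}$$ is an inclusion-preserving bijection between the set of ideals $J$ of $R$ such that the quotient $R/J$ is a perfectoid ring and the set of $p^{\flat}$-adically closed radical ideals of $R^{\flat}$. Furthermore, the restriction of this bijection yields a homeomorphism between the subspace of $\operatorname{Spec}(R)$ consisting of prime ideals $\mathfrak{p}$ of $R$ such that $R/\mathfrak{p}$ is perfectoid and the subspace of $\operatorname{Spec}(R^{\flat})$ consisting of $p^{\flat}$-adically closed prime ideals of $R^{\flat}$ (both with the subspace topology induced from the Zariski topology).
   Context: Fix a prime number $p$. Perfectoid rings are meant in the (integral) sense of Bhatt–Morrow–Scholze: a ring $R$ is perfectoid if there is $\pi\in R$ such that $R$ is $\pi$-adically complete (and separated), $\pi^p$ divides $p$ in $R$, the Frobenius on $R/pR$ is surjective, and the kernel of the theta map $\theta_R\colon W(R^{\flat})\to R$, $\sum_{n\ge 0}[x_n]p^n\mapsto\sum_{n\ge 0}x_n^{\sharp}p^n$, is principal. For a $p$-adically complete ring $R$, the tilt is $R^{\flat}:=\varprojlim_F R/pR$ ($F$ the Frobenius), whose underlying multiplicative monoid is identified with $\varprojlim_{x\mapsto x^p}R$, so elements of $R^{\flat}$ are sequences $f=(f^{(n)})_{n\ge 0}$ in $R$ with $(f^{(n+1)})^p=f^{(n)}$; $f^{\sharp}:=f^{(0)}$. For a perfectoid ring $R$ of characteristic $0$ there is a unit $v\in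 R^{\times}$ such that $vp$ admits a compatible system of $p$-power roots in $R$; one fixes such a system and lets $p^{\flat}:=((vp)^{1/p^n})_n\in R^{\flat}$ be the corresponding element. An ideal of a ring $B$ is $a$-adically closed ($a\in B$) if it is a closed subset of $B$ in the $a$-adic topology. *)

(* Defs.v *)
(* Rings are commutative and unital, and may be zero ([comPzRingType]): the
   quotient R/R is a perfectoid ring. *)
From HB Require Import structures.
From mathcomp Require Import all_boot all_order all_algebra.
From mathcomp Require Import generic_quotient ring_quotient.
From mathcomp Require Import all_classical topology.
From mathcomp Require Import mpoly.
From mathcomp Require Import ring.

Set Implicit Arguments.
Unset Strict Implicit.
Unset Printing Implicit Defensive.

Import GRing.Theory.
Local Open Scope classical_set_scope.
Local Open Scope ring_scope.
Local Open Scope quotient_scope.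

Definition divides (R : comPzRingType) (a b : R) : Prop := exists c, b = a * c.

Section Divides.
Variable R : comPzRingType.
Implicit Types a b x y : R.

Lemma divides0 a : divides a 0.
Proof. by exists 0; rewrite mulr0. Qed.

Lemma dividesD a x y : divides a x -> divides a y -> divides a (x + y).
Proof. by move=> [c ->] [d ->]; exists (c + d); rewrite mulrDr. Qed.

Lemma dividesMl a b x : divides a x -> divides a (b * x).
Proof. by move=> [c ->]; exists (b * c); rewrite mulrCA. Qed.

Lemma dividesMr a b x : divides a x -> divides a (x * b).
Proof. by rewrite mulrC; exact: dividesMl. Qed.

Lemma dividesN a x : divides a x -> divides a (- x).
Proof. by rewrite -mulN1r; exact: dividesMl. Qed.

Lemma dividesB a x y : divides a x -> divides a y -> divides a (x - y).
Proof. by move=> ax ay; apply: dividesD => //; exact: dividesN. Qed.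

Lemma divides_sum a (I : Type) (r : seq I) (P : pred I) (F : I -> R) :
  (forall i, P i -> divides a (F i)) -> divides a (\sum_(i <- r | P i) F i).
Proof.
move=> aF; elim/big_ind : _ => //; [exact: divides0 | exact: dividesD].
Qed.

Lemma divides_trans a x y z :
  divides a (x - y) -> divides a (y - z) -> divides a (x - z).
Proof. by move=> xy yz; rewrite -(subrK y x) -addrA; exact: dividesD. Qed.

Lemma divides_mul2l a b x : divides a x -> divides (b * a) (b * x).
Proof. by move=> [c ->]; exists c; rewrite mulrA. Qed.

Lemma dividesBB a x x' y y' : divides a (x - x') -> divides a (y - y') ->
  divides a (x - y - (x' - y')).
Proof. by move=> xx yy; rewrite opprD addrACA -opprD; exact: dividesB. Qed.

Lemma dividesMM a x x' y y' : divides a (x - x') -> divides a (y - y') ->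
  divides a (x * y - x' * y').
Proof.
move=> xx yy; apply: (@divides_trans _ _ (x' * y)).
  by rewrite -mulrBl; exact: dividesMr.
by rewrite -mulrBr; exact: dividesMl.
Qed.

Lemma frobeniusD p x y : prime p ->
  divides p%:R ((x + y) ^+ p - (x ^+ p + y ^+ p)).
Proof.
move=> p_pr; case: p p_pr => // p p_pr.
rewrite exprDn big_ord_recl big_ord_recr /= /bump /= add1n subn0 bin0 subnn.
rewrite binn !expr0 !mulr1 mul1r !mulr1n; set s := \sum_(i < p) _.
have -> : x ^+ p.+1 + (s + y ^+ p.+1) - (x ^+ p.+1 + y ^+ p.+1) = s by ring.
apply: divides_sum => i _; rewrite add1n.
have /dvdnP[k ->] : (p.+1 %| 'C(p.+1, i.+1))%N.
  by apply: prime_dvd_bin => //=; rewrite ltnS.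
by exists (x ^+ (p.+1 - i.+1) * y ^+ i.+1 *+ k); rewrite mulrnA mulr_natl.
Qed.

Lemma frobeniusB p x y : prime p ->
  divides p%:R ((x - y) ^+ p - (x ^+ p - y ^+ p)).
Proof.
move=> /(frobeniusD (x - y) y); rewrite subrK => /dividesN.
by congr divides; ring.
Qed.

Lemma divides_expr p n x y : prime p -> divides p%:R (x - y) ->
  divides (p ^ n.+1)%:R (x ^+ (p ^ n) - y ^+ (p ^ n)).
Proof.
move=> p_pr xy; elim: n => [|n [c IHn]]; first by rewrite expn1 expn0 !expr1.
rewrite [(p ^ n.+1)%N]expnSr (exprM x) (exprM y).
have yx : divides p%:R (y ^+ (p ^ n) - x ^+ (p ^ n)).
  rewrite -opprB; apply: dividesN; rewrite IHn expnS natrM -mulrA.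
  by exists ((p ^ n)%:R * c).
move: (x ^+ _) (y ^+ _) IHn yx => {xy} {}x {}y IHn yx.
rewrite subrXX IHn (expnSr p n.+1) natrM.
suff [d ->] : divides p%:R (\sum_(i < p) x ^+ (p.-1 - i) * y ^+ i).
  by exists (c * d); rewrite -!mulrA; congr (_ * _); rewrite mulrCA.
have -> : \sum_(i < p) x ^+ (p.-1 - i) * y ^+ i
    = \sum_(i < p) x ^+ (p.-1 - i) * (y ^+ i - x ^+ i) + p%:R * x ^+ p.-1.
  rewrite mulr_natl -[p in _ *+ p]card_ord -sumr_const -big_split /=.
  apply: eq_bigr => i _; rewrite mulrBr -exprD subnK ?subrK //.
  by rewrite -ltnS prednK ?prime_gt0.
apply: dividesD; last by exists (x ^+ p.-1).
apply: divides_sum => i _; apply: dividesMl; rewrite subrXX.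
exact: dividesMr.
Qed.

End Divides.

Definition is_ideal (R : comPzRingType) (I : set R) : Prop :=
  [/\ I 0, (forall x y, I x -> I y -> I (x + y))
         & (forall a x, I x -> I (a * x))].

Record ideal (R : comPzRingType) := Ideal {
  ideal_set :> set R;
  ideal_axiom : is_ideal ideal_set }.

Lemma principal_is_ideal (R : comPzRingType) (a : R) : is_ideal (divides a).
Proof.
split; first by exists 0; rewrite mulr0.
- by move=> x y [c ->] [d ->]; exists (c + d); rewrite mulrDr.
- by move=> b x [c ->]; exists (b * c); rewrite mulrCA.
Qed.

Definition principal_ideal (R : comPzRingType) (a : R) : ideal R :=
  Ideal (principal_is_ideal a).

(** Quotient rings *)

Section QuotientRing.
Variables (R : comPzRingType) (J : ideal R).

(* [Quotient.quot] wants a boolean membership predicate. *)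
Definition ideal_pred : {pred R} := fun x => x \in ideal_set J.

Lemma ideal_predP x : reflect (ideal_set J x) (x \in ideal_pred).
Proof. by rewrite unfold_in; apply: (iffP idP) => [/set_mem|/mem_set]. Qed.

Lemma ideal_pred_zmod : zmod_closed ideal_pred.
Proof.
have [J0 JD JM] := ideal_axiom J; split; first exact/ideal_predP.
move=> x y /ideal_predP Jx /ideal_predP Jy; apply/ideal_predP/JD => //.
by rewrite -mulN1r; exact: JM.
Qed.

HB.instance Definition _ := GRing.isZmodClosed.Build R ideal_pred ideal_pred_zmod.

Definition quotient_ring := Quotient.quot ideal_pred.

HB.instance Definition _ := GRing.Zmodule.on quotient_ring.
HB.instance Definition _ : EqQuotient R (Quotient.equiv ideal_pred) quotient_ring :=
  EqQuotient.on quotient_ring.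

Definition quotient_one : quotient_ring := \pi_quotient_ring 1.
Definition quotient_mul (x y : quotient_ring) : quotient_ring :=
  \pi_quotient_ring (repr x * repr y).

Lemma pi_quotient_eq (x y : R) :
  \pi_quotient_ring x = \pi_quotient_ring y <-> ideal_set J (x - y).
Proof.
split=> [/eqP|Jxy]; last apply/eqP.
  by rewrite eqmodE /= /Quotient.equiv => /ideal_predP.
by rewrite eqmodE /= /Quotient.equiv; exact/ideal_predP.
Qed.

Lemma pi_quotient_add (x y : R) :
  \pi_quotient_ring (x + y) = \pi_quotient_ring x + \pi_quotient_ring y.
Proof. exact: Quotient.pi_add. Qed.

Lemma pi_quotient_mul (x y : R) :
  \pi_quotient_ring (x * y)
  = quotient_mul (\pi_quotient_ring x) (\pi_quotient_ring y).
Proof.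
have [_ JD JM] := ideal_axiom J.
have H z : ideal_set J (z - repr (\pi_quotient_ring z)).
  by apply/pi_quotient_eq; rewrite reprK.
apply/pi_quotient_eq; set x' := repr _; set y' := repr _.
have -> : x * y - x' * y' = y * (x - x') + x' * (y - y').
  by rewrite !mulrBr (mulrC y x) (mulrC y x') addrA subrK.
by apply: JD; apply: JM; exact: H.
Qed.

Lemma pi_quotient_surj (x : quotient_ring) : exists r, x = \pi_quotient_ring r.
Proof. by exists (repr x); rewrite reprK. Qed.

Lemma quotient_mulA : associative quotient_mul.
Proof.
move=> x y z; have [a ->] := pi_quotient_surj x.
have [b ->] := pi_quotient_surj y; have [c ->] := pi_quotient_surj z.
rewrite -(pi_quotient_mul b c) -(pi_quotient_mul a b).
by rewrite -(pi_quotient_mul a) -(pi_quotient_mul _ c) mulrA.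
Qed.

Lemma quotient_mulC : commutative quotient_mul.
Proof. by move=> x y; rewrite /quotient_mul mulrC. Qed.

Lemma quotient_mul1 : left_id quotient_one quotient_mul.
Proof.
move=> x; have [a ->] := pi_quotient_surj x.
by rewrite /quotient_one -(pi_quotient_mul 1 a) mul1r.
Qed.

Lemma quotient_mulDl : left_distributive quotient_mul +%R.
Proof.
move=> x y z; have [a ->] := pi_quotient_surj x.
have [b ->] := pi_quotient_surj y; have [c ->] := pi_quotient_surj z.
rewrite -(pi_quotient_add a b) -(pi_quotient_mul _ c) mulrDl.
by rewrite (pi_quotient_add (a * c)) !pi_quotient_mul.
Qed.

HB.instance Definition _ := GRing.Zmodule_isComPzRing.Build quotient_ring
  quotient_mulA quotient_mulC quotient_mul1 quotient_mulDl.

End QuotientRing.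

(** Adic completeness and adic topology *)

Definition adically_complete (R : comPzRingType) (a : R) : Prop :=
  (forall x : R, (forall n, divides (a ^+ n) x) -> x = 0) /\
  (forall u : nat -> R, (forall n, divides (a ^+ n) (u n.+1 - u n)) ->
     exists l : R, forall n, divides (a ^+ n) (l - u n)).

(* The ring B carrying the a-adic topology. *)
Definition adic (B : comPzRingType) (a : B) : Type := B.

Section AdicTopology.
Variables (B : comPzRingType) (a : B).

HB.instance Definition _ := Choice.copy (adic a) B.

Definition adic_open : set_system B :=
  [set U | forall x, U x -> exists n, forall b, U (x + a ^+ n * b)].

Lemma adic_openT : adic_open setT.
Proof. by move=> x _; exists 0%N. Qed.

Lemma adic_openI : setI_closed adic_open.
Proof.
move=> U V oU oV x [/oU [m Um] /oV [n Vn]]; exists (m + n)%N => b; split.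
- by rewrite exprD -mulrA.
- by rewrite addnC exprD -mulrA.
Qed.

Lemma adic_open_bigcup (I : Type) (f : I -> set B) :
  (forall i, adic_open (f i)) -> adic_open (\bigcup_i f i).
Proof.
move=> of_ x [i _ /of_ [n fn]]; exists n => b; by exists i.
Qed.

HB.instance Definition _ := @isOpenTopological.Build (adic a)
  adic_open adic_openT adic_openI adic_open_bigcup.

End AdicTopology.

Definition adically_closed (B : comPzRingType) (a : B) (I : set B) : Prop :=
  closed (I : set (adic a)).

(** Prime spectrum *)

Definition is_radical (R : comPzRingType) (I : set R) : Prop :=
  forall (x : R) (n : nat), I (x ^+ n) -> I x.

Definition is_prime_ideal (R : comPzRingType) (I : set R) : Prop :=
  ~ I 1 /\ (forall x y, I (x * y) -> I x \/ I y).

Record spec (R : comPzRingType) := Spec {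
  spec_ideal :> ideal R;
  spec_prime : is_prime_ideal spec_ideal }.

Section Zariski.
Variable R : comPzRingType.

HB.instance Definition _ := gen_eqMixin (spec R).
HB.instance Definition _ := gen_choiceMixin (spec R).

Definition zariski_open : set_system (spec R) :=
  [set U | exists E : set R, U = ~` [set P : spec R | E `<=` P]].

Lemma zariski_openT : zariski_open setT.
Proof.
exists setT; apply/esym/seteqP; split=> // P _ /= TP.
by case: (spec_prime P) => + _; apply; exact: TP.
Qed.

Lemma zariski_openI : setI_closed zariski_open.
Proof.
move=> _ _ [E ->] [F ->].
exists [set z | exists x y, [/\ E x, F y & z = x * y]].
apply/seteqP; split=> P /=.
  move=> [/existsNP [x /not_implyP [Ex Px]] /existsNP [y /not_implyP [Fy Py]]].
  move=> /(_ (x * y)) EFP; have [_ /(_ x y)] := spec_prime P.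
  by case; [apply: EFP; exists x, y|..].
have [_ _ PM] := ideal_axiom P.
move=> /existsNP [_ /not_implyP [[x [y [Ex Fy ->]]] Pxy]]; split=> sub; apply: Pxy.
- by rewrite mulrC; apply: PM; exact: sub.
- by apply: PM; exact: sub.
Qed.

Lemma zariski_open_bigcup (I : Type) (f : I -> set (spec R)) :
  (forall i, zariski_open (f i)) -> zariski_open (\bigcup_i f i).
Proof.
move=> /choice [E fE]; exists (\bigcup_i E i); apply/seteqP; split=> P /=.
  by move=> [i _]; rewrite fE /= => EP sub; apply: EP => x Ex; apply: sub; exists i.
move=> /existsNP [x /not_implyP [[i _ Ex] Px]].
by exists i => //; rewrite fE /= => /(_ x Ex).
Qed.

HB.instance Definition _ := isOpenTopological.Build (spec R)
  zariski_openT zariski_openI zariski_open_bigcup.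

End Zariski.

Definition homeomorphism (X Y : topologicalType) (f : X -> Y) : Prop :=
  continuous f /\ exists2 g : Y -> X, continuous g & cancel f g /\ cancel g f.

(** Witt vectors *)

(* The Witt components x_0, x_1, ... of a vector, for the ghost components
   w_n = \sum_(i <= n) p^i x_i^(p^(n-i)). *)
Definition witt (A : Type) := nat -> A.

Definition ghost (p : nat) (A : comPzRingType) (x : witt A) (n : nat) : A :=
  \sum_(i < n.+1) (p ^ i)%:R * x i ^+ (p ^ (n - i)).

Section WittPolynomials.
Variables p N : nat.

Local Notation P := {mpoly int[N.+1 + N.+1]}.

(* The two generic vectors; meaningful up to index N. *)
Definition wittX : witt P := fun i => 'X_(lshift N.+1 (inord i)).
Definition wittY : witt P := fun i => 'X_(rshift N.+1 (inord i)).

Definition mpoly_divz (d : int) (q : P) : P := map_mpoly (fun z => (z %/ d)%Z) q.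

(* The vector with ghost components g, if there is one, by solving
   p^n M_n = g_n - \sum_(i < n) p^i M_i^(p^(n-i)) for M_n. *)
Fixpoint witt_solve_seq (g : nat -> P) (n : nat) : seq P :=
  if n is m.+1 then
    let s := witt_solve_seq g m in
    rcons s (mpoly_divz (p ^ m)%N%:Z
      (g m - \sum_(i < m) (p ^ i)%:R * s`_i ^+ (p ^ (m - i))))
  else [::].

Definition witt_solve (g : nat -> P) : witt P := fun n => (witt_solve_seq g n.+1)`_n.

Definition witt_mul_poly : witt P :=
  witt_solve (fun n => ghost p wittX n * ghost p wittY n).

End WittPolynomials.

Section WittPolynomialsTheory.
Variables (p N : nat) (p_pr : prime p).

Local Notation P := {mpoly int[N.+1 + N.+1]}.

Definition frobenius_lift : {rmorphism P -> P} :=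
  comp_mpoly [tuple ('X_i : P) ^+ p | i < N.+1 + N.+1].

Lemma frobenius_liftX i : frobenius_lift 'X_i = 'X_i ^+ p.
Proof. by rewrite [LHS]comp_mpolyXU -tnth_nth tnth_mktuple. Qed.

Lemma frobenius_liftP (q : P) : divides p%:R (q ^+ p - frobenius_lift q).
Proof.
pose S (q : P) := divides p%:R (q ^+ p - frobenius_lift q).
have SB q1 q2 : S q1 -> S q2 -> S (q1 - q2).
  rewrite /S rmorphB => S1 S2; apply: divides_trans (frobeniusB _ _ p_pr) _.
  exact: dividesBB S1 S2.
have S0 : S 0.
  by rewrite /S rmorph0 expr0n gtn_eqF ?prime_gt0 // subr0; exact: divides0.
have SD q1 q2 : S q1 -> S q2 -> S (q1 + q2).
  move=> S1 S2; have -> : q1 + q2 = q1 - (0 - q2) by rewrite sub0r opprK.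
  exact: SB S1 (SB _ _ S0 S2).
have S1 : S 1 by rewrite /S rmorph1 expr1n subrr; exact: divides0.
have SM q1 q2 : S q1 -> S q2 -> S (q1 * q2).
  rewrite /S rmorphM exprMn => H1 H2.
  exact: dividesMM H1 H2.
have Sn (n : nat) : S n%:R.
  by elim: n => [|n Sn]; [exact: S0 | rewrite -natr1; exact: SD Sn S1].
have Sz (z : int) : S z%:~R.
  case: z => n; first exact: Sn.
  by rewrite NegzE mulrNz -pmulrn -sub0r; exact: SB S0 (Sn _).
rewrite -/(S q) (mpolyE q); elim/big_ind : _ => [||m _]; [exact: (S0)|exact: (SD)|].
rewrite -mul_mpolyC mpolyXE_id; apply: (SM).
  have -> : (q@_m)%:MP = (q@_m)%:~R :> P by rewrite -[X in X%:MP]intz rmorph_int.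
  exact: Sz.
elim/big_ind : _ => [||i _]; [exact: (S1)|exact: (SM)|].
elim: (m i : nat) => [|k IHk]; first exact: S1.
rewrite exprS; apply: (SM _ _ _ IHk).
by rewrite /S frobenius_liftX subrr; exact: divides0.
Qed.

Lemma mcoeff_divz (d : int) (q : P) m : (mpoly_divz d q)@_m = (q@_m %/ d)%Z.
Proof.
rewrite /mpoly_divz /map_mpoly /mmap raddf_sum /=.
under eq_bigr do rewrite mmap1_id mul_mpolyC mcoeffZ mcoeffX.
have [mq|mq] := boolP (m \in msupp q).
  rewrite (bigD1_seq m) //= eqxx mulr1 big1 ?addr0 // => m' /negPf.
  by rewrite eq_sym => ->; rewrite mulr0.
rewrite (memN_msupp_eq0 mq) div0z big_seq big1 // => m' m'q.
case: eqP => [mE|_]; last by rewrite mulr0.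
by rewrite mE in m'q; rewrite m'q in mq.
Qed.

Lemma mpoly_divzK (d : nat) (q : P) : (0 < d)%N -> divides d%:R q ->
  d%:R * mpoly_divz d%:Z q = q.
Proof.
move=> d_gt0 [r ->]; apply/mpolyP => m.
rewrite !mulr_natl !mcoeffMn mcoeff_divz mcoeffMn.
congr (_ *+ d); rewrite -[_ *+ d]mulr_natl natz mulKz // -lt0n.
by [].
Qed.

Lemma size_witt_solve_seq (g : nat -> P) n : size (witt_solve_seq p g n) = n.
Proof. by elim: n => //= n IHn; rewrite size_rcons IHn. Qed.

Lemma nth_witt_solve_seq (g : nat -> P) n i : (i < n)%N ->
  (witt_solve_seq p g n)`_i = witt_solve p g i.
Proof.
elim: n => // n IHn; rewrite ltnS leq_eqVlt => /predU1P[-> //|lt_in].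
by rewrite /= nth_rcons size_witt_solve_seq lt_in IHn.
Qed.

Lemma witt_solveE (g : nat -> P) n :
  witt_solve p g n = mpoly_divz (p ^ n)%N%:Z
    (g n - \sum_(i < n) (p ^ i)%:R * witt_solve p g i ^+ (p ^ (n - i))).
Proof.
rewrite {1}/witt_solve /= nth_rcons size_witt_solve_seq ltnn eqxx.
by under eq_bigr => i _ do rewrite nth_witt_solve_seq //.
Qed.

Lemma ghost_witt_solve (g : nat -> P) :
  (forall n, divides (p ^ n.+1)%:R (g n.+1 - frobenius_lift (g n))) ->
  forall n, ghost p (witt_solve p g) n = g n.
Proof.
move=> gP; set M := witt_solve p g => n.
suff H : divides (p ^ n)%:R (g n - \sum_(i < n) (p ^ i)%:R * M i ^+ (p ^ (n - i))).
  rewrite /ghost big_ord_recr /= subnn expn0 expr1 {2}/M witt_solveE -/M.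
  by rewrite mpoly_divzK ?expn_gt0 ?prime_gt0 // addrC subrK.
elim: n => [|n IHn]; first by rewrite expn0; eexists; rewrite mul1r.
have gn : g n = \sum_(i < n.+1) (p ^ i)%:R * M i ^+ (p ^ (n - i)).
  rewrite big_ord_recr /= subnn expn0 expr1 {2}/M witt_solveE -/M.
  by rewrite mpoly_divzK ?expn_gt0 ?prime_gt0 // addrC subrK.
apply: divides_trans (gP n) _; rewrite {}gn rmorph_sum -sumrB.
apply: divides_sum => i _; rewrite rmorphM rmorph_nat (rmorphXn frobenius_lift) -mulrBr.
have le_in : (i <= n)%N by rewrite -ltnS.
have -> : (p ^ n.+1)%:R = (p ^ i)%:R * (p ^ (n - i).+1)%:R :> P.
  by rewrite -natrM -expnD -subSn // subnKC // leqW.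
have -> : (p ^ (n.+1 - i) = p * p ^ (n - i))%N by rewrite subSn // expnS.
apply: divides_mul2l; rewrite (exprM (M i)); apply: divides_expr => //.
by rewrite -opprB; apply: dividesN; exact: frobenius_liftP.
Qed.

Lemma ghost_frobenius (x : witt P) :
  (forall i, frobenius_lift (x i) = x i ^+ p) ->
  forall n, divides (p ^ n.+1)%:R (ghost p x n.+1 - frobenius_lift (ghost p x n)).
Proof.
move=> xP n; rewrite /ghost big_ord_recr /= rmorph_sum addrAC -sumrB.
apply: dividesD; last by eexists.
apply: divides_sum => i _; rewrite rmorphM rmorph_nat (rmorphXn frobenius_lift) xP -exprM.
have le_in : (i <= n)%N by rewrite -ltnS.
by rewrite -expnS -subSn // subrr; exact: divides0.
Qed.

Lemma ghost_witt_mul_poly n :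
  ghost p (witt_mul_poly p N) n = ghost p (wittX N) n * ghost p (wittY N) n.
Proof.
apply: (ghost_witt_solve _ n) => {}n; rewrite rmorphM.
by apply: dividesMM; apply: ghost_frobenius => i; exact: frobenius_liftX.
Qed.

End WittPolynomialsTheory.

(* [mmap] is restricted to nonzero rings. *)
Definition mpoly_eval (A : comPzRingType) (k : nat) (q : {mpoly int[k]})
    (x : 'I_k -> A) : A :=
  \sum_(m <- msupp q) (q@_m)%:~R * \prod_(i < k) x i ^+ m i.

Definition witt_mul (p : nat) (A : comPzRingType) (a b : witt A) : witt A :=
  fun n => mpoly_eval (witt_mul_poly p n n)
    (fun i => match fintype.split i with inl j => a j | inr j => b j end).

(** Tilt *)

Section Tilt.
Variables (p : nat) (p_pr : prime p) (R : comPzRingType).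

Local Notation Rp := (quotient_ring (principal_ideal (p%:R : R))).

Lemma natr_quotient_p : p%:R = 0 :> Rp.
Proof.
have pi0 : \pi_Rp (0 : R) = 0.
  by apply: (addrI (\pi_Rp 0)); rewrite -pi_quotient_add !addr0.
have piE n : \pi_Rp (n%:R : R) = n%:R.
  by elim: n => [//|n IHn]; rewrite -!natr1 pi_quotient_add IHn.
rewrite -piE -pi0; apply/pi_quotient_eq; rewrite subr0.
by exists 1; rewrite mulr1.
Qed.

Lemma frobenius_quotientB (x y : Rp) : (x - y) ^+ p = x ^+ p - y ^+ p.
Proof.
have [c] := frobeniusB x y p_pr.
by rewrite natr_quotient_p mul0r => /eqP; rewrite subr_eq0 => /eqP.
Qed.

Definition frobenius_compatible : {pred nat -> Rp} :=
  fun x => `[< forall n, x n.+1 ^+ p = x n >].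

Lemma frobenius_compatible_subring : subring_closed frobenius_compatible.
Proof.
split=> [|x y|x y]; rewrite ?unfold_in.
- by apply/asboolP => n; exact: expr1n.
- move=> /asboolP xP /asboolP yP; apply/asboolP => n.
  by rewrite -[LHS]/((x n.+1 - y n.+1) ^+ p) frobenius_quotientB xP yP.
- move=> /asboolP xP /asboolP yP; apply/asboolP => n.
  by rewrite -[LHS]/((x n.+1 * y n.+1) ^+ p) exprMn xP yP.
Qed.

End Tilt.

(* lim_F R/pR; primality of p is what makes this a subring of (R/pR)^nat. *)
Record tilt (p : nat) (p_pr : prime p) (R : comPzRingType) := Tilt {
  tilt_val :> nat -> quotient_ring (principal_ideal (p%:R : R));
  tilt_valP : tilt_val \in @frobenius_compatible p R }.

Section TiltTheory.
Variables (p : nat) (p_pr : prime p) (R : comPzRingType).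

Local Notation Rp := (quotient_ring (principal_ideal (p%:R : R))).
Local Notation Rb := (tilt p_pr R).

HB.instance Definition _ := [isSub for @tilt_val p p_pr R].
HB.instance Definition _ := [Choice of Rb by <:].
HB.instance Definition _ := @GRing.SubChoice_isSubComPzRing.Build (nat -> Rp)
  (@frobenius_compatible p R) Rb (frobenius_compatible_subring p_pr R).

Lemma tilt_shift_subproof (f : Rb) (k : nat) :
  (fun n => f (n + k)%N) \in @frobenius_compatible p R.
Proof.
by have := tilt_valP f; rewrite !unfold_in => /asboolP fP; apply/asboolP => n; exact: fP.
Qed.

(* The p^k-th root of f in the perfect ring R^flat. *)
Definition tilt_root (k : nat) (f : Rb) : Rb := Tilt p_pr (tilt_shift_subproof f k).

(* The element of lim_(x -> x^p) R corresponding to f; for p-adically complete R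
   there is exactly one sequence satisfying the condition. *)
Definition tilt_seq (f : Rb) : nat -> R :=
  xget (fun=> 0) [set r : nat -> R |
    (forall n, r n.+1 ^+ p = r n) /\ (forall n, \pi_Rp (r n) = f n)].

Definition sharp (f : Rb) : R := tilt_seq f 0.

Definition tilt_ideal (J : set R) : set Rb := [set f | forall n, J (tilt_seq f n)].

(* The Witt vector with components a_n is \sum_n [a_n^(1/p^n)] p^n.  The infinite
   sum in R is the p-adic limit, unique for p-adically complete R. *)
Definition theta (a : witt Rb) : R :=
  xget 0 [set r : R | forall N, divides (p%:R ^+ N)
    (r - \sum_(n < N) sharp (tilt_root n (a n)) * p%:R ^+ n)].

(* Since varpi divides p, such an R is p-adically complete, so the default
   values of [tilt_seq] and [theta] do not occur. *)
Definition perfectoid : Prop :=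
  exists varpi : R,
    [/\ adically_complete varpi,
        divides (varpi ^+ p) p%:R,
        (forall y : Rp, exists x : Rp, x ^+ p = y)
      & exists xi : witt Rb, forall w : witt Rb,
          theta w = 0 <-> exists u : witt Rb, w = witt_mul p xi u].

End TiltTheory.

Arguments tilt_ideal {p} p_pr {R} J.

Definition char0 (R : comPzRingType) : Prop := forall n : nat, n%:R = 0 :> R -> n = 0%N.

(* Main.v *)
Require Import Defs.
From HB Require Import structures.
From mathcomp Require Import all_boot all_order all_algebra.
From mathcomp Require Import all_classical topology.
From mathcomp Require Import generic_quotient mpoly ring.

Set Implicit Arguments.
Unset Strict Implicit.
Unset Printing Implicit Defensive.

Import GRing.Theory.
Local Open Scope classical_set_scope.
Local Open Scope ring_scope.
Local Open Scope quotient_scope.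

(* Let A be the tilt of R and delta = p - [t]e, with t = p^flat and e a unit of W(A)
   lifting v^-1.  The kernel of theta : W(A) -> R is generated by delta, and the inverse of
   J |-> J^flat is I |-> theta(W(I)): for a closed radical ideal I of the perfect ring A,
   theta(w) lies in theta(W(I)) iff delta divides w in W(A/I).  That J^flat recovers J uses
   the surjectivity of A -> (R/J)^flat.

   Everything about primes rests on a descent statement for an inclusion D -> E of perfect
   rings, D being t-complete and E t-separated: if delta divides w in W(E), for w in W(D),
   then it does so in W(D).  It is proved by approximating [T] - w modulo delta by a
   Teichmueller element over the perfection of D[T].  With E the product of the A/Q, it
   shows that the inverse map commutes with intersections, whence the continuity of the
   inverse.  It also shows that a perfectoid ring S with integral tilt is a domain: if
   x y = 0 in S, one takes for E the tilt of the ring of all c in S[1/p] such that c^j y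
   lies in S for all j, a ring in which x is infinitely p-divisible. *)

(** The obstacle to descent is that an injection [D -> E] need not stay injective modulo $t$, so
    nothing formal makes $W(D)/\delta \to W(E)/\delta$ injective. The way out is universal: in a
    ring where $[T]$ is close to $w$ modulo $\delta$, the relation $\delta \mid w$ makes $T$ highly
    divisible by $t$, and the quotient of $w$ by $\delta$ is then known modulo a power of $t$ from
    data over the perfection of $D[T]$. The variable can be removed again because, at each Frobenius
    level, the element that was killed is $X^Q - \xi$ plus a multiple of a power of $t$, so that
    division with remainder works modulo powers of $t$.

    The ring of all $c$ with $c^j y \in S$ need not be $p$-adically complete, so $\theta$ is no
    function there. It is replaced by a relation that ignores infinitely $p$-divisible errors, which
    is exactly why such an $x$ counts as zero; the kernel is computed from closure under $p$-power
    roots instead of perfectoidness. *)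

Definition nzring (A : comPzRingType) (nz : 1 <> 0 :> A) : Type := A.

Section NzRing.
Variables (A : comPzRingType) (nz : 1 <> 0 :> A).
HB.instance Definition _ := GRing.ComPzRing.on (nzring nz).
Lemma nzring_oner_neq0 : 1 != 0 :> nzring nz.
Proof. exact/eqP. Qed.
HB.instance Definition _ :=
  GRing.PzSemiRing_isNonZero.Build (nzring nz) nzring_oner_neq0.
End NzRing.

Section MpolyEval.
Variables (A : comPzRingType) (k : nat) (x : 'I_k -> A).

Definition mpoly_ev (q : {mpoly int[k]}) : A := mpoly_eval q x.

(** Conversion only: [nzring nz] is [A] itself, with the nonzero structure that [mmap] demands. The
    zero ring is treated apart, since quotients may vanish. *)
Lemma mpoly_ev_mmap (nz : 1 <> 0 :> A) :
  mpoly_ev = mmap (intr : int -> nzring nz) (x : 'I_k -> nzring nz).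
Proof. by []. Qed.

Lemma zero_ring (h : 1 = 0 :> A) (a b : A) : a = b.
Proof. by rewrite -[a]mulr1 -[b]mulr1 h !mulr0. Qed.

Lemma mpoly_ev_additive : additive mpoly_ev.
Proof.
have [h|nz] := pselect (1 = 0 :> A); first by move=> ? ?; apply: zero_ring h _ _.
rewrite (mpoly_ev_mmap nz); exact: (raddfB (mmap (intr : int -> nzring nz) (x : 'I_k -> nzring nz))).
Qed.

Lemma mpoly_ev_multiplicative : multiplicative mpoly_ev.
Proof.
have [h|nz] := pselect (1 = 0 :> A).
  by split=> [? ?|]; apply: zero_ring h _ _.
rewrite (mpoly_ev_mmap nz); split.
  exact: (rmorphM (mmap (intr : int -> nzring nz) (x : 'I_k -> nzring nz))).
exact: (rmorph1 (mmap (intr : int -> nzring nz) (x : 'I_k -> nzring nz))).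
Qed.

HB.instance Definition _ :=
  GRing.isAdditive.Build {mpoly int[k]} A mpoly_ev mpoly_ev_additive.
HB.instance Definition _ :=
  GRing.isMultiplicative.Build {mpoly int[k]} A mpoly_ev mpoly_ev_multiplicative.

Lemma mpoly_evX i : mpoly_ev 'X_i = x i.
Proof.
have [h|nz] := pselect (1 = 0 :> A); first exact: zero_ring h _ _.
by rewrite (mpoly_ev_mmap nz) mmapX mmap1U.
Qed.

End MpolyEval.

Lemma rmorph_mpoly_ev (A B : comPzRingType) (f : {rmorphism A -> B}) k
    (x : 'I_k -> A) q : f (mpoly_ev x q) = mpoly_ev (f \o x) q.
Proof.
rewrite /mpoly_ev /mpoly_eval rmorph_sum; apply: eq_bigr => m _ /=.
rewrite rmorphM rmorph_int rmorph_prod; congr (_ * _).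
by apply: eq_bigr => i _; rewrite rmorphXn.
Qed.

(** * Witt vectors *)

Definition torsion_free_at (p : nat) (B : comPzRingType) : Prop :=
  forall x : B, p%:R * x = 0 -> x = 0.

Lemma torsion_free_expn p (B : comPzRingType) n (x : B) :
  torsion_free_at p B -> (p ^ n)%:R * x = 0 -> x = 0.
Proof.
move=> tfB; elim: n x => [|n IHn] x; first by rewrite expn0 mul1r.
by rewrite expnS natrM -mulrA => /tfB /IHn.
Qed.

Lemma mpoly_torsion_free p k : prime p -> torsion_free_at p {mpoly int[k]}.
Proof.
move=> p_pr q /eqP; rewrite mulf_eq0 => /orP[|/eqP //].
rewrite -mpolyC_nat mpolyC_eq0 Num.Theory.pnatr_eq0.
by case: p p_pr.
Qed.

Section Ghost.
Variables (p : nat) (p_pr : prime p).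
Local Notation ghost := (ghost p).

Lemma ghost_eq_upto (A : comPzRingType) (x y : witt A) n :
  (forall i, (i <= n)%N -> x i = y i) -> ghost x n = ghost y n.
Proof. by move=> xy; apply: eq_bigr => i _; rewrite xy // -ltnS. Qed.

Lemma ghostS (A : comPzRingType) (x : witt A) n :
  ghost x n = \sum_(i < n) (p ^ i)%:R * x i ^+ (p ^ (n - i)) + (p ^ n)%:R * x n.
Proof. by rewrite /ghost big_ord_recr /= subnn expn0 expr1. Qed.

(** The system is triangular: $w_k$ is $p^k x_k$ plus terms in earlier components, and $p^k$
    cancels. *)
Lemma ghost_inj (B : comPzRingType) (x y : witt B) n : torsion_free_at p B ->
  (forall k, (k <= n)%N -> ghost x k = ghost y k) ->
  forall k, (k <= n)%N -> x k = y k.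
Proof.
move=> tfB gxy k; have [m] := ubnP k; elim: m k => // m IHm k lekm lekn.
have /eqP := gxy k lekn; rewrite !ghostS.
under eq_bigr => i _ do rewrite IHm ?(leq_trans (ltn_ord i) lekm) ?(leq_trans (ltnW (ltn_ord i)) lekn) //.
rewrite (inj_eq (addrI _)) -subr_eq0 -mulrBr => /eqP /(torsion_free_expn tfB) /eqP.
by rewrite subr_eq0 => /eqP.
Qed.

Lemma rmorph_ghost (A B : comPzRingType) (f : {rmorphism A -> B}) (x : witt A) n :
  f (ghost x n) = ghost (f \o x) n.
Proof.
rewrite /ghost rmorph_sum; apply: eq_bigr => i _.
by rewrite rmorphM rmorph_nat rmorphXn.
Qed.

(** A congruence modulo $p$ becomes one modulo $p^{n-i+1}$ after raising to the power $p^{n-i}$; the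
    weight $p^i$ supplies the rest. This is what makes ghost components of vectors over $B/p$
    meaningful modulo $p^{n+1}$, and later defines [theta_rel]. *)
Lemma ghost_congr (B : comPzRingType) (x y : witt B) n :
  (forall k, (k <= n)%N -> divides p%:R (x k - y k)) ->
  divides (p ^ n.+1)%:R (ghost x n - ghost y n).
Proof.
move=> xy; rewrite /ghost -sumrB; apply: divides_sum => i _.
rewrite -mulrBr; have le_in : (i <= n)%N by rewrite -ltnS.
have -> : (p ^ n.+1)%:R = (p ^ i)%:R * (p ^ (n - i).+1)%:R :> B.
  by rewrite -natrM -expnD -subSn // subnKC // leqW.
by apply: divides_mul2l; apply: divides_expr => //; exact: xy.
Qed.

Lemma ghost_congr_inv (B : comPzRingType) (x y : witt B) n : torsion_free_at p B ->
  (forall k, (k <= n)%N -> divides (p ^ k.+1)%:R (ghost x k - ghost y k)) ->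
  forall k, (k <= n)%N -> divides p%:R (x k - y k).
Proof.
move=> tfB gxy k; have [m] := ubnP k; elim: m k => // m IHm k lekm lekn.
have := gxy k lekn; rewrite !ghostS opprD addrACA -sumrB -mulrBr => H.
have : divides (p ^ k.+1)%:R ((p ^ k)%:R * (x k - y k)).
  rewrite -[X in divides _ X](addKr (\sum_(i < k) ((p ^ i)%:R * x i ^+ (p ^ (k - i))
      - (p ^ i)%:R * y i ^+ (p ^ (k - i))))) addrC.
  apply: dividesB => //; apply: divides_sum => i _; rewrite -mulrBr.
  have -> : (p ^ k.+1)%:R = (p ^ i)%:R * (p ^ (k - i).+1)%:R :> B.
    by rewrite -natrM -expnD -subSn ?(ltnW (ltn_ord i)) // subnKC // leqW // ltnW.
  apply: divides_mul2l; apply: divides_expr => //; apply: IHm.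
    exact: leq_trans (ltn_ord i) lekm.
  exact: leq_trans (ltnW (ltn_ord i)) lekn.
move=> [c /eqP]; rewrite expnSr natrM -mulrA -subr_eq0 -mulrBr.
by move=> /eqP /(torsion_free_expn tfB) /eqP; rewrite subr_eq0 => /eqP ->; exists c.
Qed.

End Ghost.

(** * Operations on Witt vectors from operations on ghost components *)

Section WittOperation.
Variables (p : nat) (p_pr : prime p).
Local Notation ghost := (ghost p).

Definition witt_vars (A : comPzRingType) (a b : witt A) N (i : 'I_(N.+1 + N.+1)) : A :=
  match fintype.split i with inl j => a j | inr j => b j end.

Lemma rmorph_witt_vars (A B : comPzRingType) (f : A -> B) (a b : witt A) N i :
  f (@witt_vars A a b N i) = @witt_vars B (f \o a) (f \o b) N i.
Proof. by rewrite /witt_vars; case: fintype.split. Qed.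

Lemma mpoly_ev_wittX (A : comPzRingType) (a b : witt A) N i : (i <= N)%N ->
  mpoly_ev (@witt_vars A a b N) (wittX N i) = a i.
Proof.
move=> leiN; rewrite mpoly_evX /witt_vars.
by rewrite (unsplitK (inl _)) inordK.
Qed.

Lemma mpoly_ev_wittY (A : comPzRingType) (a b : witt A) N i : (i <= N)%N ->
  mpoly_ev (@witt_vars A a b N) (wittY N i) = b i.
Proof.
move=> leiN; rewrite mpoly_evX /witt_vars.
by rewrite (unsplitK (inr _)) inordK.
Qed.

Variable op : forall B : comPzRingType, B -> B -> B.
Hypothesis op_natural : forall (A B : comPzRingType) (f : {rmorphism A -> B}) x y,
  f (op x y) = op (f x) (f y).
Hypothesis op_congr : forall (B : comPzRingType) (d x x' y y' : B),
  divides d (x - x') -> divides d (y - y') -> divides d (op x y - op x' y').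

(** Sum, product and negative are treated at once: naturality of [op] and its compatibility with
    congruences are what the integrality criterion [ghost_witt_solve] needs. For [ring_mul] this is
    the product [witt_mul] of the statement. *)
Definition witt_op_poly N := witt_solve p
  (fun n => op (ghost (wittX N) n) (ghost (wittY N) n)).

Definition witt_op (A : comPzRingType) (a b : witt A) : witt A :=
  fun n => mpoly_ev (@witt_vars A a b n) (witt_op_poly n n).

Lemma ghost_witt_op_poly N n :
  ghost (witt_op_poly N) n = op (ghost (wittX N) n) (ghost (wittY N) n).
Proof.
apply: (ghost_witt_solve p_pr _ n) => {}n; rewrite op_natural.
by apply: op_congr; apply: (ghost_frobenius _ n) => i; exact: frobenius_liftX.
Qed.

(** The definition uses a new set of variables for each component, whereas ghost components mix all
    components up to [n]. The polynomial is independent of the number of variables, because its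
    ghost components are and polynomial rings over the integers have no $p$-torsion. *)
Lemma witt_op_polyE (A : comPzRingType) (a b : witt A) N n : (n <= N)%N ->
  witt_op a b n = mpoly_ev (@witt_vars A a b N) (witt_op_poly N n).
Proof.
move=> lenN.
pose x := @witt_vars {mpoly int[N.+1 + N.+1]} (wittX N) (wittY N) n.
have <- : mpoly_ev x (witt_op_poly n n) = witt_op_poly N n.
  apply: (ghost_inj (x := mpoly_ev x \o witt_op_poly n)
    (@mpoly_torsion_free p _ p_pr) _ (leqnn n)) => k lekn.
  transitivity (mpoly_ev x (ghost (witt_op_poly n) k)); first by rewrite rmorph_ghost.
  rewrite (ghost_witt_op_poly n k) (ghost_witt_op_poly N k).
  apply: etrans (op_natural (mpoly_ev x) _ _) _.
  by congr op; apply: etrans (rmorph_ghost p (mpoly_ev x) _ _) _;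
    apply: ghost_eq_upto => i leik /=; [apply: mpoly_ev_wittX|apply: mpoly_ev_wittY];
    rewrite (leq_trans leik).
rewrite rmorph_mpoly_ev /witt_op; congr (mpoly_ev _ _).
apply/funext => i; rewrite /= /x (rmorph_witt_vars (mpoly_ev (witt_vars a b (N:=N)))) /witt_vars.
by case: fintype.split => j; apply/esym; [apply: mpoly_ev_wittX | apply: mpoly_ev_wittY];
  rewrite (leq_trans _ lenN) // -ltnS.
Qed.

Lemma ghost_witt_op (A : comPzRingType) (a b : witt A) n :
  ghost (witt_op a b) n = op (ghost a n) (ghost b n).
Proof.
transitivity (mpoly_ev (@witt_vars A a b n) (ghost (witt_op_poly n) n)).
  apply: etrans (esym (rmorph_ghost p (mpoly_ev _) _ _)).
  by apply: ghost_eq_upto => i lein; exact: witt_op_polyE.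
rewrite ghost_witt_op_poly; apply: etrans (op_natural (mpoly_ev _) _ _) _.
by congr op; apply: etrans (rmorph_ghost p (mpoly_ev _) _ _) _;
  apply: ghost_eq_upto => i lein; [apply: mpoly_ev_wittX|apply: mpoly_ev_wittY].
Qed.

Lemma rmorph_witt_op (A B : comPzRingType) (f : {rmorphism A -> B}) (a b : witt A) n :
  f (witt_op a b n) = witt_op (f \o a) (f \o b) n.
Proof.
rewrite rmorph_mpoly_ev /witt_op; congr (mpoly_ev _ _).
by apply/funext => i; exact: (rmorph_witt_vars f).
Qed.

Lemma witt_op_upto (A : comPzRingType) (a b a' b' : witt A) n :
  (forall i, (i <= n)%N -> a i = a' i) -> (forall i, (i <= n)%N -> b i = b' i) ->
  witt_op a b n = witt_op a' b' n.
Proof.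
move=> aa' bb'; rewrite /witt_op; congr (mpoly_ev _ _); apply/funext => i.
by rewrite /witt_vars; case: fintype.split => j; rewrite ?aa' ?bb' // -ltnS.
Qed.

End WittOperation.

Definition ring_add (B : comPzRingType) (x y : B) := x + y.
Definition ring_mul (B : comPzRingType) (x y : B) := x * y.
(** Binary in form, so that negation is an instance of [witt_op]. *)
Definition ring_opp (B : comPzRingType) (x y : B) := - x.

Lemma witt_mul_op p (A : comPzRingType) (a b : witt A) :
  witt_mul p a b = witt_op p ring_mul a b.
Proof. by []. Qed.

(* Natural operations in three Witt vectors whose component n only depends on the
   components up to n. Such operations agree as soon as their ghost components do. *)
Definition witt_natural (F : forall B : comPzRingType, witt B -> witt B -> witt B -> witt B) :=
  (forall (A B : comPzRingType) (f : {rmorphism A -> B}) (a b c : witt A) n,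
     f (F A a b c n) = F B (f \o a) (f \o b) (f \o c) n) /\
  (forall (A : comPzRingType) (a b c a' b' c' : witt A) n,
     (forall i, (i <= n)%N -> [/\ a i = a' i, b i = b' i & c i = c' i]) ->
     F A a b c n = F A a' b' c' n).

Section WittNatural.
Variables (p : nat) (p_pr : prime p).
Local Notation ghost := (ghost p).

Lemma witt_lift (A : comPzRingType) m n (a : 'I_m -> witt A) :
  exists (k : nat) (f : {rmorphism {mpoly int[k]} -> A})
    (b : 'I_m -> witt {mpoly int[k]}),
    forall j i, (i <= n)%N -> f (b j i) = a j i.
Proof.
exists #|{: 'I_m * 'I_n.+1}|.
exists (mpoly_ev (fun l : 'I_#|{: 'I_m * 'I_n.+1}| => let ji : 'I_m * 'I_n.+1 := enum_val l in a ji.1 ji.2)).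
exists (fun j i => 'X_(enum_rank ((j, inord i) : 'I_m * 'I_n.+1))) => j i lein.
by apply: etrans (mpoly_evX _ _) _; rewrite enum_rankK /= inordK.
Qed.

Lemma witt_lift3 (A : comPzRingType) n (a b c : witt A) :
  exists (k : nat) (f : {rmorphism {mpoly int[k]} -> A})
    (a' b' c' : witt {mpoly int[k]}),
    forall i, (i <= n)%N -> [/\ f (a' i) = a i, f (b' i) = b i & f (c' i) = c i].
Proof.
have [k [f [x fx]]] := witt_lift n (fun j : 'I_3 => [:: a; b; c]`_j).
exists k, f, (x 0), (x 1), (x 2%:R) => i lein; split.
- exact: fx 0 i lein.
- exact: fx 1 i lein.
- exact: fx 2%:R i lein.
Qed.

(** The components up to [n] lift to a polynomial ring over the integers, where ghost components are
    injective; naturality carries the identity back to [A]. *)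
Lemma witt_natural_ext F G : witt_natural F -> witt_natural G ->
  (forall (B : comPzRingType) (a b c : witt B) n, torsion_free_at p B ->
     ghost (F B a b c) n = ghost (G B a b c) n) ->
  forall (A : comPzRingType) (a b c : witt A), F A a b c = G A a b c.
Proof.
move=> [Fn Fl] [Gn Gl] FG A a b c; apply/funext => n.
have [k [f [a' [b' [c' f']]]]] := witt_lift3 n a b c.
rewrite (Fl _ _ _ _ (f \o a') (f \o b') (f \o c')); last first.
  by move=> i /f' [].
rewrite (Gl _ _ _ _ (f \o a') (f \o b') (f \o c')); last first.
  by move=> i /f' [].
rewrite -Fn -Gn; congr (f _).
apply: (ghost_inj (@mpoly_torsion_free p k p_pr) _ (leqnn n)) => i _.
exact/FG/mpoly_torsion_free.
Qed.

Lemma witt_natural1 : witt_natural (fun B a b c => a).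
Proof. by split=> // A a b c a' b' c' n /(_ n (leqnn n)) []. Qed.
Lemma witt_natural2 : witt_natural (fun B a b c => b).
Proof. by split=> // A a b c a' b' c' n /(_ n (leqnn n)) []. Qed.
Lemma witt_natural3 : witt_natural (fun B a b c => c).
Proof. by split=> // A a b c a' b' c' n /(_ n (leqnn n)) []. Qed.

Lemma witt_natural_op op F G :
  witt_natural F -> witt_natural G ->
  witt_natural (fun B a b c => witt_op p op (F B a b c) (G B a b c)).
Proof.
move=> [Fn Fl] [Gn Gl]; split.
  move=> A B f a b c n; rewrite rmorph_witt_op.
  by apply: witt_op_upto => i _ /=; rewrite ?Fn ?Gn.
move=> A a b c a' b' c' n H; apply: witt_op_upto => i lein.
  by apply: Fl => j leji; apply: H; exact: leq_trans leji lein.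
by apply: Gl => j leji; apply: H; exact: leq_trans leji lein.
Qed.

Definition witt_teich (A : comPzRingType) (x : A) : witt A :=
  fun n => if n is 0%N then x else 0.

Lemma witt_natural_teich (x : forall A : comPzRingType, A) :
  (forall (A B : comPzRingType) (f : {rmorphism A -> B}), f (x A) = x B) ->
  witt_natural (fun B a b c => witt_teich (x B)).
Proof. by move=> fx; split=> // A B f a b c [|n] /=; rewrite ?fx ?rmorph0. Qed.

Lemma ghost_teich (A : comPzRingType) (x : A) n : ghost (witt_teich x) n = x ^+ (p ^ n).
Proof.
rewrite /ghost big_ord_recl /= expn0 mul1r subn0 big1 ?addr0 // => i _.
by rewrite expr0n expn_eq0 (gtn_eqF (prime_gt0 p_pr)) mulr0.
Qed.

End WittNatural.

Section WittRing.
Variables (p : nat) (p_pr : prime p).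
Local Notation ghost := (ghost p).

Lemma ring_add_natural (A B : comPzRingType) (f : {rmorphism A -> B}) x y :
  f (ring_add x y) = ring_add (f x) (f y).
Proof. exact: rmorphD. Qed.
Lemma ring_mul_natural (A B : comPzRingType) (f : {rmorphism A -> B}) x y :
  f (ring_mul x y) = ring_mul (f x) (f y).
Proof. exact: rmorphM. Qed.
Lemma ring_opp_natural (A B : comPzRingType) (f : {rmorphism A -> B}) x y :
  f (ring_opp x y) = ring_opp (f x) (f y).
Proof. exact: rmorphN. Qed.
Lemma ring_add_congr (B : comPzRingType) (d x x' y y' : B) :
  divides d (x - x') -> divides d (y - y') -> divides d (ring_add x y - ring_add x' y').
Proof. by move=> xx yy; rewrite /ring_add opprD addrACA; exact: dividesD. Qed.
Lemma ring_opp_congr (B : comPzRingType) (d x x' y y' : B) :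
  divides d (x - x') -> divides d (y - y') -> divides d (ring_opp x y - ring_opp x' y').
Proof. by move=> xx yy; rewrite /ring_opp -opprD; exact: dividesN. Qed.

Definition Witt (A : comPzRingType) : Type := nat -> A.

Section Laws.
Variable A : comPzRingType.
Definition wadd (a b : Witt A) : Witt A := witt_op p ring_add a b.
Definition wmul (a b : Witt A) : Witt A := witt_op p ring_mul a b.
Definition wopp (a : Witt A) : Witt A := witt_op p ring_opp a a.
End Laws.

Lemma ghost_wadd (A : comPzRingType) (a b : Witt A) n :
  ghost (wadd a b) n = ghost a n + ghost b n.
Proof. by apply: ghost_witt_op => //; [exact: ring_add_natural|exact: ring_add_congr]. Qed.
Lemma ghost_wmul (A : comPzRingType) (a b : Witt A) n :
  ghost (wmul a b) n = ghost a n * ghost b n.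
Proof. by apply: ghost_witt_op => //; [exact: ring_mul_natural|exact: dividesMM]. Qed.
Lemma ghost_wopp (A : comPzRingType) (a : Witt A) n :
  ghost (wopp a) n = - ghost a n.
Proof. by apply: ghost_witt_op => //; [exact: ring_opp_natural|exact: ring_opp_congr]. Qed.

Let natD := witt_natural_op p ring_add.
Let natM := witt_natural_op p ring_mul.
Let natN F (Fn : witt_natural F) := witt_natural_op p ring_opp Fn Fn.
Let nat1 := witt_natural1.
Let nat2 := witt_natural2.
Let nat3 := witt_natural3.
Let natT := witt_natural_teich.

Lemma waddA (A : comPzRingType) : associative (@wadd A).
Proof.
apply: (witt_natural_ext p_pr (natD nat1 (natD nat2 nat3)) (natD (natD nat1 nat2) nat3)).
by move=> *; rewrite !ghost_wadd addrA.
Qed.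

Lemma waddC (A : comPzRingType) : commutative (@wadd A).
Proof.
move=> a b; apply: (witt_natural_ext p_pr (natD nat1 nat2) (natD nat2 nat1) _ a b a).
by move=> *; rewrite !ghost_wadd addrC.
Qed.

Lemma wadd0 (A : comPzRingType) : left_id (witt_teich 0) (@wadd A).
Proof.
move=> a; apply: (witt_natural_ext p_pr (natD (natT (fun _ _ f => rmorph0 f)) nat1) nat1 _ a a a).
by move=> *; rewrite !ghost_wadd (ghost_teich p_pr) expr0n expn_eq0 (gtn_eqF (prime_gt0 p_pr)) add0r.
Qed.

Lemma waddN (A : comPzRingType) : left_inverse (witt_teich 0) (@wopp A) (@wadd A).
Proof.
move=> a; apply: (witt_natural_ext p_pr (natD (natN nat1) nat1)
  (natT (fun _ _ f => rmorph0 f)) _ a a a).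
move=> *; rewrite [LHS]ghost_wadd [X in X + _]ghost_wopp [RHS](ghost_teich p_pr) expr0n expn_eq0.
by rewrite (gtn_eqF (prime_gt0 p_pr)) addNr.
Qed.

Lemma wmulA (A : comPzRingType) : associative (@wmul A).
Proof.
apply: (witt_natural_ext p_pr (natM nat1 (natM nat2 nat3)) (natM (natM nat1 nat2) nat3)).
by move=> *; rewrite !ghost_wmul mulrA.
Qed.

Lemma wmulC (A : comPzRingType) : commutative (@wmul A).
Proof.
move=> a b; apply: (witt_natural_ext p_pr (natM nat1 nat2) (natM nat2 nat1) _ a b a).
by move=> *; rewrite !ghost_wmul mulrC.
Qed.

Lemma wmul1 (A : comPzRingType) : left_id (witt_teich 1) (@wmul A).
Proof.
move=> a; apply: (witt_natural_ext p_pr (natM (natT (fun _ _ f => rmorph1 f)) nat1) nat1 _ a a a).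
by move=> *; rewrite !ghost_wmul (ghost_teich p_pr) expr1n mul1r.
Qed.

Lemma wmulDl (A : comPzRingType) : left_distributive (@wmul A) (@wadd A).
Proof.
apply: (witt_natural_ext p_pr (natM (natD nat1 nat2) nat3)
  (natD (natM nat1 nat3) (natM nat2 nat3))).
by move=> *; rewrite [LHS]ghost_wmul [X in X * _]ghost_wadd [RHS]ghost_wadd [X in _ = X + _]ghost_wmul [X in _ = _ + X]ghost_wmul mulrDl.
Qed.

End WittRing.

(* The proof of primality is a parameter because it is needed for the ring laws. *)
Definition WittRing (p : nat) (p_pr : prime p) (A : comPzRingType) : Type := Witt A.

Fact witt_add_key : unit. Proof. by []. Qed.
Fact witt_opp_key : unit. Proof. by []. Qed.
Fact witt_mul_key : unit. Proof. by []. Qed.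

Section WittRingInstance.
Variables (p : nat) (p_pr : prime p) (A : comPzRingType).
Local Notation W := (WittRing p_pr A).
HB.instance Definition _ := gen_eqMixin W.
HB.instance Definition _ := gen_choiceMixin W.
(* The operations are locked: otherwise failing unification problems expand them
   into polynomials. *)
Definition witt_add : W -> W -> W := locked_with witt_add_key (@wadd p A).
Definition witt_opp : W -> W := locked_with witt_opp_key (@wopp p A).
Definition witt_prod : W -> W -> W := locked_with witt_mul_key (@wmul p A).
Lemma witt_addE : witt_add = @wadd p A. Proof. exact: locked_withE. Qed.
Lemma witt_oppE : witt_opp = @wopp p A. Proof. exact: locked_withE. Qed.
Lemma witt_prodE : witt_prod = @wmul p A. Proof. exact: locked_withE. Qed.

Lemma witt_addA : associative witt_add. Proof. rewrite witt_addE; exact: waddA. Qed.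
Lemma witt_addC : commutative witt_add. Proof. rewrite witt_addE; exact: waddC. Qed.
Lemma witt_add0 : left_id (witt_teich 0) witt_add.
Proof. rewrite witt_addE; exact: wadd0. Qed.
Lemma witt_addN : left_inverse (witt_teich 0) witt_opp witt_add.
Proof. rewrite witt_addE witt_oppE; exact: waddN. Qed.
Lemma witt_prodA : associative witt_prod. Proof. rewrite witt_prodE; exact: wmulA. Qed.
Lemma witt_prodC : commutative witt_prod. Proof. rewrite witt_prodE; exact: wmulC. Qed.
Lemma witt_prod1 : left_id (witt_teich 1) witt_prod.
Proof. rewrite witt_prodE; exact: wmul1. Qed.
Lemma witt_prodDl : left_distributive witt_prod witt_add.
Proof. rewrite witt_prodE witt_addE; exact: wmulDl. Qed.

HB.instance Definition _ := GRing.isZmodule.Build W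
  witt_addA witt_addC witt_add0 witt_addN.
HB.instance Definition _ := GRing.Zmodule_isComPzRing.Build W
  witt_prodA witt_prodC witt_prod1 witt_prodDl.

Lemma wittDE (a b : W) : a + b = witt_op p ring_add a b.
Proof. by have := congr1 (fun h => h a b) witt_addE. Qed.
Lemma wittNE (a : W) : - a = witt_op p ring_opp a a.
Proof. by have := congr1 (fun h => h a) witt_oppE. Qed.
Lemma wittME (a b : W) : a * b = witt_op p ring_mul a b.
Proof. by have := congr1 (fun h => h a b) witt_prodE. Qed.

Lemma witt_mulE (a b : W) : witt_mul p a b = a * b.
Proof. by rewrite wittME; exact: witt_mul_op. Qed.

Lemma ghostD (a b : W) n : ghost p (a + b) n = ghost p a n + ghost p b n.
Proof. by rewrite wittDE; exact: ghost_wadd. Qed.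
Lemma ghostM (a b : W) n : ghost p (a * b) n = ghost p a n * ghost p b n.
Proof. by rewrite wittME; exact: ghost_wmul. Qed.
Lemma ghostN (a : W) n : ghost p (- a) n = - ghost p a n.
Proof. by rewrite wittNE; exact: ghost_wopp. Qed.

Definition teich (x : A) : W := witt_teich x.

Lemma witt0E i : (0 : W) i = 0.
Proof. by case: i. Qed.

Lemma wittD_upto (a b a' b' : W) n : (forall i, (i <= n)%N -> a i = a' i) ->
  (forall i, (i <= n)%N -> b i = b' i) -> (a + b) n = (a' + b') n.
Proof. by rewrite !wittDE; exact: witt_op_upto. Qed.
Lemma wittM_upto (a b a' b' : W) n : (forall i, (i <= n)%N -> a i = a' i) ->
  (forall i, (i <= n)%N -> b i = b' i) -> (a * b) n = (a' * b') n.
Proof. by rewrite !wittME; exact: witt_op_upto. Qed.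
End WittRingInstance.

Section WittMap.
Variables (p : nat) (p_pr : prime p) (A B : comPzRingType) (f : {rmorphism A -> B}).

Definition witt_map (a : WittRing p_pr A) : WittRing p_pr B := fun n => f (a n).

Lemma witt_map_additive : additive witt_map.
Proof.
move=> a b; rewrite !wittDE !wittNE; apply/funext => n.
apply: etrans (rmorph_witt_op p ring_add f _ _ n) _.
apply: witt_op_upto => i _ //.
exact: (rmorph_witt_op p ring_opp f).
Qed.

Lemma witt_map_multiplicative : multiplicative witt_map.
Proof.
split.
  by move=> a b; rewrite !wittME; apply/funext => n; exact: (rmorph_witt_op p ring_mul f).
by apply/funext => -[|n]; rewrite /witt_map /= ?rmorph1 ?rmorph0.
Qed.

HB.instance Definition _ := GRing.isAdditive.Build (WittRing p_pr A) (WittRing p_pr B) witt_map witt_map_additive.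
HB.instance Definition _ := GRing.isMultiplicative.Build (WittRing p_pr A) (WittRing p_pr B) witt_map witt_map_multiplicative.

Lemma witt_map_teich x : witt_map (teich p_pr x) = teich p_pr (f x).
Proof. by apply/funext => -[|n]; rewrite /witt_map /= ?rmorph0. Qed.

End WittMap.

Arguments witt_map {p} p_pr {A B} f a.

(** * Quotient maps and ideals *)

Section QuotientMap.
Variables (R : comPzRingType) (J : ideal R).

Definition qmap (x : R) : quotient_ring J := \pi_(quotient_ring J) x.

Lemma qmap_eq x y : qmap x = qmap y <-> ideal_set J (x - y).
Proof. exact: pi_quotient_eq. Qed.

Lemma qmap_surj (y : quotient_ring J) : exists x, qmap x = y.
Proof. by have [x ->] := pi_quotient_surj y; exists x. Qed.

Lemma qmap_additive : additive qmap.
Proof.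
move=> x y; apply: (addIr (qmap y)); rewrite subrK.
by apply: etrans (esym (pi_quotient_add J (x - y) y)) _; rewrite subrK.
Qed.
Lemma qmap_multiplicative : multiplicative qmap.
Proof. by split; first exact: pi_quotient_mul. Qed.

HB.instance Definition _ := GRing.isAdditive.Build R (quotient_ring J) qmap qmap_additive.
HB.instance Definition _ :=
  GRing.isMultiplicative.Build R (quotient_ring J) qmap qmap_multiplicative.

Lemma qmap0 x : qmap x = 0 <-> ideal_set J x.
Proof. by rewrite -[0](rmorph0 qmap) qmap_eq subr0. Qed.

End QuotientMap.

Section IdealTheory.
Variables (R : comPzRingType) (J : ideal R).
Lemma ideal0 : ideal_set J 0. Proof. by have [] := ideal_axiom J. Qed.
Lemma idealD x y : ideal_set J x -> ideal_set J y -> ideal_set J (x + y).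
Proof. by have [_ H _] := ideal_axiom J; exact: H. Qed.
Lemma idealMl a x : ideal_set J x -> ideal_set J (a * x).
Proof. by have [_ _ H] := ideal_axiom J; exact: H. Qed.
End IdealTheory.

Lemma ideal_ext (R : comPzRingType) (I J : ideal R) : (forall x, ideal_set I x <-> ideal_set J x) -> I = J.
Proof.
case: I J => [I aI] [J aJ] /= IJ; have E : I = J by apply/seteqP; split=> x /IJ.
by subst J; congr Ideal; exact: Prop_irrelevance.
Qed.

(** * Perfect rings *)

Definition perfect (p : nat) (A : comPzRingType) : Prop :=
  [/\ p%:R = 0 :> A, forall x : A, x ^+ p = 0 -> x = 0
    & forall y : A, exists x, x ^+ p = y].

Section CharP.
Variables (p : nat) (p_pr : prime p) (A : comPzRingType) (p0 : p%:R = 0 :> A).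

Lemma frob_expD n (x y : A) : (x + y) ^+ (p ^ n) = x ^+ (p ^ n) + y ^+ (p ^ n).
Proof.
elim: n => [|n IHn]; first by rewrite expn0 !expr1.
rewrite !expnSr !exprM IHn; have [c] := frobeniusD (x ^+ (p ^ n)) (y ^+ (p ^ n)) p_pr.
by rewrite p0 mul0r => /eqP; rewrite subr_eq0 => /eqP.
Qed.

Lemma frob_expB n (x y : A) : (x - y) ^+ (p ^ n) = x ^+ (p ^ n) - y ^+ (p ^ n).
Proof. by apply: (addIr (y ^+ (p ^ n))); rewrite -frob_expD !subrK. Qed.

End CharP.

Section Perfect.
Variables (p : nat) (p_pr : prime p) (A : comPzRingType) (perfA : perfect p A).

Lemma perfect_p0 : p%:R = 0 :> A. Proof. by case: perfA. Qed.

Lemma perfect_eq0 n (x : A) : x ^+ (p ^ n) = 0 -> x = 0.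
Proof.
have [_ inj _] := perfA; elim: n => [|n IHn]; first by rewrite expn0 expr1.
by rewrite expnSr exprM => /inj/IHn.
Qed.

Lemma perfect_inj n (x y : A) : x ^+ (p ^ n) = y ^+ (p ^ n) -> x = y.
Proof.
move=> /eqP; rewrite -subr_eq0 -(frob_expB p_pr perfect_p0) => /eqP /perfect_eq0 /eqP.
by rewrite subr_eq0 => /eqP.
Qed.

Lemma perfect_root n (y : A) : exists x, x ^+ (p ^ n) = y.
Proof.
have [_ _ sur] := perfA; elim: n y => [|n IHn] y; first by exists y; rewrite expn0 expr1.
by have [z <-] := sur y; have [x <-] := IHn z; exists x; rewrite expnSr exprM.
Qed.

Lemma perfect_reduced n (x : A) : x ^+ n = 0 -> x = 0.
Proof.
move=> xn0; apply: (@perfect_eq0 n).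
have le : (n <= p ^ n)%N by rewrite ltnW // ltn_expl // prime_gt1.
by rewrite -(subnK le) exprD xn0 mulr0.
Qed.

Lemma perfect_quotient (I : ideal A) : is_radical I -> perfect p (quotient_ring I).
Proof.
move=> radI; split.
- by rewrite -(rmorph_nat (qmap I)) perfect_p0 rmorph0.
- move=> y; have [x <-] := qmap_surj y; rewrite -rmorphXn => /qmap0 /radI Ix.
  exact/qmap0.
- move=> y; have [x <-] := qmap_surj y; have [z] := perfect_root 1 x.
  by rewrite expn1 => <-; exists (qmap I z); rewrite rmorphXn.
Qed.

End Perfect.

(** * Witt vectors over perfect rings *)

Section WittBasics.
Variables (p : nat) (p_pr : prime p) (A : comPzRingType).
Local Notation W := (WittRing p_pr A).
Implicit Types a b c : W.
Local Notation teich := (@teich p p_pr _).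

Lemma ghost0 a : ghost p a 0 = a 0%N.
Proof. by rewrite /ghost big_ord1 expn0 mul1r expr1. Qed.

Lemma wittD0 a b : (a + b) 0%N = a 0%N + b 0%N.
Proof. by have := ghostD a b 0; rewrite !ghost0. Qed.
Lemma wittM0 a b : (a * b) 0%N = a 0%N * b 0%N.
Proof. by have := ghostM a b 0; rewrite !ghost0. Qed.
Lemma wittN0 a : (- a) 0%N = - a 0%N.
Proof. by have := ghostN a 0; rewrite !ghost0. Qed.
Lemma wittB0 a b : (a - b) 0%N = a 0%N - b 0%N.
Proof. by rewrite wittD0 wittN0. Qed.

Lemma ghost_nat m n : ghost p (m%:R : W) n = m%:R.
Proof.
elim: m => [|m IHm].
  apply: etrans (ghost_teich p_pr 0 n) _.
  by rewrite expr0n expn_eq0 (gtn_eqF (prime_gt0 p_pr)).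
rewrite -!natr1 ghostD IHm; congr (_ + _).
by apply: etrans (ghost_teich p_pr 1 n) _; rewrite expr1n.
Qed.

Lemma witt_nat0 m : (m%:R : W) 0%N = m%:R.
Proof. by have := ghost_nat m 0; rewrite ghost0. Qed.

Lemma witt10 : (1 : W) 0%N = 1. Proof. exact: (witt_nat0 1). Qed.

Lemma teichM x y : teich (x * y) = teich x * teich y :> W.
Proof.
pose T (B : comPzRingType) (x : B) : witt B := witt_teich x.
pose F (B : comPzRingType) (a b c : witt B) := T B (a 0%N * b 0%N).
pose G (B : comPzRingType) (a b c : witt B) :=
  witt_op p ring_mul (T B (a 0%N)) (T B (b 0%N)).
suff H : F A = G A by rewrite wittME; exact: (congr1 (fun h => h (teich x) (teich y) (teich y)) H).
apply/funext => a; apply/funext => b; apply/funext => c; move: A a b c.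
apply: (witt_natural_ext p_pr).
- split=> [A' B f a b c [|n]|A' a b c a' b' c' [|n] H] //=; rewrite ?rmorph0 ?rmorphM //.
  by have [-> -> _] := H 0%N (leq0n _).
- apply: witt_natural_op; split=> [A' B f a b c [|n]|A' a b c a' b' c' [|n] H] //=;
    rewrite ?rmorph0 ?rmorphM //; by have [? ? _] := H 0%N (leq0n _).
- move=> B a b c n _; apply: etrans (ghost_teich p_pr _ n) _.
  by rewrite [RHS]ghost_wmul // !(ghost_teich p_pr) exprMn.
Qed.

Lemma teich1 : teich 1 = 1 :> W. Proof. by []. Qed.
Lemma teich0 : teich 0 = 0 :> W. Proof. by []. Qed.

Definition witt_tail a : W := fun n => if n is 0%N then 0 else a n.

Lemma witt_head_tail a : a = teich (a 0%N) + witt_tail a.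
Proof.
pose T (B : comPzRingType) (x : B) : witt B := witt_teich x.
pose S (B : comPzRingType) (a : witt B) : witt B := fun n => if n is 0%N then 0 else a n.
pose F (B : comPzRingType) (a b c : witt B) := a.
pose G (B : comPzRingType) (a b c : witt B) := witt_op p ring_add (T B (a 0%N)) (S B a).
suff H : F A = G A by rewrite wittDE; exact: (congr1 (fun h => h a a a) H).
apply/funext => {}a; apply/funext => b; apply/funext => c; move: A a b c.
apply: (witt_natural_ext p_pr).
- exact: witt_natural1.
- apply: witt_natural_op; split=> [A' B f ? ? ? [|n]|A' ? ? ? ? ? ? [|n] H] //=;
    rewrite ?rmorph0 //; try by have [? ? _] := H 0%N (leq0n _).
  by have [? ? _] := H n.+1 (leqnn _).
- move=> B a' ? ? n _; rewrite /F /G [RHS](ghost_wadd p_pr) (ghost_teich p_pr) /ghost !big_ord_recl /=.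
  rewrite expn0 !mul1r subn0 expr0n expn_eq0 (gtn_eqF (prime_gt0 p_pr)) add0r.
  by congr (_ + _); apply: eq_bigr => i _; rewrite /bump.
Qed.

End WittBasics.

Section WittCharP.
Variables (p : nat) (p_pr : prime p) (A : comPzRingType).
Local Notation W := (WittRing p_pr A).
Implicit Types a b c : W.
Local Notation teich := (@teich p p_pr _).

(** Multiplication by $p$ is Verschiebung after Frobenius. On a lift without $p$-torsion the two
    sides have ghost components differing by $p^{m+1} a'_m$, so their components agree modulo
    $p$. *)
Lemma wittMp (p0 : p%:R = 0 :> A) a n :
  (p%:R * a) n = if n is k.+1 then a k ^+ p else 0.
Proof.
have [k [f [a' [b' [c' fa]]]]] := witt_lift3 n a a a.
pose x : WittRing p_pr _ := p%:R * (a' : WittRing p_pr _).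
pose y : witt {mpoly int[k]} := fun n => if n is m.+1 then a' m ^+ p else 0.
have gxy m : divides (p ^ m.+1)%:R (ghost p x m - ghost p y m).
  rewrite ghostM ghost_nat; exists (a' m).
  rewrite ghostS mulrDr mulr_sumr /ghost big_ord_recl /= subn0 expr0n expn_eq0.
  rewrite (gtn_eqF (prime_gt0 p_pr)) mulr0 add0r addrAC.
  rewrite [X in _ + X]mulrA -natrM -expnS -[RHS]add0r; congr (_ + _).
  rewrite -sumrB big1 // => i _; rewrite /bump /= add1n -exprM -expnS -subnSK //.
  by rewrite mulrA -natrM -expnS subrr.
have [c] := ghost_congr_inv p_pr (x := x) (y := y) (@mpoly_torsion_free p k p_pr)
   (fun m _ => gxy m) (leqnn n).
move=> /(congr1 f); rewrite rmorphB rmorphM rmorph_nat p0 mul0r => /eqP; rewrite subr_eq0 => /eqP E.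
transitivity (f (x n)).
  transitivity ((p%:R * witt_map p_pr f a') n).
    by apply: wittM_upto => // i /fa [].
  by rewrite -(rmorph_nat (witt_map p_pr f)) -rmorphM.
rewrite E /y; case: (n) fa => [|m] fa; first by rewrite rmorph0.
by rewrite rmorphXn; have [-> _ _] := fa m (leqnSn _).
Qed.

Lemma wittMpX (p0 : p%:R = 0 :> A) m a n :
  (p%:R ^+ m * a) n = if (n < m)%N then 0 else a (n - m)%N ^+ (p ^ m).
Proof.
elim: m n => [|m IHm] n; first by rewrite expr0 mul1r subn0 expn0 expr1.
rewrite exprS -mulrA wittMp //; case: n => [//|n].
rewrite IHm ltnS subSS; case: ifP => _; first by rewrite expr0n (gtn_eqF (prime_gt0 p_pr)).
by rewrite expnSr exprM.
Qed.

Lemma wittD_pX (p0 : p%:R = 0 :> A) m a b n : (n < m)%N ->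
  (a + p%:R ^+ m * b) n = a n.
Proof.
move=> nm; rewrite -[in RHS](addr0 a); apply: wittD_upto => // i lein.
by rewrite wittMpX // (leq_ltn_trans lein nm) witt0E.
Qed.

(** Reduce modulo [s], where [teich s] becomes zero. *)
Lemma witt_teich_mod s a b i : divides s ((a + teich s * b) i - a i).
Proof.
apply/(qmap0 (principal_ideal s)).
have qs : qmap (principal_ideal s) s = 0 by apply/qmap0; exists 1; rewrite mulr1.
have : witt_map p_pr (qmap (principal_ideal s)) (a + teich s * b) i
     = witt_map p_pr (qmap (principal_ideal s)) a i.
  by rewrite rmorphD rmorphM /= witt_map_teich /= qs teich0 mul0r addr0.
by rewrite /witt_map rmorphB /= => ->; rewrite subrr.
Qed.

End WittCharP.

Lemma geometric_sum (R : comPzRingType) (q u : R) n :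
  (1 - q) * u - 1 = (1 - q) * (u - \sum_(i < n) q ^+ i) - q ^+ n.
Proof.
rewrite mulrBr -addrA; congr (_ + _).
have -> : (1 - q) * (\sum_(i < n) q ^+ i) = 1 - q ^+ n.
  by rewrite -[RHS]opprB subrX1 -mulNr opprB.
by rewrite opprB addrAC subrr add0r.
Qed.

Section WittPerfect.
Variables (p : nat) (p_pr : prime p) (A : comPzRingType) (perfA : perfect p A).
Local Notation W := (WittRing p_pr A).
Implicit Types a b c : W.
Local Notation teich := (@teich p p_pr _).
Let p0 := perfect_p0 perfA.

Lemma witt_p_tf a : p%:R * a = 0 -> a = 0.
Proof.
move=> pa; apply/funext => n; rewrite witt0E.
have := congr1 (fun x : W => x n.+1) pa; rewrite wittMp // witt0E.
by rewrite -[X in _ ^+ X]expn1 => /(perfect_eq0 perfA).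
Qed.

Lemma witt_pX_tf n a : p%:R ^+ n * a = 0 -> a = 0.
Proof.
by elim: n => [|n IHn]; [rewrite expr0 mul1r | rewrite exprS -mulrA => /witt_p_tf].
Qed.

Lemma witt_pX_inj n a b : p%:R ^+ n * a = p%:R ^+ n * b -> a = b.
Proof.
by move=> /eqP; rewrite -subr_eq0 -mulrBr => /eqP /witt_pX_tf /eqP; rewrite subr_eq0 => /eqP.
Qed.

Lemma witt_p_inj a b : p%:R * a = p%:R * b -> a = b.
Proof. exact: (@witt_pX_inj 1). Qed.

Lemma witt_div_pX n a : (forall i, (i < n)%N -> a i = 0) -> divides (p%:R ^+ n) a.
Proof.
move=> a0; have /choice [c cP] := perfect_root perfA n.
exists (fun i => c (a (i + n)%N)); apply/funext => i.
rewrite wittMpX //; case: ltnP => [/a0 //|le]; by rewrite cP subnK.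
Qed.

Lemma witt_div_p a : a 0%N = 0 -> exists b, a = p%:R * b.
Proof. by move=> a0; apply: (@witt_div_pX 1) => -[]. Qed.

Lemma witt_decomp a : exists b, a = teich (a 0%N) + p%:R * b.
Proof. by have [b bE] := witt_div_p (a := witt_tail a) erefl; exists b; rewrite -bE; exact: witt_head_tail. Qed.

Lemma witt_sep a : (forall n, divides (p%:R ^+ n) a) -> a = 0.
Proof.
move=> H; apply/funext => n; rewrite witt0E; have [b ->] := H n.+1.
by rewrite wittMpX // ltnSn.
Qed.

Lemma witt_sum (b : nat -> W) : exists u : W, forall n, 
  divides (p%:R ^+ n) (u - \sum_(i < n) p%:R ^+ i * b i).
Proof.
pose s n := \sum_(i < n) p%:R ^+ i * b i.
(* Component $k$ of the partial sums is constant from stage $k+1$ on, so the diagonal is the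
   limit. *)
have sE n m k : (k < n)%N -> s (n + m)%N k = s n k.
  move=> kn; elim: m => [|m IHm]; first by rewrite addn0.
  by rewrite addnS /s big_ord_recr /= wittD_pX ?(leq_trans kn (leq_addr _ _)).
exists (fun k => s k.+1 k) => n; apply: witt_div_pX => i lt_in.
rewrite -/(s n) -[0](witt0E p_pr A i) -(subrr (s n)).
apply: wittD_upto => // j le_ji.
by rewrite -[in RHS](subnKC (leq_ltn_trans le_ji lt_in)) sE.
Qed.

(** Multiplication by [teich x] turns [a] into $1 - pc$, which a geometric series inverts. *)
Lemma witt_unit a (x : A) : a 0%N * x = 1 -> exists b : W, a * b = 1.
Proof.
move=> ax; have /witt_div_p [c cE] : (1 - a * teich x) 0%N = 0.
  by rewrite wittB0 wittM0 witt10 ax subrr.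
have [u uP] := witt_sum (fun i => c ^+ i); exists (teich x * u).
have -> : a * (teich x * u) = (1 - p%:R * c) * u by rewrite -cE mulrA; congr (_ * u); ring.
suff : (1 - p%:R * c) * u - 1 = 0 by move/eqP; rewrite subr_eq0 => /eqP.
apply: witt_sep => n; have [d] := uP n.
under eq_bigr do rewrite -exprMn.
rewrite (geometric_sum _ _ n) => ->.
exists ((1 - p%:R * c) * d - c ^+ n).
by rewrite mulrBr exprMn mulrCA.
Qed.

End WittPerfect.

Section WittMapTheory.
Variables (p : nat) (p_pr : prime p) (A B : comPzRingType) (f : {rmorphism A -> B}).

Lemma witt_map_eq0 (a : WittRing p_pr A) : witt_map p_pr f a = 0 <-> forall i, f (a i) = 0.
Proof.
split=> [H i|H]; last by apply/funext => i; rewrite witt0E; exact: H.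
by have := congr1 (fun x : WittRing p_pr B => x i) H; rewrite witt0E.
Qed.

Lemma witt_map_surj : (forall y, exists x, f x = y) ->
  forall b : WittRing p_pr B, exists a : WittRing p_pr A, witt_map p_pr f a = b.
Proof.
move=> /choice [g gP] b; exists (fun i => g (b i)).
by apply/funext => i; exact: gP.
Qed.

End WittMapTheory.

Lemma witt_ideal_kernel (p : nat) (p_pr : prime p) (A : comPzRingType) (I : ideal A)
    (a : WittRing p_pr A) :
  (forall i, ideal_set I (a i)) <-> witt_map p_pr (qmap I) a = 0.
Proof.
by rewrite witt_map_eq0; split=> H i; [apply/qmap0; exact: H | apply/(qmap0 I); exact: H].
Qed.

Section QuotientLift.
Variables (R S : comPzRingType) (J : ideal R) (g : {rmorphism R -> S}).
Hypothesis gJ : forall x, ideal_set J x -> g x = 0.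

Definition quot_lift_subdef (_ : forall x, ideal_set J x -> g x = 0)
  (y : quotient_ring J) : S := g (repr y).
Local Notation quot_lift := (quot_lift_subdef gJ).

Lemma quot_liftE x : quot_lift (qmap J x) = g x.
Proof.
apply/eqP; rewrite -subr_eq0 -rmorphB; apply/eqP/gJ/qmap_eq.
by rewrite /qmap reprK.
Qed.

Lemma quot_lift_additive : additive quot_lift.
Proof.
move=> x y; have [a <-] := qmap_surj x; have [b <-] := qmap_surj y.
by rewrite -rmorphB !quot_liftE rmorphB.
Qed.

Lemma quot_lift_multiplicative : multiplicative quot_lift.
Proof.
split=> [x y|]; last by rewrite -(rmorph1 (qmap J)) quot_liftE rmorph1.
have [a <-] := qmap_surj x; have [b <-] := qmap_surj y.
by rewrite -rmorphM !quot_liftE rmorphM.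
Qed.

HB.instance Definition _ := GRing.isAdditive.Build (quotient_ring J) S quot_lift quot_lift_additive.
HB.instance Definition _ :=
  GRing.isMultiplicative.Build (quotient_ring J) S quot_lift quot_lift_multiplicative.
Definition quot_lift_rmorphism : {rmorphism quotient_ring J -> S} := quot_lift.
End QuotientLift.

(** * Perfect closure *)

Section PerfectClosure.
Variables (p : nat) (p_pr : prime p) (B : comPzRingType) (p0 : p%:R = 0 :> B).

Definition eventually_frob : {pred nat -> B} :=
  fun b => `[< exists N, forall n, (N <= n)%N -> b n.+1 = b n ^+ p >].

Lemma eventually_frob_subring : subring_closed eventually_frob.
Proof.
split=> [|x y|x y]; rewrite ?unfold_in.
- by apply/asboolP; exists 0%N => n _; rewrite [RHS]expr1n.
- move=> /asboolP[N xP] /asboolP[M yP]; apply/asboolP; exists (maxn N M) => n.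
  rewrite geq_max => /andP[/xP xn /yP yn].
  rewrite -[LHS]/(x n.+1 - y n.+1) -[X in X ^+ p]/(x n - y n) xn yn.
  by have := frob_expB p_pr p0 1 (x n) (y n); rewrite !expn1.
- move=> /asboolP[N xP] /asboolP[M yP]; apply/asboolP; exists (maxn N M) => n.
  rewrite geq_max => /andP[/xP xn /yP yn].
  by rewrite -[LHS]/(x n.+1 * y n.+1) -[X in X ^+ p]/(x n * y n) xn yn exprMn.
Qed.

End PerfectClosure.

(* The sequence b represents the element b_n^(1/p^n), for n large. *)
Record perf_seq (p : nat) (p_pr : prime p) (B : comPzRingType) (p0 : p%:R = 0 :> B) :=
  PerfSeq { perf_val :> nat -> B; perf_valP : perf_val \in @eventually_frob p B }.

Section PerfectClosureRing.
Variables (p : nat) (p_pr : prime p) (B : comPzRingType) (p0 : p%:R = 0 :> B).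
Local Notation S := (perf_seq p_pr p0).

HB.instance Definition _ := [isSub for @perf_val p p_pr B p0].
HB.instance Definition _ := [Choice of S by <:].
HB.instance Definition _ := @GRing.SubChoice_isSubComPzRing.Build (nat -> B)
  (@eventually_frob p B) S (eventually_frob_subring p_pr p0).

Lemma perf_seqP (x : S) : exists N, forall n, (N <= n)%N -> x n.+1 = x n ^+ p.
Proof. by have := perf_valP x; rewrite unfold_in => /asboolP. Qed.

Lemma perf_seqD (x y : S) n : (x + y) n = x n + y n. Proof. by []. Qed.
Lemma perf_seqB (x y : S) n : (x - y) n = x n - y n. Proof. by []. Qed.
Lemma perf_seqM (x y : S) n : (x * y) n = x n * y n. Proof. by []. Qed.
Lemma perf_seqX (x : S) k n : (x ^+ k) n = x n ^+ k.
Proof. by elim: k => // k IHk; rewrite !exprS perf_seqM IHk. Qed.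
Lemma perf_seq_nat k n : (k%:R : S) n = k%:R.
Proof. by elim: k => // k IHk; rewrite -!natr1 perf_seqD IHk. Qed.

Definition eventually_zero : set S := [set x | exists N, forall n, (N <= n)%N -> x n = 0].

Lemma eventually_zero_ideal : is_ideal eventually_zero.
Proof.
split; first by exists 0%N.
- move=> x y [N xN] [M yM]; exists (maxn N M) => n.
  by rewrite geq_max => /andP[/xN xn /yM yn]; rewrite perf_seqD xn yn addr0.
- by move=> a x [N xN]; exists N => n /xN xn; rewrite perf_seqM xn mulr0.
Qed.

(** The colimit of [B] along Frobenius. In this form an equality of classes holds at some finite
    level, which is how identities over the perfection of a polynomial ring become identities
    between polynomials. *)
Definition perf : Type := quotient_ring (Ideal eventually_zero_ideal).
HB.instance Definition _ := GRing.ComPzRing.on perf.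
Definition perf_class : {rmorphism S -> perf} := qmap (Ideal eventually_zero_ideal).

Lemma perf_class_eq x y :
  perf_class x = perf_class y -> exists N, forall n, (N <= n)%N -> x n = y n.
Proof.
move=> /qmap_eq [N H]; exists N => n /H; rewrite perf_seqB => /eqP.
by rewrite subr_eq0 => /eqP.
Qed.

Lemma perf_perfect : perfect p perf.
Proof.
split.
- rewrite -(rmorph_nat perf_class); apply/qmap0; exists 0%N => n _.
  by rewrite perf_seq_nat.
- move=> y; have [x <-] := qmap_surj y; rewrite -rmorphXn => /qmap0 [N xN].
  have [M xM] := perf_seqP x; apply/qmap0; exists (maxn N M).+1 => -[//|n].
  by rewrite ltnS geq_max => /andP[/xN xn /xM ->]; rewrite -perf_seqX.
- move=> y; have [x <-] := qmap_surj y; have [N xN] := perf_seqP x.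
  have zP : (fun n => x n.-1) \in @eventually_frob p B.
    by rewrite unfold_in; apply/asboolP; exists N.+1 => -[//|n] /xN.
  exists (perf_class (PerfSeq p_pr p0 zP)); rewrite -rmorphXn; apply/qmap_eq.
  by exists N.+1 => -[//|n] /xN xn; rewrite perf_seqB perf_seqX /= xn subrr.
Qed.

Lemma perf_in_subproof (x : B) : (fun n => x ^+ (p ^ n)) \in @eventually_frob p B.
Proof. by rewrite unfold_in; apply/asboolP; exists 0%N => n _; rewrite -exprM expnSr. Qed.

Definition perf_in_seq (x : B) : S := PerfSeq p_pr p0 (perf_in_subproof x).
Definition perf_in (x : B) : perf := perf_class (perf_in_seq x).

Lemma perf_in_additive : additive perf_in.
Proof.
move=> x y; rewrite /perf_in -rmorphB; congr (perf_class _).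
by apply/val_inj/funext => n /=; rewrite frob_expB.
Qed.
Lemma perf_in_multiplicative : multiplicative perf_in.
Proof.
split=> [x y|].
  rewrite /perf_in -rmorphM; congr (perf_class _).
  by apply/val_inj/funext => n /=; rewrite exprMn.
rewrite /perf_in -(rmorph1 perf_class); congr (perf_class _).
by apply/val_inj/funext => n /=; rewrite expr1n.
Qed.
HB.instance Definition _ := GRing.isAdditive.Build B perf perf_in perf_in_additive.
HB.instance Definition _ := GRing.isMultiplicative.Build B perf perf_in perf_in_multiplicative.

End PerfectClosureRing.

Section PerfMap.
Variables (p : nat) (p_pr : prime p) (B C : comPzRingType).
Variables (pB : p%:R = 0 :> B) (pC : p%:R = 0 :> C) (f : {rmorphism B -> C}).

Lemma perf_map_seq_subproof (x : perf_seq p_pr pB) :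
  (fun n => f (x n)) \in @eventually_frob p C.
Proof.
have [N xN] := perf_seqP x; rewrite unfold_in; apply/asboolP; exists N => n /xN ->.
by rewrite rmorphXn.
Qed.
Definition perf_map_seq (x : perf_seq p_pr pB) : perf p_pr pC :=
  perf_class p_pr pC (PerfSeq p_pr pC (perf_map_seq_subproof x)).

Lemma perf_map_seq_additive : additive perf_map_seq.
Proof.
move=> x y; rewrite /perf_map_seq -rmorphB; congr (perf_class _ _ _).
by apply/val_inj/funext => n; exact: (rmorphB f).
Qed.
Lemma perf_map_seq_multiplicative : multiplicative perf_map_seq.
Proof.
split=> [x y|].
  rewrite /perf_map_seq -rmorphM; congr (perf_class _ _ _).
  by apply/val_inj/funext => n; exact: (rmorphM f).
rewrite /perf_map_seq -(rmorph1 (@perf_class p p_pr C pC)); congr (perf_class _ _ _).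
by apply/val_inj/funext => n; exact: (rmorph1 f).
Qed.
HB.instance Definition _ := GRing.isAdditive.Build (perf_seq p_pr pB) (perf p_pr pC) perf_map_seq perf_map_seq_additive.
HB.instance Definition _ := GRing.isMultiplicative.Build (perf_seq p_pr pB) (perf p_pr pC) perf_map_seq perf_map_seq_multiplicative.

Lemma perf_map_seq_zero x : eventually_zero x -> perf_map_seq x = 0.
Proof. by move=> [N xN]; apply/qmap0; exists N => n /xN /= ->; rewrite rmorph0. Qed.

Definition perf_map : {rmorphism perf p_pr pB -> perf p_pr pC} :=
  quot_lift_rmorphism (J := Ideal (eventually_zero_ideal p_pr pB)) perf_map_seq_zero.

Lemma perf_map_class x :
  perf_map (perf_class p_pr pB x) = perf_class p_pr pC (PerfSeq p_pr pC (perf_map_seq_subproof x)).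
Proof. exact: quot_liftE. Qed.

Lemma perf_map_in x : perf_map (perf_in p_pr pB x) = perf_in p_pr pC (f x).
Proof.
rewrite perf_map_class; congr (perf_class _ _ _); apply/val_inj/funext => n /=.
by rewrite rmorphXn.
Qed.
End PerfMap.

(** * Tilted approximation *)

Definition witt_delta (p : nat) (p_pr : prime p) (A : comPzRingType) (t : A)
  (e : WittRing p_pr A) : WittRing p_pr A := p%:R - teich p_pr t * e.

Lemma witt_map_delta (p : nat) (p_pr : prime p) (A B : comPzRingType)
    (f : {rmorphism A -> B}) t (e : WittRing p_pr A) :
  witt_map p_pr f (witt_delta t e) = witt_delta (f t) (witt_map p_pr f e).
Proof. by rewrite /witt_delta rmorphB rmorphM rmorph_nat /= witt_map_teich. Qed.

(** One step of the approximation, with [F], [G], [H], [Y] Teichmueller elements and $\delta = P -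
    Te$: modulo $\delta$ the leading error $PY$ equals $TeY$, whose principal part [G] merges with
    [F] into [H] at the cost of a carry $Pk$. *)
Lemma approx_step (R : comPzRingType) (P T z F a y Y y2 e E e2 G H k : R) :
  z = F + P * y + (P - T * e) * a -> y = Y + P * y2 -> e = E + P * e2 ->
  G = E * (T * Y) -> F + G = H + P * k ->
  z = H + P * (k + e2 * (T * Y) + T * e * y2) + (P - T * e) * (a + Y + P * y2).
Proof.
move=> -> -> -> -> FG; have -> : F = H + P * k - E * (T * Y) by rewrite -FG addrK.
ring.
Qed.

Section TiltedApproximation.
Variables (p : nat) (p_pr : prime p) (A : comPzRingType) (perfA : perfect p A).
Local Notation W := (WittRing p_pr).
Local Notation teich := (@teich p p_pr _).
Variables (t : A) (e : W A).

Lemma teich_add_carry (B : comPzRingType) (perfB : perfect p B) (f g : B) :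
  exists k : W B, teich f + teich g = teich (f + g) + p%:R * k.
Proof.
have [|k kE] := witt_div_p perfB (a := teich f + teich g - teich (f + g)).
  by rewrite wittB0 wittD0 /= subrr.
by exists k; rewrite -kE [RHS]addrC subrK.
Qed.

Lemma teich_divides_tail (B : comPzRingType) (perfB : perfect p B) s (y y2 : W B) :
  y = teich (y 0%N) + p%:R * y2 -> divides (teich s) y ->
  divides s (y 0%N) /\ divides (teich s) y2.
Proof.
move=> yE [b bE]; have y0 : y 0%N = s * b 0%N by rewrite bE wittM0.
split; first by exists (b 0%N).
have [b2 b2E] := witt_decomp perfB b; exists b2.
apply: (witt_p_inj perfB); apply: (addrI (teich (y 0%N))); rewrite -yE y0 {1}bE {1}b2E.
by rewrite mulrDr teichM mulrCA.
Qed.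

(** Teichmueller addition is homogeneous: scaling both summands by $s$ scales the carry by $[s]$. *)
Lemma teich_divides_carry (B : comPzRingType) (perfB : perfect p B) s (f g : B) (k : W B) :
  teich f + teich g = teich (f + g) + p%:R * k ->
  divides s f -> divides s g -> divides (teich s) k.
Proof.
move=> kE [f1 fE] [g1 gE]; have [k1 k1E] := teich_add_carry perfB f1 g1.
exists k1; apply: (witt_p_inj perfB); apply: (addrI (teich (f + g))).
by rewrite -kE fE gE -mulrDr !teichM mulrCA -!mulrDr k1E.
Qed.

(* The approximation lemma of perfectoid theory: f approximates the element z modulo
   delta, with an error that is small wherever f is. *)
Lemma tilted_approximation (z : W A) n : exists (f : A) (y a : W A) (h : A),
  [/\ z = teich f + p%:R * y + witt_delta t e * a, f = z 0%N + t * h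
    & forall (B : comPzRingType) (psi : {rmorphism A -> B}), perfect p B ->
        forall r, (r <= n)%N -> divides (psi t ^+ r) (psi f) ->
        divides (teich (psi t ^+ r)) (witt_map p_pr psi y)].
Proof.
elim: n => [|n [f [y [a [h [zE fE fP]]]]]].
  have [y yE] := witt_decomp perfA z.
  exists (z 0%N), y, 0, 0; split; first by rewrite mulr0 addr0.
    by rewrite mulr0 addr0.
  move=> B psi _ [|//] _ _; exists (witt_map p_pr psi y).
  by rewrite expr0 teich1 mul1r.
have [y2 y2E] := witt_decomp perfA y.
have [e2 e2E] := witt_decomp perfA e.
(* Modulo $\delta$ the leading digit of the error $py$ contributes $[g]$, which is absorbed into the
   approximation. *)
set g := e 0%N * (t * y 0%N).
have [k kE] := teich_add_carry perfA f g.
exists (f + g), (k + e2 * (teich t * teich (y 0%N)) + teich t * e * y2).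
exists (a + teich (y 0%N) + p%:R * y2), (h + e 0%N * y 0%N).
have gE : teich g = teich (e 0%N) * (teich t * teich (y 0%N)) by rewrite !teichM.
split; first exact: approx_step zE y2E e2E gE kE.
  by rewrite fE /g mulrDr -addrA [t * (_ * _)]mulrCA.
move=> B psi perfB [|r].
  move=> _ _; eexists; by rewrite expr0 teich1 mul1r.
rewrite ltnS => lern; rewrite rmorphD => -[c cE].
have step s : (s <= r)%N -> divides (psi t ^+ s) (psi f) ->
    divides (psi t ^+ s) (psi (y 0%N)) /\ divides (teich (psi t ^+ s)) (witt_map p_pr psi y2).
  move=> lesr /(fP B psi perfB s (leq_trans lesr lern)) D.
  have := teich_divides_tail perfB (y := witt_map p_pr psi y) (y2 := witt_map p_pr psi y2) _ D.
  by apply; rewrite {1}y2E rmorphD rmorphM rmorph_nat /= witt_map_teich.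
have divg s : divides (psi t ^+ s) (psi (y 0%N)) -> divides (psi t ^+ s.+1) (psi g).
  move=> [d dE]; exists (psi (e 0%N) * d).
  by rewrite /g !rmorphM dE exprS; ring.
(* Smallness of $f+g$ has to be passed back to $f$. If $t^s \mid f$, the hypothesis on $f$ gives
   $t^s \mid y_0$, hence $t^{s+1} \mid g$; since $t^{r+1} \mid f+g$, one more power of $t$ divides
   $f$. *)
have divf s : (s <= r.+1)%N -> divides (psi t ^+ s) (psi f).
  elim: s => [_|s IHs lts]; first by exists (psi f); rewrite expr0 mul1r.
  have [ys _] := step s lts (IHs (ltnW lts)).
  have -> : psi f = psi t ^+ r.+1 * c - psi g by rewrite -cE addrK.
  apply: dividesB; last exact: divg.
  by rewrite -(subnKC lts) exprD -mulrA; eexists.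
have [yr y2r] := step r (leqnn r) (divf r (leqnSn r)).
rewrite !rmorphD !rmorphM /= !witt_map_teich.
apply: dividesD; first apply: dividesD.
- apply: (teich_divides_carry perfB (f := psi f) (g := psi g)).
  + have := congr1 (witt_map p_pr psi) kE.
    by rewrite !rmorphD rmorphM rmorph_nat /= !witt_map_teich rmorphD.
  + exact: divf.
  + exact: divg.
- apply: dividesMl; rewrite -teichM; have [d ->] := yr.
  by exists (teich d); rewrite -teichM mulrA -exprS.
- have [d ->] := y2r; exists (witt_map p_pr psi e * d).
  by rewrite exprS teichM -!mulrA; congr (_ * _); rewrite mulrCA.
Qed.

(* In a perfect ring where [T] is a multiple u of delta up to p t^N, the root T is
   divisible by t, hence u is divisible by t, hence T by t^2, and so on. *)
Lemma teich_delta_divides (T : A) (u b : W A) N :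
  teich T = witt_delta t e * u + p%:R * (teich (t ^+ N) * b) ->
  divides (teich (t ^+ N)) u.
Proof.
move=> TE; suff H j : (j <= N)%N -> divides (teich (t ^+ j)) u by exact: H.
elim: j => [_|j IHj ltjN]; first by exists u; rewrite expr0 teich1 mul1r.
have [v vE] := IHj (ltnW ltjN).
(* With $u = [t^j]v$, the components of index 0 give $T = t^{j+1} T_1$. Then $[T_1] + ev$ has head
   zero, so it is a multiple of $p$, and $p$ can be cancelled. *)
pose T1 := - (e 0%N * v 0%N).
have TT : T = t * (t ^+ j * T1).
  have := congr1 (fun x : W A => x 0%N) TE.
  rewrite /witt_delta wittD0 !wittM0 wittB0 wittM0 witt_nat0 (perfect_p0 perfA) vE wittM0 /= => ->.
  by rewrite /T1; ring.
have [|q qE] := witt_div_p perfA (a := teich T1 + e * v).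
  by rewrite wittD0 wittM0 /= addNr.
have {}TE : teich t * (teich (t ^+ j) * (teich T1 + e * v))
    = p%:R * (u + teich (t ^+ N) * b).
  have -> : teich t * (teich (t ^+ j) * (teich T1 + e * v))
      = teich (t * (t ^+ j * T1)) + teich t * e * (teich (t ^+ j) * v).
    by rewrite !teichM; ring.
  by rewrite -TT -vE TE /witt_delta; ring.
have E : teich (t ^+ j.+1) * q = u + teich (t ^+ N) * b.
  apply: (witt_p_inj perfA); rewrite -TE qE exprS teichM; ring.
have NE : teich (t ^+ N) = teich (t ^+ j.+1) * teich (t ^+ (N - j.+1)).
  by rewrite -teichM -exprD subnKC.
exists (q - teich (t ^+ (N - j.+1)) * b); rewrite mulrBr mulrA -NE E.
by rewrite addrK.
Qed.

End TiltedApproximation.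

(** * Purity of the cover given by a tilted approximation *)

(** The radical of $(f)$, written with $p$-power exponents so that additivity is the Frobenius
    identity. *)
Lemma ideal_closure_radical (p : nat) (p_pr : prime p) (A : comPzRingType)
    (p0 : p%:R = 0 :> A) (f : A) :
  is_ideal [set a | exists n, divides f (a ^+ (p ^ n))].
Proof.
split.
- by exists 0%N; rewrite expn0 expr1; exact: divides0.
- move=> x y [n xn] [m ym]; exists (n + m)%N; rewrite (frob_expD p_pr p0).
  have p_gt0 k : (0 < p ^ k)%N by rewrite expn_gt0 prime_gt0.
  apply: dividesD.
    rewrite expnD exprM -(prednK (p_gt0 m)) exprS; exact: dividesMr.
  rewrite addnC expnD exprM -(prednK (p_gt0 n)) exprS; exact: dividesMr.
- by move=> a x [n xn]; exists n; rewrite exprMn; exact: dividesMl.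
Qed.

Definition root_ideal (p : nat) (p_pr : prime p) (A : comPzRingType)
  (p0 : p%:R = 0 :> A) (f : A) : ideal A := Ideal (ideal_closure_radical p_pr p0 f).

Lemma root_ideal_radical (p : nat) (p_pr : prime p) (A : comPzRingType)
  (p0 : p%:R = 0 :> A) (f : A) : is_radical (root_ideal p_pr p0 f).
Proof.
move=> x k [n xn]; exists (k + n)%N.
have le : (k <= p ^ k)%N by rewrite ltnW // ltn_expl // prime_gt1.
rewrite expnD -(subnK le) mulnDl exprD [x ^+ (k * _)]exprM.
exact: dividesMl.
Qed.

Import Pdiv.Ring Pdiv.RingMonic.

Section Purity.
Variables (D M : comNzRingType) (i : {rmorphism D -> M}).
Variables (Q : nat) (w xi : D) (h : {poly D}).
Hypothesis Q_gt0 : (0 < Q)%N.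

(** The divisor is monic only modulo [w], as the degree of [h] is arbitrary. Dividing the error by
    the monic part $X^Q - \xi$ leaves a new error with one more factor [w]. *)
Lemma perturbed_division K (d : {poly D}) : exists r q s : {poly D},
  (size r <= Q)%N /\ d = r + ('X^Q - xi%:P + w%:P * h) * q + w%:P ^+ K * s.
Proof.
elim: K => [|K [r [q [s [szr ->]]]]].
  by exists 0, 0, d; rewrite size_poly0 expr0 mul1r mulr0 !add0r.
have mon : 'X^Q - xi%:P \is monic by rewrite monicXnsubC.
exists (r + w%:P ^+ K * rmodp s ('X^Q - xi%:P)).
exists (q + w%:P ^+ K * rdivp s ('X^Q - xi%:P)).
exists (- h * rdivp s ('X^Q - xi%:P)); split.
  apply: leq_trans (size_polyD _ _) _; rewrite geq_max szr -rmorphXn mul_polyC.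
  apply: leq_trans (size_scale_leq _ _) _.
  by rewrite -ltnS -(size_XnsubC xi Q_gt0) ltn_rmodp monic_neq0.
have := rdivp_eq mon s; set u := rdivp _ _; set v := rmodp _ _ => ->; rewrite exprS; ring.
Qed.

Lemma divides_poly_coef (s : M) (c : {poly M}) :
  (forall j, divides s c`_j) -> divides s%:P c.
Proof.
move=> /choice [g gP]; exists (\poly_(j < size c) g j).
apply/polyP => j; rewrite coefCM coef_poly; case: ltnP => [_ //|le].
by rewrite mulr0 nth_default.
Qed.

(** The coefficients of index at least $Q$ in the product give $c_k = x c_{k+Q} + s b_{k+Q}$, so
    divisibility descends from indices beyond the size of [c]. *)
Lemma perturbed_regular (x : M) (s : M) (c r b : {poly M}) :
  (size r <= Q)%N -> ('X^Q - x%:P) * c = r + s%:P * b -> divides s%:P c.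
Proof.
move=> szr E; apply: divides_poly_coef => j.
have rec k : c`_k = x * c`_(k + Q) + s * b`_(k + Q).
  have := congr1 (fun P : {poly M} => P`_(k + Q)) E.
  rewrite mulrBl coefB coefXnM coefCM coefD coefCM ltnNge leq_addl /= addnK.
  rewrite [r`_ _]nth_default ?add0r; last exact: leq_trans szr (leq_addl _ _).
  by move=> <-; rewrite addrC subrK.
have [m] := ubnP (size c - j); elim: m j => // m IHm j lt.
have [le|lt'] := leqP (size c) j; first by rewrite nth_default //; exact: divides0.
rewrite rec; apply: dividesD; last by eexists.
apply: dividesMl; apply: IHm; rewrite ltnS in lt; apply: leq_trans lt.
by apply: ltn_sub2l => //; rewrite -{1}[j]addn0 ltn_add2l.
Qed.

(** Let $F = X^Q - \xi + wh$. Modulo $w^K$, the powers of $X$ below $X^Q$ are a basis of the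
    polynomials modulo $F$. A constant of [M] congruent to a polynomial over [D] therefore equals
    its remainder, which is defined over [D]. *)
Lemma perturbed_purity K (c : M) (d : {poly D}) (b a : {poly M}) :
  c%:P = map_poly i d + (i w)%:P ^+ K * b
    + ('X^Q - (i xi)%:P + (i w)%:P * map_poly i h) * a ->
  exists d0 m0, c = i d0 + i w ^+ K * m0.
Proof.
have [r [q [s [szr ->]]]] := perturbed_division K d.
rewrite !(rmorphD, rmorphM, rmorphN, rmorphXn) /= !map_polyC map_polyX /= => E.
set F := 'X^Q - (i xi)%:P + (i w)%:P * map_poly i h in E.
pose r' := c%:P - map_poly i r.
have {}E : F * (map_poly i q + a) = r' + (i w)%:P ^+ K * (- (b + map_poly i s)).
  rewrite /r' E /F; ring.
have szr' : (size r' <= Q)%N.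
  apply: leq_trans (size_polyD _ _) _; rewrite geq_max size_polyN.
  by rewrite (leq_trans (size_polyC_leq1 _) Q_gt0) (leq_trans (size_poly _ _) szr).
(* Each use of [perturbed_regular] gains one factor [w]: the perturbation term $w h (q+a)$ is one
   power more divisible than $q+a$ itself. *)
have [c1 c1E] : divides ((i w)%:P ^+ K) (map_poly i q + a).
  suff H j : (j <= K)%N -> divides ((i w)%:P ^+ j) (map_poly i q + a) by exact: H.
  elim: j => [_|j IHj ltjK]; first by eexists; rewrite expr0 mul1r.
  have [cj cjE] := IHj (ltnW ltjK).
  rewrite -rmorphXn; apply: (perturbed_regular (x := i xi) (r := r')
    (b := (i w)%:P ^+ (K - j.+1) * (- (b + map_poly i s)) - map_poly i h * cj) szr').
  have -> : ('X^Q - (i xi)%:P) * (map_poly i q + a)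
      = F * (map_poly i q + a) - (i w)%:P * map_poly i h * (map_poly i q + a).
    by rewrite /F; ring.
  have wK : (i w)%:P ^+ K = (i w)%:P ^+ j.+1 * (i w)%:P ^+ (K - j.+1).
    by rewrite -exprD subnKC.
  rewrite E cjE rmorphXn /= wK; move: (_ ^+ (K - _)) => wk; rewrite exprS.
  ring.
have : divides ((i w)%:P ^+ K) r'.
  have -> : r' = F * (map_poly i q + a) - (i w)%:P ^+ K * (- (b + map_poly i s)).
    by rewrite E addrK.
  by rewrite c1E; apply: dividesB; [apply: dividesMl|]; eexists.
move=> [r1 /(congr1 (fun P : {poly M} => P`_0)) /=].
rewrite -(rmorphXn (@polyC M)) /= coefCM coefB coefC eqxx coef_map /= => /eqP; rewrite subr_eq => /eqP ->.
by exists r`_0, r1`_0; rewrite addrC.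
Qed.

End Purity.

(** * Descent of divisibility by delta, modulo t *)

Section Crux.
Variables (p : nat) (p_pr : prime p).

Lemma poly_char0 (D : comNzRingType) : p%:R = 0 :> D -> p%:R = 0 :> {poly D}.
Proof. by move=> p0; rewrite -(rmorph_nat (@polyC D)) p0 rmorph0. Qed.

(** In [B], the perfection of $M[T]$ modulo the radical of $(f)$, one has $[T] = \delta(a+u)$ up to
    a multiple of $p[t^N]$. Thus $u \equiv -a$ modulo $[t^N]$ by [teich_delta_divides], where [a] is
    defined over the perfection of $D[T]$. At a finite Frobenius level [perturbed_purity] eliminates
    $T$. *)
Lemma delta_descent_nz (D M : comNzRingType) (i : {rmorphism D -> M}) (t : D)
    (e w : WittRing p_pr D) (u : WittRing p_pr M) k n (x : M) :
  perfect p D -> perfect p M ->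
  witt_map p_pr i w = witt_delta (i t) (witt_map p_pr i e) * u ->
  x ^+ (p ^ n) = u k -> exists d m, x = i d + i t * m.
Proof.
(* Precision $t^N$ with $N = p^n$ leaves precision $t$ after extraction of $p^n$-th roots. *)
move=> perfD perfM wE xE; set N := (p ^ n)%N in xE.
have pD := poly_char0 (perfect_p0 perfD); have pM := poly_char0 (perfect_p0 perfM).
pose A : comPzRingType := perf p_pr pD; pose AM : comPzRingType := perf p_pr pM.
have perfA : perfect p A := perf_perfect p_pr pD.
have perfAM : perfect p AM := perf_perfect p_pr pM.
pose iA : {rmorphism D -> A} := perf_in p_pr pD \o polyC.
pose iM : {rmorphism M -> AM} := perf_in p_pr pM \o polyC.
pose im : {rmorphism {poly D} -> {poly M}} := map_poly i.
pose psi : {rmorphism A -> AM} := perf_map p_pr pD pM im.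
have psi_in P : psi (perf_in p_pr pD P) = perf_in p_pr pM (im P) by exact: perf_map_in.
have psi_iA d : psi (iA d) = iM (i d).
  by rewrite /= -[LHS]/(psi (perf_in p_pr pD d%:P)) psi_in /= map_polyC.
pose T : A := perf_in p_pr pD 'X.
pose z : WittRing p_pr A := teich p_pr T - witt_map p_pr iA w.
have [f [y [a [h [zE fE fP]]]]] :=
  tilted_approximation perfA (iA t) (witt_map p_pr iA e) z N.
have fM0 := perfect_p0 perfAM.
pose I := root_ideal p_pr fM0 (psi f).
(* The radical is divided out, and not $(f)$ alone, to keep [B] perfect. *)
pose B : comPzRingType := quotient_ring I.
have perfB : perfect p B := perfect_quotient perfAM (@root_ideal_radical p p_pr AM fM0 (psi f)).
pose pi : {rmorphism AM -> B} := qmap I.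
pose phi : {rmorphism A -> B} := pi \o psi.
pose j : {rmorphism M -> B} := pi \o iM.
have phi_iA d : phi (iA d) = j (i d) by exact: (congr1 pi (psi_iA d)).
have phif : phi f = 0.
  by apply/qmap0; exists 0%N, 1; rewrite expn0 expr1 mulr1.
have [b bE] : divides (teich p_pr (phi (iA t) ^+ N)) (witt_map p_pr phi y).
  by apply: (fP B phi perfB N (leqnn N)); rewrite phif; exact: divides0.
have we v : witt_map p_pr phi (witt_map p_pr iA v) = witt_map p_pr j (witt_map p_pr i v).
  by apply/funext => l; exact: phi_iA.
have TE : teich p_pr (phi T) = witt_delta (phi (iA t)) (witt_map p_pr phi (witt_map p_pr iA e))
    * (witt_map p_pr phi a + witt_map p_pr j u)
    + p%:R * (teich p_pr (phi (iA t) ^+ N) * b).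
  have E1 : witt_map p_pr phi z = teich p_pr (phi T)
      - witt_delta (phi (iA t)) (witt_map p_pr phi (witt_map p_pr iA e)) * witt_map p_pr j u.
    by rewrite /z rmorphB /= witt_map_teich we wE rmorphM /= witt_map_delta -phi_iA -we.
  have E2 : witt_map p_pr phi z = p%:R * (teich p_pr (phi (iA t) ^+ N) * b)
      + witt_delta (phi (iA t)) (witt_map p_pr phi (witt_map p_pr iA e)) * witt_map p_pr phi a.
    rewrite zE !rmorphD !rmorphM rmorph_nat /= witt_map_teich witt_map_delta phif teich0.
    by rewrite add0r bE.
  move: E1; rewrite E2 => /esym/eqP; rewrite subr_eq => /eqP ->.
  by rewrite mulrDr [RHS]addrC addrA.
have [v vE] := teich_delta_divides perfB TE.
have [b1 b1E] : divides (phi (iA t) ^+ N) (j (u k) - phi ((- a) k)).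
  have := witt_teich_mod (phi (iA t) ^+ N) (witt_map p_pr phi (- a)) v k.
  have E : witt_map p_pr phi (- a) + (witt_map p_pr phi a + witt_map p_pr j u)
      = witt_map p_pr j u by rewrite rmorphN addrA addNr add0r.
  by rewrite -vE E.
have [d0 d0E] := perfect_root perfA n ((- a) k).
have [b2 b2E] := perfect_root perfB n b1.
have [b3 b3E] := qmap_surj b2.
have xB : j x - phi d0 - phi (iA t) * b2 = 0.
  apply: (@perfect_eq0 p B perfB n).
  rewrite !(frob_expB p_pr (perfect_p0 perfB)) exprMn b2E -[j x ^+ _]rmorphXn -[phi d0 ^+ _]rmorphXn d0E -/N xE.
  by rewrite -b1E subrr.
have {xB} : pi (iM x - psi d0 - psi (iA t) * b3) = 0.
  rewrite -[RHS]xB !rmorphB rmorphM; congr (_ - _ * _); exact: b3E.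
move=> /qmap0 [m [c cE]].
have [sd sdE] := qmap_surj d0; have [sb sbE] := qmap_surj b3.
have [sh shE] := qmap_surj h; have [sc scE] := qmap_surj c.
have fME : psi f = perf_in p_pr pM ('X - (i (w 0%N))%:P)
    + perf_in p_pr pM (i t)%:P * psi h.
  rewrite fE rmorphD rmorphM psi_iA; congr (_ + _).
  have -> : z 0%N = T - iA (w 0%N) by rewrite /z wittB0.
  have psiT : psi T = perf_in p_pr pM 'X by rewrite /T psi_in /im /= map_polyX.
  by rewrite rmorphB psiT psi_iA [RHS]rmorphB.
pose cl : {rmorphism perf_seq p_pr pM -> AM} := perf_class p_pr pM.
pose ms (s : perf_seq p_pr pD) := PerfSeq p_pr pM (perf_map_seq_subproof im s).
have psicl s : psi (perf_class p_pr pD s) = cl (ms s) by exact: perf_map_class.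
pose ps := @perf_in_seq p p_pr {poly M} pM.
have : cl ((ps x%:P - ms sd - ps (i t)%:P * sb) ^+ (p ^ m))
   = cl ((ps ('X - (i (w 0%N))%:P) + ps (i t)%:P * ms sh) * sc).
  rewrite rmorphXn !rmorphB !rmorphM rmorphD rmorphM -!psicl.
  have -> : perf_class p_pr pD sd = d0 by [].
  have -> : perf_class p_pr pD sh = h by [].
  have -> : cl sb = b3 by [].
  have -> : cl sc = c by [].
  rewrite -[cl (ps ('X - _)) + _]fME -cE psi_iA; congr (_ ^+ _).
(* Evaluated at level [N0] the classes become polynomials, and the constants appear raised to the
   power $Q = p^{N_0}$. *)
move=> /perf_class_eq [N0 /(_ N0 (leqnn N0))].
rewrite perf_seqX !perf_seqB !perf_seqM perf_seqD !perf_seqM /=.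
set Q := (p ^ N0)%N; set dN := sd N0; set bN := sb N0; set hN := sh N0; set cN := sc N0.
rewrite !(frob_expB p_pr pM) exprMn -!exprM => E.
have Q_gt0 : (0 < Q)%N by rewrite expn_gt0 prime_gt0.
(* Here $F = X^Q - w_0^Q + t^Q h$ is the level [N0] of $f = T - w_0 + th$, and $K = p^m$ makes the
   error $t^{Qp^m}$, whose $Qp^m$-th root is $t$. *)
have [d1 [m1 xE']] : exists d1 m1, x ^+ (Q * p ^ m) = i d1 + i (t ^+ Q) ^+ (p ^ m) * m1.
  apply: (perturbed_purity (xi := w 0%N ^+ Q) (h := hN) Q_gt0 (d := dN ^+ (p ^ m))
    (b := bN ^+ (p ^ m)) (a := cN)).
  rewrite !rmorphXn /= -exprM -E; ring.
have [d2 d2E] := perfect_root perfD (N0 + m) d1.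
have [m2 m2E] := perfect_root perfM (N0 + m) m1.
exists d2, m2; apply/eqP; rewrite -subr_eq0 opprD addrA; apply/eqP.
apply: (perfect_eq0 perfM (n := N0 + m)).
rewrite !(frob_expB p_pr (perfect_p0 perfM)) exprMn -rmorphXn d2E m2E.
rewrite expnD -/Q xE' rmorphXn -exprM; ring.
Qed.
End Crux.

Section NzIso.
Variables (A : comPzRingType) (nz : 1 <> 0 :> A).
Definition nz_in (x : A) : nzring nz := x.
Definition nz_out (x : nzring nz) : A := x.
Lemma nz_in_additive : additive nz_in. Proof. by []. Qed.
Lemma nz_in_multiplicative : multiplicative nz_in. Proof. by []. Qed.
Lemma nz_out_additive : additive nz_out. Proof. by []. Qed.
Lemma nz_out_multiplicative : multiplicative nz_out. Proof. by []. Qed.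
HB.instance Definition _ := GRing.isAdditive.Build A (nzring nz) nz_in nz_in_additive.
HB.instance Definition _ := GRing.isMultiplicative.Build A (nzring nz) nz_in nz_in_multiplicative.
HB.instance Definition _ := GRing.isAdditive.Build (nzring nz) A nz_out nz_out_additive.
HB.instance Definition _ := GRing.isMultiplicative.Build (nzring nz) A nz_out nz_out_multiplicative.

Lemma nz_perfect p : perfect p A -> perfect p (nzring nz).
Proof.
move=> [p0 inj sur]; split.
- by rewrite -(rmorph_nat nz_in) p0.
- by move=> x xp; apply: inj; rewrite -[x]/(nz_out x) -rmorphXn xp rmorph0.
- by move=> y; have [x xy] := sur (nz_out y); exists (nz_in x); rewrite -rmorphXn xy.
Qed.
End NzIso.

Section Descent.
Variables (p : nat) (p_pr : prime p).

Lemma delta_descent (D M : comPzRingType) (i : {rmorphism D -> M}) (t : D)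
    (e w : WittRing p_pr D) (u : WittRing p_pr M) k n (x : M) :
  perfect p D -> perfect p M ->
  witt_map p_pr i w = witt_delta (i t) (witt_map p_pr i e) * u ->
  x ^+ (p ^ n) = u k -> exists d m, x = i d + i t * m.
Proof.
move=> perfD perfM wE xE.
have [h|nzM] := pselect (1 = 0 :> M); first by exists 0, 0; exact: zero_ring h _ _.
have nzD : 1 <> 0 :> D by move=> h; apply: nzM; rewrite -(rmorph1 i) h rmorph0.
pose i' : {rmorphism nzring nzD -> nzring nzM} := @nz_in M nzM \o (i \o @nz_out D nzD).
pose jD : {rmorphism D -> nzring nzD} := @nz_in D nzD.
pose jM : {rmorphism M -> nzring nzM} := @nz_in M nzM.
pose inD := witt_map p_pr jD; pose inM := witt_map p_pr jM.
have E v : witt_map p_pr i' (inD v) = inM (witt_map p_pr i v) by [].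
have wE' : witt_map p_pr i' (inD w)
    = witt_delta (i' (jD t)) (witt_map p_pr i' (inD e)) * inM u.
  by rewrite !E wE /inM rmorphM /= witt_map_delta.
have xE' : jM x ^+ (p ^ n) = inM u k by rewrite -rmorphXn xE.
have [d [m xdm]] := delta_descent_nz (nz_perfect nzD perfD) (nz_perfect nzM perfM) wE' xE'.
by exists (nz_out d), (nz_out m).
Qed.

End Descent.

Definition adic_sep (B : comPzRingType) (t : B) : Prop :=
  forall x, (forall n, divides (t ^+ n) x) -> x = 0.

(* Completeness stated through series, so that it passes to quotients. *)
Definition adic_sums (B : comPzRingType) (t : B) : Prop :=
  forall b : nat -> B, exists g, forall n, divides (t ^+ n) (g - \sum_(m < n) t ^+ m * b m).

(** * Exact descent for complete D *)

Section GeneratedSubring.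
Variables (p : nat) (p_pr : prime p) (D E : comPzRingType) (i : {rmorphism D -> E}).
Variable u : WittRing p_pr E.

(** All $p$-power roots of the components are included so that the subring generated is perfect, as
    [delta_descent] requires. *)
Definition contains_roots (P : set E) : Prop :=
  [/\ P 1, forall x y, P x -> P y -> P (x - y), forall x y, P x -> P y -> P (x * y),
      forall d, P (i d) & forall k n y, y ^+ (p ^ n) = u k -> P y].

Definition root_pred : {pred E} :=
  fun x => `[< forall P : set E, contains_roots P -> P x >].

Lemma root_pred_subring : subring_closed root_pred.
Proof.
split=> [|x y|x y]; rewrite ?unfold_in.
- by apply/asboolP => P [].
- move=> /asboolP Px /asboolP Py; apply/asboolP => P HP.
  by have [_ PB _ _ _] := HP; apply: PB; [exact: Px | exact: Py].
- move=> /asboolP Px /asboolP Py; apply/asboolP => P HP.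
  by have [_ _ PM _ _] := HP; apply: PM; [exact: Px | exact: Py].
Qed.

Record root_subring := RootSubring { root_val :> E; root_valP : root_val \in root_pred }.

HB.instance Definition _ := [isSub for root_val].
HB.instance Definition _ := [Choice of root_subring by <:].
HB.instance Definition _ := @GRing.SubChoice_isSubComPzRing.Build E
  root_pred root_subring root_pred_subring.

Definition root_emb : {rmorphism root_subring -> E} := \val.

Lemma root_ind (P : set E) : contains_roots P -> forall x : root_subring, P (root_emb x).
Proof. by move=> HP x; have := root_valP x; rewrite unfold_in => /asboolP /(_ P HP). Qed.

Lemma root_in x : (forall P : set E, contains_roots P -> P x) ->
  exists y : root_subring, root_emb y = x.
Proof.
move=> H; have xP : x \in root_pred by rewrite unfold_in; exact/asboolP.
by exists (RootSubring xP).
Qed.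

Lemma root_emb_inj : injective root_emb.
Proof. exact: val_inj. Qed.

Lemma root_lift_subproof d : i d \in root_pred.
Proof. by rewrite unfold_in; apply/asboolP => P []. Qed.
Definition root_lift (d : D) : root_subring := RootSubring (root_lift_subproof d).
Lemma root_lift_additive : additive root_lift.
Proof. by move=> x y; apply: root_emb_inj; rewrite rmorphB; exact: (rmorphB i). Qed.
Lemma root_lift_multiplicative : multiplicative root_lift.
Proof.
split=> [x y|]; apply: root_emb_inj; first by rewrite rmorphM; exact: (rmorphM i).
by rewrite rmorph1; exact: (rmorph1 i).
Qed.
HB.instance Definition _ := GRing.isAdditive.Build D root_subring root_lift root_lift_additive.
HB.instance Definition _ :=
  GRing.isMultiplicative.Build D root_subring root_lift root_lift_multiplicative.

Lemma root_subring_perfect : perfect p D -> perfect p E -> perfect p root_subring.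
Proof.
move=> perfD perfE; split.
- by apply: root_emb_inj; rewrite rmorph_nat rmorph0 (perfect_p0 perfE).
- move=> x xp; apply: root_emb_inj; rewrite rmorph0; have [_ inj _] := perfE.
  by apply: inj; rewrite -rmorphXn xp rmorph0.
- move=> y; have [x xE] := perfect_root perfE 1 (root_emb y); rewrite expn1 in xE.
  suff [x' x'E] : exists x' : root_subring, root_emb x' = x.
    by exists x'; apply: root_emb_inj; rewrite rmorphXn x'E xE.
  apply: root_in => P HP.
  have [P1 PB PM Pi Pu] := HP.
  have root1 (z : E) : exists x : E, x ^+ p = z by have [z' <-] := perfect_root perfE 1 z; exists z'; rewrite expn1.
  have uniq (z1 z2 : E) : z1 ^+ p = z2 ^+ p -> z1 = z2.
    by move=> zz; apply: (perfect_inj p_pr perfE (n := 1)); rewrite expn1.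
  (* The elements all of whose $p$-th roots lie in [P] again satisfy [contains_roots], because the
     generators are stable under $p$-th roots. *)
  pose P' : set E := [set z | forall x, x ^+ p = z -> P x].
  suff : P' (root_emb y) by apply.
  apply: (root_ind (P := P')); split.
  + by move=> z z1; have -> : z = 1 by apply: uniq; rewrite z1 expr1n.
  + move=> a b; have [a' <-] := root1 a; have [b' <-] := root1 b => Pa Pb z zE.
    have -> : z = a' - b'.
      by apply: uniq; rewrite zE; have := frob_expB p_pr (perfect_p0 perfE) 1 a' b'; rewrite expn1.
    by apply: PB; [exact: Pa | exact: Pb].
  + move=> a b; have [a' <-] := root1 a; have [b' <-] := root1 b => Pa Pb z zE.
    have -> : z = a' * b' by apply: uniq; rewrite zE exprMn.
    by apply: PM; [exact: Pa | exact: Pb].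
  + move=> d z zE; have [d' d'E] := perfect_root perfD 1 d; rewrite expn1 in d'E.
    have -> : z = i d' by apply: uniq; rewrite zE -rmorphXn d'E.
    exact: Pi.
  + by move=> k n z zE z' z'E; apply: (Pu k n.+1); rewrite expnS exprM z'E.
Qed.

(* M = D + t M for the subring M of E generated by D and the p-power roots of the
   components of u; as D is complete and E is separated this forces M = D. *)
Lemma delta_descent_complete (t : D) (e w : WittRing p_pr D) :
  perfect p D -> perfect p E -> injective i -> adic_sums t -> adic_sep (i t) ->
  witt_map p_pr i w = witt_delta (i t) (witt_map p_pr i e) * u ->
  exists u', w = witt_delta t e * u'.
Proof.
move=> perfD perfE i_inj sumD sepE wE.
pose M : comPzRingType := root_subring; pose iM : {rmorphism D -> M} := root_lift.
have perfM : perfect p M := root_subring_perfect perfD perfE.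
have iME d : root_emb (iM d) = i d by [].
have embi v : witt_map p_pr root_emb (witt_map p_pr iM v) = witt_map p_pr i v by [].
have /choice [uM uME] : forall k, exists y : M, root_emb y = u k.
  move=> k; apply: root_in => P [_ _ _ _ Pu]; apply: (Pu k 0%N).
  by rewrite expn0 expr1.
have uE : witt_map p_pr root_emb (uM : WittRing p_pr M) = u by apply/funext.
have wME : witt_map p_pr iM w = witt_delta (iM t) (witt_map p_pr iM e) * (uM : WittRing p_pr M).
  apply/funext => k; apply: root_emb_inj.
  have : witt_map p_pr root_emb (witt_map p_pr iM w) k
    = witt_map p_pr root_emb (witt_delta (iM t) (witt_map p_pr iM e) * (uM : WittRing p_pr M)) k.
    by rewrite embi wE rmorphM /= witt_map_delta embi uE.
  by [].
(* The set $D + tM$ is a subring, and [delta_descent] puts the generators into it. *)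
have split_M (x : M) : exists d (m : M), root_emb x = i d + i t * root_emb m.
  pose P0 : set E := [set z | exists d (m : M), z = i d + i t * root_emb m].
  apply: (root_ind (P := P0)); split.
  - by exists 1, 0; rewrite rmorph1 rmorph0 mulr0 addr0.
  - move=> _ _ [d [m ->]] [d' [m' ->]]; exists (d - d'), (m - m').
    by rewrite !rmorphB; ring.
  - move=> _ _ [d [m ->]] [d' [m' ->]].
    exists (d * d'), (iM d * m' + m * iM d' + iM t * m * m').
    by rewrite !(rmorphD, rmorphM) !iME; ring.
  - by move=> d; exists d, 0; rewrite rmorph0 mulr0 addr0.
  - move=> k n y yE.
    have [y' y'E] : exists y' : M, root_emb y' = y.
      by apply: root_in => P [_ _ _ _ Pu]; exact: Pu yE.
    have y'X : y' ^+ (p ^ n) = uM k by apply: root_emb_inj; rewrite rmorphXn y'E yE uME.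
    have [d [m dm]] := delta_descent perfD perfM wME y'X.
    by exists d, m; rewrite -y'E dm rmorphD rmorphM.
have [fd /choice [fm fE]] : exists fd : M -> D,
    forall x, exists m, root_emb x = i (fd x) + i t * root_emb m.
  by have /choice [fd fdP] := split_M; exists fd.
have lift (x : M) : exists d, i d = root_emb x.
  pose xs n := iter n fm x.
  have xsE n : root_emb x = \sum_(m < n) i t ^+ m * i (fd (xs m)) + i t ^+ n * root_emb (xs n).
    elim: n => [|n IHn]; first by rewrite big_ord0 add0r expr0 mul1r.
    by rewrite IHn fE big_ord_recr exprSr mulrDr addrA mulrA.
  have [g gP] := sumD (fun n => fd (xs n)); exists g.
  apply/eqP; rewrite -subr_eq0; apply/eqP; apply: sepE => n.
  have [r /(congr1 i)] := gP n; rewrite rmorphB rmorph_sum rmorphM.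
  under eq_bigr do rewrite rmorphM rmorphXn.
  move=> /eqP; rewrite subr_eq => /eqP ->; rewrite (xsE n).
  by exists (i r - root_emb (xs n)); rewrite rmorphXn; ring.
have /choice [u' u'E] := fun k => lift (uM k).
exists u'; apply/funext => k; apply: i_inj.
have : witt_map p_pr i w k = witt_map p_pr i (witt_delta t e * (u' : WittRing p_pr D)) k.
  have -> : witt_map p_pr i (witt_delta t e * (u' : WittRing p_pr D))
      = witt_delta (i t) (witt_map p_pr i e) * witt_map p_pr i u'.
    by rewrite rmorphM /= witt_map_delta.
  suff -> : witt_map p_pr i u' = u by rewrite wE.
  by apply/funext => l; rewrite /witt_map u'E uME.
by [].
Qed.

End GeneratedSubring.

(** * Tilts *)

Lemma inverse_uniq (R : comPzRingType) (x a b : R) : x * a = 1 -> x * b = 1 -> a = b.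
Proof. by move=> xa xb; rewrite -[a]mulr1 -xb mulrA [a * x]mulrC xa mul1r. Qed.

Section TiltBasics.
Variables (p : nat) (p_pr : prime p) (C : comPzRingType).
Local Notation Cp := (quotient_ring (principal_ideal (p%:R : C))).
Local Notation tilt := (tilt p_pr C).

Definition redp : {rmorphism C -> Cp} := qmap (principal_ideal (p%:R : C)).

Lemma redp_eq x y : redp x = redp y <-> divides p%:R (x - y).
Proof. exact: (qmap_eq (principal_ideal (p%:R : C))). Qed.

Lemma redp_surj y : exists x, redp x = y.
Proof. exact: qmap_surj. Qed.

Definition tilt_ev (n : nat) (f : tilt) : Cp := f n.
Arguments tilt_ev : simpl never.
Lemma tilt_ev_additive n : additive (tilt_ev n). Proof. by []. Qed.
Lemma tilt_ev_multiplicative n : multiplicative (tilt_ev n). Proof. by []. Qed.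
HB.instance Definition _ n := GRing.isAdditive.Build tilt Cp (tilt_ev n) (tilt_ev_additive n).
HB.instance Definition _ n :=
  GRing.isMultiplicative.Build tilt Cp (tilt_ev n) (tilt_ev_multiplicative n).

Lemma tilt_ext (f g : tilt) : (forall n, tilt_ev n f = tilt_ev n g) -> f = g.
Proof. by move=> fg; apply/val_inj/funext => n; exact: fg. Qed.

Lemma tilt_evS (f : tilt) n : tilt_ev n.+1 f ^+ p = tilt_ev n f.
Proof. by have := tilt_valP f; rewrite unfold_in => /asboolP /(_ n). Qed.

Lemma tilt_evX (f : tilt) n k : tilt_ev (n + k) f ^+ (p ^ k) = tilt_ev n f.
Proof.
elim: k => [|k IHk]; first by rewrite addn0 expn0 expr1.
by rewrite expnS exprM addnS tilt_evS.
Qed.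

Lemma tilt_rootX (f : tilt) k : tilt_root k f ^+ (p ^ k) = f.
Proof. by apply: tilt_ext => n; rewrite rmorphXn; exact: tilt_evX. Qed.

Lemma tilt_perfect : perfect p tilt.
Proof.
split.
- by apply: tilt_ext => n; rewrite rmorph_nat rmorph0 natr_quotient_p.
- move=> f fp; apply: tilt_ext => n; rewrite rmorph0 -tilt_evS -rmorphXn fp rmorph0 //.
- by move=> f; exists (tilt_root 1 f); have := tilt_rootX f 1; rewrite expn1.
Qed.

Lemma tilt_ev0_le (f : tilt) m n : (m <= n)%N -> tilt_ev n f = 0 -> tilt_ev m f = 0.
Proof.
move=> /subnKC <- f0; rewrite -(tilt_evX f m (n - m)) f0 expr0n expn_eq0.
by rewrite (gtn_eqF (prime_gt0 p_pr)).
Qed.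

Lemma mk_tilt_subproof (r : nat -> Cp) : (forall n, r n.+1 ^+ p = r n) ->
  r \in @frobenius_compatible p C.
Proof. by move=> rP; rewrite unfold_in; exact/asboolP. Qed.
Definition mk_tilt (r : nat -> Cp) (rP : forall n, r n.+1 ^+ p = r n) : tilt :=
  Tilt p_pr (mk_tilt_subproof rP).
Lemma mk_tilt_ev r rP n : tilt_ev n (@mk_tilt r rP) = r n. Proof. by []. Qed.

(** Since $f_n^{p^n} = f_0$, every level is a unit; uniqueness makes the inverses compatible. *)
Lemma tilt_unit (f : tilt) (x : Cp) : tilt_ev 0 f * x = 1 -> exists g, f * g = 1.
Proof.
move=> fx; have fE n : tilt_ev n f ^+ (p ^ n) = tilt_ev 0 f by rewrite -[n in LHS]add0n tilt_evX.
pose r n := tilt_ev n f ^+ (p ^ n).-1 * x.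
have fr n : tilt_ev n f * r n = 1.
  by rewrite mulrA -exprS prednK ?expn_gt0 ?prime_gt0 // fE.
have rP n : r n.+1 ^+ p = r n.
  apply: (inverse_uniq (x := tilt_ev n f)) (fr n).
  by rewrite -(tilt_evS f n) -exprMn fr expr1n.
by exists (mk_tilt rP); apply: tilt_ext => n; rewrite rmorphM rmorph1; exact: fr.
Qed.

Section PseudoUniformizer.
Variables (t : tilt) (t0 : tilt_ev 0 t = 0).

(** The component of $t^{p^n}$ at level $n$ is $t_0 = 0$. So powers of $t$ tend to zero in the
    inverse limit, which alone yields $t$-adic separatedness and summability, whatever the ring [C]
    is. *)
Lemma tilt_pow_ev n m : (p ^ n <= m)%N -> tilt_ev n (t ^+ m) = 0.
Proof.
move=> /subnK <-; rewrite rmorphXn exprD.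
by have := tilt_evX t 0 n; rewrite add0n t0 => ->; rewrite mulr0.
Qed.

Lemma tilt_sep : adic_sep t.
Proof.
move=> f H; apply: tilt_ext => n; have [h ->] := H (p ^ n)%N.
by rewrite rmorphM /= tilt_pow_ev // mul0r rmorph0.
Qed.

Lemma tilt_partial_ev (b : nat -> tilt) n N : (p ^ n <= N)%N ->
  tilt_ev n (\sum_(m < N) t ^+ m * b m) = tilt_ev n (\sum_(m < p ^ n) t ^+ m * b m).
Proof.
move=> /subnKC <-; elim: (N - _)%N => [|k IHk]; first by rewrite addn0.
by rewrite addnS big_ord_recr rmorphD /= IHk rmorphM /= tilt_pow_ev ?leq_addr // mul0r addr0.
Qed.

Lemma tilt_sums : adic_sums t.
Proof.
have ex (b : nat -> tilt) : exists g : tilt, forall n N, (p ^ n <= N)%N ->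
    tilt_ev n g = tilt_ev n (\sum_(m < N) t ^+ m * b m).
  pose r n := tilt_ev n (\sum_(m < p ^ n) t ^+ m * b m).
  have rP n : r n.+1 ^+ p = r n.
    by rewrite /r tilt_evS tilt_partial_ev // leq_exp2l ?prime_gt1.
  by exists (mk_tilt rP) => n N le; rewrite mk_tilt_ev tilt_partial_ev.
(* Applied again to the shifted series, the existence of limits yields the factor of $t^n$ in the
   remainder. *)
move=> b; have [g gP] := ex b; exists g => n.
have [g' g'P] := ex (fun m => b (n + m)%N); exists g'.
apply/eqP; rewrite subr_eq; apply/eqP; apply: tilt_ext => k.
rewrite (gP k (n + p ^ k)%N) ?leq_addl // rmorphD rmorphM /= (g'P k _ (leqnn _)).
rewrite -rmorphM -rmorphD big_split_ord /= addrC; congr (tilt_ev k (_ + _)).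
by rewrite mulr_sumr; apply: eq_bigr => m _; rewrite exprD mulrA.
Qed.
End PseudoUniformizer.

End TiltBasics.

Section TiltMap.
Variables (p : nat) (p_pr : prime p) (C C' : comPzRingType) (phi : {rmorphism C -> C'}).

Lemma redp_map_subproof x :
  ideal_set (principal_ideal (p%:R : C)) x -> (redp p C' \o phi) x = 0.
Proof. by move=> [y ->]; rewrite rmorphM rmorph_nat natr_quotient_p mul0r. Qed.

Definition redp_map := quot_lift_rmorphism redp_map_subproof.
Lemma redp_mapE x : redp_map (redp p C x) = redp p C' (phi x).
Proof. exact: quot_liftE. Qed.

Lemma tilt_map_subproof (f : tilt p_pr C) n :
  redp_map (tilt_ev n.+1 f) ^+ p = redp_map (tilt_ev n f).
Proof. by rewrite -rmorphXn tilt_evS. Qed.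
Definition tilt_map (f : tilt p_pr C) : tilt p_pr C' := mk_tilt p_pr (tilt_map_subproof f).
Lemma tilt_map_ev f n : tilt_ev n (tilt_map f) = redp_map (tilt_ev n f). Proof. by []. Qed.

Lemma tilt_map_additive : additive tilt_map.
Proof.
by move=> f g; apply: tilt_ext => n; exact: (rmorphB redp_map (tilt_ev n f) (tilt_ev n g)).
Qed.
Lemma tilt_map_multiplicative : multiplicative tilt_map.
Proof.
split=> [f g|]; apply: tilt_ext => n; last exact: (rmorph1 redp_map).
exact: (rmorphM redp_map (tilt_ev n f) (tilt_ev n g)).
Qed.
HB.instance Definition _ := GRing.isAdditive.Build (tilt p_pr C) (tilt p_pr C') tilt_map tilt_map_additive.
HB.instance Definition _ :=
  GRing.isMultiplicative.Build (tilt p_pr C) (tilt p_pr C') tilt_map tilt_map_multiplicative.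
End TiltMap.

Arguments tilt_map {p} p_pr {C C'} phi f.

(** * Fontaine's map *)

Section Theta.
Variables (p : nat) (p_pr : prime p).

(** A relational form of [tilt_seq], usable over rings that are not $p$-adically complete. *)
Definition sharp_seq (C : comPzRingType) (f : tilt p_pr C) (r : nat -> C) : Prop :=
  (forall n, r n.+1 ^+ p = r n) /\ (forall n, redp p C (r n) = tilt_ev n f).

Lemma sharp_seqX (C : comPzRingType) (f : tilt p_pr C) r n k :
  sharp_seq f r -> r (n + k)%N ^+ (p ^ k) = r n.
Proof.
move=> [rS _]; elim: k => [|k IHk]; first by rewrite addn0 expn0 expr1.
by rewrite expnS exprM addnS rS.
Qed.

(* r is the image of w under theta up to p-divisible elements; no completeness of C
   is needed to make sense of this. *)
Definition theta_rel (C : comPzRingType) (w : WittRing p_pr (tilt p_pr C)) (r : C) : Prop :=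
  forall n (l : WittRing p_pr C),
    witt_map p_pr (redp p C) l = witt_map p_pr (@tilt_ev p p_pr C n) w ->
    divides (p ^ n.+1)%:R (r - ghost p l n).

Lemma witt_lifts (C : comPzRingType) (w : WittRing p_pr (tilt p_pr C)) n :
  exists l : WittRing p_pr C,
    witt_map p_pr (redp p C) l = witt_map p_pr (@tilt_ev p p_pr C n) w.
Proof. by have := witt_map_surj (f := redp p C) (@redp_surj p C) (witt_map p_pr (@tilt_ev p p_pr C n) w). Qed.

Lemma ghost_redp (C : comPzRingType) (l l' : WittRing p_pr C) n :
  witt_map p_pr (redp p C) l = witt_map p_pr (redp p C) l' ->
  divides (p ^ n.+1)%:R (ghost p l n - ghost p l' n).
Proof.
move=> ll'; apply: ghost_congr => // k _; apply/redp_eq.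
exact: (congr1 (fun x : WittRing p_pr _ => x k) ll').
Qed.

Lemma theta_rel_intro (C : comPzRingType) (w : WittRing p_pr (tilt p_pr C)) (r : C) :
  (forall n, exists l : WittRing p_pr C,
    witt_map p_pr (redp p C) l = witt_map p_pr (@tilt_ev p p_pr C n) w /\
    divides (p ^ n.+1)%:R (r - ghost p l n)) -> theta_rel w r.
Proof.
move=> H n l' l'E; have [l [lE D]] := H n.
by apply: divides_trans D _; apply: ghost_redp; rewrite lE.
Qed.

Section RingHom.
Variables (C : comPzRingType).
Implicit Types (a b : WittRing p_pr (tilt p_pr C)) (r s : C).

Lemma theta_relB a b r s : theta_rel a r -> theta_rel b s -> theta_rel (a - b) (r - s).
Proof.
move=> ar bs; apply: theta_rel_intro => n.
have [l lE] := witt_lifts a n; have [m mE] := witt_lifts b n.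
exists (l - m); split; first by rewrite !rmorphB /= lE mE.
by rewrite ghostD ghostN; apply: dividesBB; [exact: ar | exact: bs].
Qed.

Lemma theta_relM a b r s : theta_rel a r -> theta_rel b s -> theta_rel (a * b) (r * s).
Proof.
move=> ar bs; apply: theta_rel_intro => n.
have [l lE] := witt_lifts a n; have [m mE] := witt_lifts b n.
exists (l * m); split; first by rewrite !rmorphM /= lE mE.
by rewrite ghostM; apply: dividesMM; [exact: ar | exact: bs].
Qed.

Lemma theta_rel_nat k : theta_rel (k%:R : WittRing p_pr (tilt p_pr C)) (k%:R : C).
Proof.
apply: theta_rel_intro => n; exists k%:R; split; first by rewrite !rmorph_nat.
by rewrite ghost_nat subrr; exact: divides0.
Qed.

Lemma theta_relD a b r s : theta_rel a r -> theta_rel b s -> theta_rel (a + b) (r + s).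
Proof.
move=> ar bs; rewrite -[b]opprK -[s]opprK; apply: theta_relB => //.
by have := theta_relB (@theta_rel_nat 0) bs; rewrite !sub0r.
Qed.

Lemma theta_rel_teich (f : tilt p_pr C) (r : nat -> C) : sharp_seq f r -> theta_rel (teich p_pr f) (r 0%N).
Proof.
move=> fr; apply: theta_rel_intro => n; exists (teich p_pr (r n)); split.
  by rewrite !witt_map_teich; congr (teich p_pr _); case: fr => _ /(_ n).
rewrite (ghost_teich p_pr) -[n in r n]add0n (sharp_seqX 0 n fr) subrr.
exact: divides0.
Qed.

Lemma theta_rel_close a r s : theta_rel a r ->
  (forall n, divides (p ^ n)%:R (s - r)) -> theta_rel a s.
Proof. by move=> ar D n l lE; apply: divides_trans (D _) (ar n l lE). Qed.

Lemma theta_rel_uniq a r s n : theta_rel a r -> theta_rel a s -> divides (p ^ n)%:R (r - s).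
Proof.
move=> ar as_; have [l lE] := witt_lifts a n.
suff [c ->] : divides (p ^ n.+1)%:R (r - s) by rewrite expnSr natrM -mulrA; eexists.
apply: divides_trans (ar n l lE) _.
by rewrite -opprB; apply: dividesN; exact: as_ n l lE.
Qed.

Lemma theta_rel_ev a r : theta_rel a r -> redp p C r = tilt_ev 0 (a 0%N).
Proof.
move=> ar; have [l lE] := witt_lifts a 0; have := ar 0%N l lE.
rewrite expn1 ghost0 => /redp_eq ->.
exact: (congr1 (fun x : WittRing p_pr _ => x 0%N) lE).
Qed.

(* theta only depends on the components modulo decreasing powers, which yields
   the cancellation of p in a p-torsion free ring. *)
Lemma theta_rel_div a r : torsion_free_at p C ->
  theta_rel (p%:R * a) (p%:R * r) -> theta_rel a r.
Proof.
move=> tf H n l' l'E.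
have [l lE] := witt_lifts a n.+1.
(* The $p$-th powers of a lift at level $n+1$ form a lift at level $n$, and their ghost components
   differ only by $p^{n+1} l_{n+1}$. Thus the information at level $n+1$ survives cancelling one
   $p$. *)
have lpE : witt_map p_pr (redp p C) ((fun i => l i ^+ p) : WittRing p_pr C)
    = witt_map p_pr (@tilt_ev p p_pr C n) a.
  apply/funext => i; have := congr1 (fun x : WittRing p_pr _ => x i) lE.
  by rewrite /witt_map rmorphXn /= => ->; rewrite tilt_evS.
apply: (@divides_trans _ _ _ (ghost p ((fun i => l i ^+ p) : WittRing p_pr C) n)); last first.
  by apply: ghost_redp; exact: etrans lpE (esym l'E).
have := H n.+1 (p%:R * l); rewrite rmorphM rmorph_nat /= lE rmorphM rmorph_nat => /(_ erefl).
rewrite ghostM ghost_nat -mulrBr => -[c /eqP]; rewrite expnS natrM -mulrA -subr_eq0 -mulrBr.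
move=> /eqP /tf /eqP; rewrite subr_eq0 => /eqP E.
have -> : r - ghost p ((fun i => l i ^+ p) : WittRing p_pr C) n
  = r - ghost p l n.+1 + (p ^ n.+1)%:R * l n.+1.
  rewrite [ghost p l _]ghostS opprD -!addrA addNr addr0; congr (_ + _).
  congr (- _); apply: eq_bigr => i _; rewrite -exprM -expnS subSn // -ltnS //.
by apply: dividesD; [rewrite E|]; eexists.
Qed.

End RingHom.

Lemma theta_rel_map (C C' : comPzRingType) (phi : {rmorphism C -> C'})
    (a : WittRing p_pr (tilt p_pr C)) r :
  theta_rel a r -> theta_rel (witt_map p_pr (tilt_map p_pr phi) a) (phi r).
Proof.
move=> ar; apply: theta_rel_intro => n; have [l lE] := witt_lifts a n.
exists (witt_map p_pr phi l); split.
  apply/funext => i; have := congr1 (fun x : WittRing p_pr _ => x i) lE.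
  rewrite /witt_map => E; rewrite [RHS]tilt_map_ev -E.
  by rewrite redp_mapE.
have [c /(congr1 phi)] := ar n l lE.
by rewrite rmorphB rmorphM rmorph_nat rmorph_ghost => ->; eexists.
Qed.

Lemma sharp_seq_map (C C' : comPzRingType) (phi : {rmorphism C -> C'})
    (f : tilt p_pr C) r : sharp_seq f r -> sharp_seq (tilt_map p_pr phi f) (phi \o r).
Proof.
move=> [rS rE]; split=> n /=; first by rewrite -rmorphXn rS.
by rewrite -redp_mapE rE.
Qed.

End Theta.

(** * Complete rings *)

(** An [a]-adic limit alone would not be congruent to [u n] modulo $b^n$. The tail after [n] is
    $b^n$ times a series that itself converges [a]-adically, to [l n]. *)
Lemma complete_of_divides (R : comPzRingType) (a b : R) :
  adically_complete a -> divides a b -> adically_complete b.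
Proof.
move=> [sep lim] [c ->]; split.
  move=> x H; apply: sep => n; have [d ->] := H n.
  by rewrite exprMn -mulrA; eexists.
move=> u uP; have /choice [s sE] := uP.
have uE n m : u (n + m)%N = u n + (a * c) ^+ n * \sum_(i < m) (a * c) ^+ i * s (n + i)%N.
  elim: m => [|m IHm]; first by rewrite addn0 big_ord0 mulr0 addr0.
  have -> : u (n + m.+1)%N = u (n + m)%N + (a * c) ^+ (n + m) * s (n + m)%N.
    by rewrite addnS -sE addrC subrK.
  by rewrite IHm big_ord_recr /= exprD; ring.
have lims n : exists l, forall m, divides (a ^+ m) (l - \sum_(i < m) (a * c) ^+ i * s (n + i)%N).
  apply: lim => m; rewrite big_ord_recr /= addrAC subrr add0r exprMn -mulrA.
  by eexists.
have /choice [l lP] := lims.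
exists (u 0%N + l 0%N) => n; exists (l n).
apply/eqP; rewrite -subr_eq0; apply/eqP; apply: sep => m.
have [d dE] := lP 0%N (n + m)%N; have [d' d'E] := lP n m.
have {dE} -> : l 0%N = \sum_(i < n + m) (a * c) ^+ i * s (0 + i)%N + a ^+ (n + m) * d.
  by rewrite -dE addrC subrK.
have {d'E} -> : l n = \sum_(i < m) (a * c) ^+ i * s (n + i)%N + a ^+ m * d'.
  by rewrite -d'E addrC subrK.
have := uE 0%N (n + m)%N; rewrite add0n expr0 mul1r uE => E.
rewrite addrA -E exprD; exists (a ^+ n * d - (a * c) ^+ n * d'); ring.
Qed.

Lemma complete_of_exp (R : comPzRingType) (a : R) k : (0 < k)%N ->
  adically_complete (a ^+ k) -> adically_complete a.
Proof.
move=> k_gt0 [sep lim]; split.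
  by move=> x H; apply: sep => n; rewrite -exprM; exact: H.
move=> u uP.
have uE n m : divides (a ^+ n) (u (n + m)%N - u n).
  elim: m => [|m IHm]; first by rewrite addn0 subrr; exact: divides0.
  rewrite addnS; apply: divides_trans IHm.
  by have [c ->] := uP (n + m)%N; rewrite exprD -mulrA; eexists.
have [l lP] : exists l, forall n, divides ((a ^+ k) ^+ n) (l - u (k * n)%N).
  by apply: lim => n; rewrite -exprM mulnS addnC; exact: uE.
exists l => n; apply: (@divides_trans _ _ _ (u (k * n)%N)).
  have [c ->] := lP n; rewrite -exprM -(prednK k_gt0) mulSn exprD -mulrA.
  by eexists.
by rewrite -(subnKC (leq_pmull n k_gt0)); exact: uE.
Qed.

Section CompleteTheta.
Variables (p : nat) (p_pr : prime p) (C : comPzRingType).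
Hypothesis compC : adically_complete (p%:R : C).
Implicit Types (f g : tilt p_pr C) (a b w : WittRing p_pr (tilt p_pr C)) (r s : C).

Lemma complete_sep r : (forall n, divides (p ^ n)%:R r) -> r = 0.
Proof. by have [sep _] := compC => H; apply: sep => n; rewrite -natrX. Qed.

Lemma complete_eq r s : (forall n, divides (p ^ n)%:R (r - s)) -> r = s.
Proof. by move=> /complete_sep /eqP; rewrite subr_eq0 => /eqP. Qed.

Lemma complete_lim (u : nat -> C) : (forall n, divides (p ^ n)%:R (u n.+1 - u n)) ->
  exists l, forall n, divides (p ^ n)%:R (l - u n).
Proof.
have [_ lim] := compC => uP; have [|l lP] := lim u.
  by move=> n; rewrite -natrX.
by exists l => n; rewrite natrX.
Qed.

Lemma sharp_seq_uniq f (r r' : nat -> C) : sharp_seq f r -> sharp_seq f r' -> r = r'.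
Proof.
move=> fr fr'; apply/funext => n; apply: complete_eq => k.
rewrite -(sharp_seqX n k fr) -(sharp_seqX n k fr').
have [|c ->] := @divides_expr _ p k (r (n + k)%N) (r' (n + k)%N) p_pr.
  by apply/redp_eq; case: fr fr' => _ -> [_ ->].
by rewrite expnSr natrM -mulrA; eexists.
Qed.

Lemma sharp_seq_exists f : exists r : nat -> C, sharp_seq f r.
Proof.
have /choice [z zP] : forall n, exists z, redp p C z = tilt_ev n f by move=> n; exact: redp_surj.
have zz n : divides p%:R (z n.+1 ^+ p - z n).
  by apply/redp_eq; rewrite rmorphXn !zP tilt_evS.
have lims n : exists l, forall k, divides (p ^ k)%:R (l - z (n + k)%N ^+ (p ^ k)).
  apply: complete_lim => k; rewrite addnS expnS exprM.
  have [c ->] := @divides_expr _ p k _ _ p_pr (zz (n + k)%N).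
  by rewrite expnSr natrM -mulrA; eexists.
have /choice [r rP] := lims; exists r; split=> n.
  apply: complete_eq => k.
  apply: (@divides_trans _ _ _ (z (n + k.+1)%N ^+ (p ^ k.+1))).
    rewrite addnS -addSn expnSr exprM subrXX; apply: dividesMr; exact: rP.
  rewrite -opprB; apply: dividesN; have [c ->] := rP n k.+1.
  by rewrite expnSr natrM -mulrA; eexists.
rewrite -zP; apply/redp_eq; apply: divides_trans (zz n).
by have := rP n 1%N; rewrite addn1 expn1.
Qed.

Lemma tilt_seqP f : sharp_seq f (tilt_seq f).
Proof. exact: (xgetPex (fun=> 0 : C) (sharp_seq_exists f)). Qed.

Lemma tilt_seqS f n : tilt_seq f n.+1 ^+ p = tilt_seq f n.
Proof. by case: (tilt_seqP f). Qed.

Lemma tilt_seqX f n k : tilt_seq f (n + k)%N ^+ (p ^ k) = tilt_seq f n.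
Proof. exact: sharp_seqX (tilt_seqP f). Qed.

Lemma redp_tilt_seq f n : redp p C (tilt_seq f n) = tilt_ev n f.
Proof. by case: (tilt_seqP f). Qed.

Lemma tilt_seq_eq f (r : nat -> C) : sharp_seq f r -> tilt_seq f = r.
Proof. by move=> fr; exact: sharp_seq_uniq (tilt_seqP f) fr. Qed.

Lemma tilt_seq_root f n k : tilt_seq (tilt_root k f) n = tilt_seq f (n + k)%N.
Proof.
rewrite (@tilt_seq_eq _ (fun n => tilt_seq f (n + k)%N)) //; split=> m.
  by rewrite addSn tilt_seqS.
by rewrite redp_tilt_seq.
Qed.

Lemma tilt_seqM f g n : tilt_seq (f * g) n = tilt_seq f n * tilt_seq g n.
Proof.
rewrite (@tilt_seq_eq _ (fun n => tilt_seq f n * tilt_seq g n)) //; split=> m.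
  by rewrite exprMn !tilt_seqS.
by rewrite !rmorphM /= !redp_tilt_seq.
Qed.

Lemma tilt_seq0 n : tilt_seq (0 : tilt p_pr C) n = 0.
Proof.
rewrite (@tilt_seq_eq _ (fun=> 0)) //; split=> m.
  by rewrite expr0n (gtn_eqF (prime_gt0 p_pr)).
by rewrite !rmorph0.
Qed.

Lemma sharpM f g : sharp (f * g) = sharp f * sharp g. Proof. exact: tilt_seqM. Qed.

Lemma sharpX f k : sharp (f ^+ k) = sharp f ^+ k.
Proof.
elim: k => [|k IHk]; last by rewrite !exprS sharpM IHk.
rewrite !expr0 /sharp (@tilt_seq_eq _ (fun=> 1)) //; split=> m; first exact: expr1n.
by rewrite !rmorph1.
Qed.

Lemma theta_rel_exists w : exists r, theta_rel w r.
Proof.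
have /choice [l lP] := fun n => witt_lifts w n.
pose lp n : WittRing p_pr C := fun i => l n.+1 i ^+ p.
have lpE n : witt_map p_pr (redp p C) (lp n) = witt_map p_pr (@tilt_ev p p_pr C n) w.
  apply/funext => i; have := congr1 (fun x : WittRing p_pr _ => x i) (lP n.+1).
  by rewrite /witt_map /lp rmorphXn /= => ->; rewrite tilt_evS.
have [|r rP] := @complete_lim (fun n => if n is m.+1 then ghost p (l m) m else 0).
  move=> [|n]; first by exists (ghost p (l 0%N) 0%N); rewrite expn0 mul1r subr0.
  have [c cE] := ghost_redp n (etrans (lpE n) (esym (lP n))).
  have -> : ghost p (l n.+1) n.+1 = ghost p (lp n) n + (p ^ n.+1)%:R * l n.+1 n.+1.
    rewrite ghostS; congr (_ + _); apply: eq_bigr => i _.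
    by rewrite /lp -exprM -expnS subSn // -ltnS.
  by exists (l n.+1 n.+1 + c); rewrite mulrDr -cE; ring.
exists r; apply: theta_rel_intro => n; exists (l n).
by split=> //; exact: rP n.+1.
Qed.

Lemma theta_relP w : theta_rel w (theta w).
Proof.
have setE r : theta_rel w r <-> forall N, divides (p%:R ^+ N)
    (r - \sum_(n < N) sharp (tilt_root n (w n)) * p%:R ^+ n).
  (* For the lift by the components [tilt_seq], the ghost component $n$ is the partial sum of $n+1$
     terms defining [theta]; the condition for $N = 0$ is void. *)
  pose l n : WittRing p_pr C := fun i => tilt_seq (w i) n.
  have lE n : witt_map p_pr (redp p C) (l n) = witt_map p_pr (@tilt_ev p p_pr C n) w.
    by apply/funext => i; exact: redp_tilt_seq.
  have gE n : \sum_(i < n.+1) sharp (tilt_root i (w i)) * p%:R ^+ i = ghost p (l n) n.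
    apply: eq_bigr => i _; rewrite /sharp tilt_seq_root add0n mulrC natrX; congr (_ * _).
    by rewrite -(tilt_seqX (w i) i (n - i)) subnKC // -ltnS.
  split=> [H [|n]|H]; first by rewrite expr0; eexists; rewrite mul1r.
    by rewrite gE -natrX; exact: H.
  apply: theta_rel_intro => n; exists (l n); split=> //.
  by rewrite -gE natrX; exact: H.
have [r rP] := theta_rel_exists w; apply/setE.
pose P : set C := [set r | forall N, divides (p%:R ^+ N)
  (r - \sum_(n < N) sharp (tilt_root n (w n)) * p%:R ^+ n)].
by have := @xgetPex _ 0 P (ex_intro _ r (iffLR (setE r) rP)).
Qed.

Lemma theta_eq w r : theta_rel w r -> theta w = r.
Proof. by move=> wr; apply: complete_eq => n; apply: (theta_rel_uniq (a := w)) => //; exact: theta_relP. Qed.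

Lemma thetaB a b : theta (a - b) = theta a - theta b.
Proof. by apply: theta_eq; apply: theta_relB; exact: theta_relP. Qed.
Lemma thetaD a b : theta (a + b) = theta a + theta b.
Proof. by apply: theta_eq; apply: theta_relD; exact: theta_relP. Qed.
Lemma thetaM a b : theta (a * b) = theta a * theta b.
Proof. by apply: theta_eq; apply: theta_relM; exact: theta_relP. Qed.
Lemma theta_nat k : theta (k%:R : WittRing p_pr (tilt p_pr C)) = k%:R.
Proof. by apply: theta_eq; exact: theta_rel_nat. Qed.
Lemma theta0 : theta (0 : WittRing p_pr (tilt p_pr C)) = 0.
Proof. exact: (theta_nat 0). Qed.
Lemma thetaXp n : theta (p%:R ^+ n : WittRing p_pr (tilt p_pr C)) = p%:R ^+ n.
Proof. by rewrite -!natrX theta_nat. Qed.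
Lemma theta_teich f : theta (teich p_pr f) = sharp f.
Proof. by apply: theta_eq; apply: theta_rel_teich; exact: tilt_seqP. Qed.
Lemma theta_redp w : redp p C (theta w) = tilt_ev 0 (w 0%N).
Proof. by apply: theta_rel_ev; exact: theta_relP. Qed.

Hypothesis semiC : forall y : quotient_ring (principal_ideal (p%:R : C)), exists x, x ^+ p = y.

Lemma tilt_ev_surj n y : exists f : tilt p_pr C, tilt_ev n f = y.
Proof.
have /choice [rt rtP] := semiC.
have rP m : iter m.+1 rt y ^+ p = iter m rt y by rewrite /= rtP.
exists (mk_tilt p_pr rP ^+ (p ^ n)).
by rewrite rmorphXn /=; have := tilt_evX (mk_tilt p_pr rP) 0 n; rewrite add0n => ->.
Qed.

Lemma theta_surj r : exists w : WittRing p_pr (tilt p_pr C), theta w = r.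
Proof.
have step x : exists fy : tilt p_pr C * C, x = sharp fy.1 + p%:R * fy.2.
  have [f fE] := tilt_ev_surj 0 (redp p C x).
  have /redp_eq [y yE] : redp p C x = redp p C (sharp f) by rewrite redp_tilt_seq.
  by exists (f, y); rewrite -yE addrC subrK.
have /choice [h hP] := step.
pose x n := iter n (fun x => (h x).2) r.
have [w wP] := witt_sum (p_pr := p_pr) (tilt_perfect p_pr C) (fun n => teich p_pr (h (x n)).1).
exists w; apply: complete_eq => n; rewrite natrX.
have [c /eqP] := wP n; rewrite subr_eq => /eqP ->.
rewrite thetaD thetaM thetaXp.
have -> : r = theta (\sum_(i < n) p%:R ^+ i * teich p_pr (h (x i)).1) + p%:R ^+ n * x n.
  elim: n {wP c} => [|n IHn]; first by rewrite big_ord0 theta0 add0r mul1r.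
  rewrite IHn big_ord_recr /= thetaD thetaM thetaXp theta_teich {1}(hP (x n)) exprSr.
  by rewrite mulrDr addrA mulrA.
by exists (theta c - x n); ring.
Qed.
End CompleteTheta.

(** * The kernel of Fontaine's map *)

Section DeltaTheory.
Variables (p : nat) (p_pr : prime p) (D : comPzRingType) (perfD : perfect p D).
Variables (t : D) (e : WittRing p_pr D).
Hypothesis e_unit : exists x, e 0%N * x = 1.
Local Notation W := (WittRing p_pr D).
Implicit Types (y z w u : W).

Lemma witt_delta0 y : (witt_delta t e * y) 0%N = - (t * e 0%N * y 0%N).
Proof.
by rewrite wittM0 /witt_delta wittB0 wittM0 witt_nat0 (perfect_p0 perfD) sub0r /= mulNr.
Qed.

Lemma delta_divides_p y z : witt_delta t e * y = p%:R * (p%:R * z) ->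
  divides p%:R y.
Proof.
move=> E; have [x ex] := e_unit.
have ty0 : t * y 0%N = 0.
  have := congr1 (fun a : W => a 0%N) E.
  rewrite witt_delta0 wittM0 witt_nat0 (perfect_p0 perfD) mul0r => /eqP.
  rewrite oppr_eq0 => /eqP H; rewrite -[LHS]mulr1 -ex.
  have -> : t * y 0%N * (e 0%N * x) = t * e 0%N * y 0%N * x by ring.
  by rewrite H mul0r.
have [y2 yE] := witt_decomp perfD y.
have ty : teich p_pr t * y = p%:R * (teich p_pr t * y2).
  by rewrite {1}yE mulrDr -teichM ty0 teich0 add0r mulrCA.
have {}E : y - e * (teich p_pr t * y2) = p%:R * z.
  apply: (witt_p_inj perfD); rewrite -E /witt_delta mulrBl mulrBr; congr (_ - _).
  by rewrite [in RHS]mulrAC ty; ring.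
have y0 : y 0%N = e 0%N * t * y2 0%N.
  have := congr1 (fun a : W => a 0%N) E.
  rewrite wittB0 !wittM0 witt_nat0 (perfect_p0 perfD) mul0r /= mulrA => /eqP.
  by rewrite subr_eq0 => /eqP.
have y00 : y 0%N = 0.
  apply: (perfect_reduced p_pr perfD (n := 2)).
  have -> : y 0%N ^+ 2 = e 0%N * y2 0%N * (t * y 0%N) by rewrite expr2 {1}y0; ring.
  by rewrite ty0 mulr0.
by exists y2; rewrite yE y00 teich0 add0r.
Qed.

(** The element [t] may be a zero divisor. The heads give $t y_0 = 0$; after cancelling one $p$,
    they give $y_0 \in tD$. So $y_0^2 = 0$, and [D] is reduced. The second factor $p$ in the
    hypothesis pays for the cancellation. *)
Lemma delta_divides_pX n y : divides (p%:R ^+ n.+1) (witt_delta t e * y) ->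
  divides (p%:R ^+ n) y.
Proof.
elim: n y => [|n IHn] y [z zE]; first by exists y; rewrite expr0 mul1r.
have [|y' y'E] := @delta_divides_p y (p%:R ^+ n * z).
  by rewrite zE !exprS; ring.
have [|y2 y2E] := IHn y'.
  exists z; apply: (witt_p_inj perfD); rewrite mulrCA -y'E zE [in LHS]exprS; ring.
by exists y2; rewrite y'E y2E exprS mulrA.
Qed.

(** The approximate quotients form a $p$-adic Cauchy sequence by [delta_divides_pX], which loses one
    power of $p$; hence the shift to [y n.+1]. *)
Lemma delta_closed w :
  (forall n, exists y z, w = witt_delta t e * y + p%:R ^+ n * z) ->
  exists y, w = witt_delta t e * y.
Proof.
move=> /choice [y /choice [z wE]].
have /choice [c cE] n : divides (p%:R ^+ n) (y n.+2 - y n.+1).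
  apply: delta_divides_pX; exists (z n.+1 - p%:R * z n.+2).
  have := wE n.+2; rewrite {1}(wE n.+1) => E.
  have -> : witt_delta t e * (y n.+2 - y n.+1)
     = witt_delta t e * y n.+2 + p%:R ^+ n.+2 * z n.+2
       - (witt_delta t e * y n.+1 + p%:R ^+ n.+1 * z n.+1)
       + p%:R ^+ n.+1 * z n.+1 - p%:R ^+ n.+2 * z n.+2 by ring.
  by rewrite E subrr add0r !exprS; ring.
have yE n : y n.+1 = y 1%N + \sum_(i < n) p%:R ^+ i * c i.
  elim: n => [|n IHn]; first by rewrite big_ord0 addr0.
  by rewrite big_ord_recr /= addrA -IHn -cE addrC subrK.
have [u uP] := witt_sum (p_pr := p_pr) perfD c.
exists (y 1%N + u); apply/eqP; rewrite -subr_eq0; apply/eqP.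
apply: (witt_sep perfD) => n; have [d dE] := uP n.
rewrite (wE n.+1) yE; set s := \sum_(i < n) _ in dE *.
have -> : u = s + p%:R ^+ n * d by rewrite -dE addrC subrK.
by exists (p%:R * z n.+1 - witt_delta t e * d); rewrite exprSr; ring.
Qed.

End DeltaTheory.

Section Untilt.
Variables (p : nat) (p_pr : prime p).

Definition semiperfect (C : comPzRingType) : Prop :=
  forall y : quotient_ring (principal_ideal (p%:R : C)), exists x, x ^+ p = y.

(** Phrased with [theta_rel] so that it passes along every ring morphism, also to rings that are not
    complete. *)
Definition distinguished (C : comPzRingType) (t : tilt p_pr C)
    (e : WittRing p_pr (tilt p_pr C)) : Prop :=
  [/\ tilt_ev 0 t = 0, exists x, e 0%N * x = 1 & theta_rel (witt_delta t e) 0].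

Lemma perfectoid_complete (C : comPzRingType) :
  perfectoid p_pr C -> adically_complete (p%:R : C) /\ semiperfect C.
Proof.
move=> [varpi [comp [c cE] semi _]]; split=> //.
apply: complete_of_divides comp _; exists (varpi ^+ p.-1 * c).
by rewrite mulrA -exprS prednK ?prime_gt0.
Qed.

Lemma distinguished_exists (C : comPzRingType) (t : tilt p_pr C) (v v' : C) :
  adically_complete (p%:R : C) -> semiperfect C -> v * v' = 1 ->
  sharp t = v * p%:R -> exists e, distinguished t e.
Proof.
move=> compC semiC vv tE; have [e eE] := theta_surj p_pr compC semiC v'.
exists e; split.
- by rewrite -(redp_tilt_seq compC) -/(sharp t) tE rmorphM rmorph_nat natr_quotient_p mulr0.
- have [x ex] : exists x, e 0%N * x = 1; last by exists x.
  apply: (tilt_unit (x := redp p C v)).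
  by rewrite -(theta_redp compC) eE -rmorphM mulrC vv rmorph1.
- have <- : theta (witt_delta t e) = 0; last exact: theta_relP.
  rewrite /witt_delta (thetaB compC) (thetaM compC) (theta_nat p_pr compC) (theta_teich compC).
  by rewrite eE tE mulrAC vv mul1r subrr.
Qed.

Lemma distinguished_map (C C' : comPzRingType) (phi : {rmorphism C -> C'}) t e :
  distinguished (C := C) t e ->
  distinguished (tilt_map p_pr phi t) (witt_map p_pr (tilt_map p_pr phi) e).
Proof.
move=> [t0 [x ex] d0]; split.
- by rewrite tilt_map_ev t0 rmorph0.
- by exists (tilt_map p_pr phi x); rewrite /witt_map -rmorphM ex rmorph1.
- rewrite -witt_map_delta -(rmorph0 phi); exact: theta_rel_map.
Qed.

(** In $p = \xi a + [t]e$ the leading parts contribute only their carry [k], so a factor [P] comes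
    out and can be cancelled. *)
Lemma kernel_component (R : comPzRingType) (P X x x2 a a0 a2 T e e0 e2 k : R) :
  X = x + P * x2 -> a = a0 + P * a2 -> e = e0 + P * e2 ->
  P = X * a + T * e -> T * e0 + x * a0 = P * k ->
  P = P * (k + T * e2 + (x * a2 + x2 * a)).
Proof.
move=> XE aE eE PE kE; rewrite [LHS]PE XE mulrDl {1}aE eE !mulrDr -kE; ring.
Qed.

Section Kernel.
Variables (C : comPzRingType) (t : tilt p_pr C) (e : WittRing p_pr (tilt p_pr C)).
Hypothesis dist : distinguished t e.
Hypothesis perfC : perfectoid p_pr C.
Let compC : adically_complete (p%:R : C) := proj1 (perfectoid_complete perfC).
Let semiC : semiperfect C := proj2 (perfectoid_complete perfC).
Let perfT := tilt_perfect p_pr C.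
Implicit Types (w u : WittRing p_pr (tilt p_pr C)).

Lemma theta_delta u : theta (witt_delta t e * u) = 0.
Proof.
have [_ _ d0] := dist.
by rewrite (thetaM compC) (theta_eq compC d0) mul0r.
Qed.

(* Comparing the components of index 1 in delta = xi a shows that a is a unit. *)
Lemma theta_kernel w : theta w = 0 <-> exists u, w = witt_delta t e * u.
Proof.
split=> [w0|[u ->]]; last exact: theta_delta.
have [_ [_ _ _ [xi xiP]]] := perfC.
have xiP' u : theta u = 0 <-> exists a, u = (xi : WittRing p_pr (tilt p_pr C)) * a.
  rewrite xiP; split=> -[a ->]; exists a; first exact: witt_mulE.
  by rewrite -witt_mulE.
have xi0 : tilt_ev 0 (xi 0%N) = 0.
  rewrite -(theta_redp compC xi).
  have -> : theta (xi : WittRing p_pr (tilt p_pr C)) = 0 by apply/xiP'; exists 1; rewrite mulr1.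
  exact: rmorph0.
have [a aE] : exists a, witt_delta t e = (xi : WittRing p_pr (tilt p_pr C)) * a.
  by apply/xiP'; rewrite -[X in theta X]mulr1 theta_delta.
have [t0 _ _] := dist.
have [x2 x2E] := witt_decomp perfT (xi : WittRing p_pr (tilt p_pr C)).
have [a2 a2E] := witt_decomp perfT a.
have [e2 e2E] := witt_decomp perfT e.
pose f := t * e 0%N; pose g := xi 0%N * a 0%N.
have fg : g = - f.
  have := congr1 (fun u : WittRing p_pr (tilt p_pr C) => u 0%N) aE.
  by rewrite wittM0 -[witt_delta t e]mulr1 (witt_delta0 perfT) witt10 mulr1 => H; rewrite /g /f -H.
have [k kE] := teich_add_carry p_pr perfT f g.
have [k' k'E] : divides t (k 0%N).
  have [b ->] : divides (teich p_pr t) k.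
    apply: (teich_divides_carry perfT kE); first by eexists.
    by rewrite fg -mulrN; exists (- e 0%N); rewrite mulrN.
  by rewrite wittM0; exists (b 0%N).
have E1 : 1 = k + teich p_pr t * e2 + (teich p_pr (xi 0%N) * a2 + x2 * a).
  apply: (witt_p_inj perfT); rewrite mulr1.
  apply: (kernel_component x2E a2E e2E); last first.
    by rewrite -!teichM -/f -/g kE fg subrr teich0 add0r.
  by apply/eqP; rewrite -subr_eq; apply/eqP.
have [b ab] : exists b, a * b = 1.
  suff [x ax] : exists x, a 0%N * x = 1 by apply: (witt_unit perfT (x := x)).
  (* At level 0 both $t$ and the head of $\xi$ vanish, and so does the head of the carry, a multiple
     of $t$. The head of [E1] reduces to $1 = x_{2,0}\, a_0$. *)
  apply: (tilt_unit (x := tilt_ev 0 (x2 0%N))).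
  have := congr1 (fun u : WittRing p_pr (tilt p_pr C) => tilt_ev 0 (u 0%N)) E1.
  rewrite !(wittD0, wittM0) witt10 k'E !(rmorphD, rmorphM) /= t0 xi0 !mul0r !add0r => H.
  by rewrite mulrC -H.
have /xiP' [u ->] := w0.
by exists (b * u); rewrite aE -mulrA [a * _]mulrA ab mul1r.
Qed.

(** If $f^\sharp = p\,\theta(u)$, then $[f] - pu$ is a multiple of $\delta$, and its head exhibits
    $f$ as a multiple of $t$. *)
Lemma tilt_ev0_divides f : tilt_ev 0 f = 0 -> divides t f.
Proof.
rewrite -(redp_tilt_seq compC) => f0.
have [y yE] : divides p%:R (sharp f).
  by rewrite -[sharp f]subr0; apply/redp_eq; rewrite rmorph0.
have [u uE] := theta_surj p_pr compC semiC y.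
have /theta_kernel [c cE] : theta (teich p_pr f - p%:R * u) = 0.
  by rewrite (thetaB compC) (theta_teich compC) (thetaM compC) (theta_nat p_pr compC) uE yE subrr.
have := congr1 (fun a : WittRing p_pr (tilt p_pr C) => a 0%N) cE.
rewrite wittB0 wittM0 witt_nat0 (perfect_p0 perfT) mul0r subr0 (witt_delta0 perfT) /= => ->.
by exists (- (e 0%N * c 0%N)); rewrite mulrN mulrA.
Qed.

End Kernel.
End Untilt.

(** * Perfectoid quotients *)

Arguments tilt_map : simpl never.
Arguments redp_map : simpl never.
Arguments tilt_ev [p p_pr C] n f : simpl never.

Lemma adically_closedP (B : comPzRingType) (a : B) (I : set B) :
  adically_closed a I <-> forall x, (forall n, exists b, I (x + a ^+ n * b)) -> I x.
Proof.
rewrite /adically_closed -openC; split=> [oI x H|H].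
  have oI' : adic_open a (~` I) := oI.
  apply: contrapT => Ix; have [n nP] := oI' x Ix.
  by have [b Ib] := H n; exact: nP b Ib.
have -> : @open (adic a) (~` I) = adic_open a (~` I) by [].
move=> x Ix; apply: contrapT => H'; apply: Ix; apply: H => n.
apply: contrapT => nb; apply: H'; exists n => b Ib; apply: nb; by exists b.
Qed.

Lemma complete_quotient (R S : comPzRingType) (phi : {rmorphism R -> S}) (a : R) :
  (forall y, exists x, phi x = y) -> adically_complete a ->
  (forall y, (forall n, divides (phi a ^+ n) y) -> y = 0) -> adically_complete (phi a).
Proof.
move=> surj [_ lim] sep; split=> // u uP.
have /choice [s sE] := uP; have /choice [r rE] := fun n => surj (s n).
have [r0 r0E] := surj (u 0%N).
have uE n : u n = phi (r0 + \sum_(i < n) a ^+ i * r i).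
  elim: n => [|n IHn]; first by rewrite big_ord0 addr0.
  rewrite big_ord_recr /= addrA rmorphD -IHn rmorphM rmorphXn rE -sE addrC.
  by rewrite subrK.
have [|l lP] := lim (fun n => r0 + \sum_(i < n) a ^+ i * r i).
  move=> n; exists (r n); rewrite big_ord_recr /=.
  by set s' := \sum_(i < n) _; ring.
exists (phi l) => n; rewrite uE -rmorphB; have [c ->] := lP n.
by exists (phi c); rewrite rmorphM rmorphXn.
Qed.

Section PerfectoidQuotients.
Variables (p : nat) (p_pr : prime p) (R : comPzRingType) (perfR : perfectoid p_pr R).
Variables (t : tilt p_pr R) (e : WittRing p_pr (tilt p_pr R)) (v v' : R).
Hypotheses (vv : v * v' = 1) (tE : sharp t = v * p%:R) (dist : distinguished t e).
Let compR : adically_complete (p%:R : R) := proj1 (perfectoid_complete perfR).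
Let semiR : semiperfect p R := proj2 (perfectoid_complete perfR).
Local Notation A := (tilt p_pr R).
Local Notation W := (WittRing p_pr A).
Let perfA : perfect p A := tilt_perfect p_pr R.
Let t0 : tilt_ev 0 t = 0. Proof. by case: dist. Qed.

Definition untilt (I : set A) : set R :=
  [set x | exists w : W, (forall n, I (w n)) /\ theta w = x].

Section Quotient.
Variables (J : set R) (S : comPzRingType) (phi : {rmorphism R -> S}).
Hypotheses (phi_surj : forall y, exists x, phi x = y) (phi0 : forall x, phi x = 0 <-> J x).

Lemma tilt_seq_qmap : adically_complete (p%:R : S) -> forall (f : A) n,
  tilt_seq (tilt_map p_pr phi f) n = phi (tilt_seq f n).
Proof.
move=> compS f n.
by rewrite (tilt_seq_eq compS (sharp_seq_map phi (tilt_seqP compR f))).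
Qed.

Lemma tilt_idealE : adically_complete (p%:R : S) -> forall f : A,
  tilt_ideal p_pr J f <-> tilt_map p_pr phi f = 0.
Proof.
move=> compS f; split=> [H|f0 n].
  apply: tilt_ext => n; rewrite -(redp_tilt_seq compS) tilt_seq_qmap //.
  have -> : phi (tilt_seq f n) = 0 by apply/phi0; exact: H.
  by rewrite !rmorph0.
by apply/phi0; rewrite -(tilt_seq_qmap compS) f0 tilt_seq0.
Qed.

Lemma tilt_ideal_closed : adically_complete (p%:R : S) ->
  [/\ is_ideal (tilt_ideal p_pr J), is_radical (tilt_ideal p_pr J)
    & adically_closed t (tilt_ideal p_pr J)].
Proof.
move=> compS; split; first split.
- by apply/tilt_idealE => //; rewrite rmorph0.
- move=> f g /tilt_idealE => /(_ compS) f0 /tilt_idealE => /(_ compS) g0.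
  by apply/tilt_idealE => //; rewrite rmorphD /= f0 g0 addr0.
- move=> a f /tilt_idealE => /(_ compS) f0; apply/tilt_idealE => //.
  by rewrite rmorphM /= f0 mulr0.
- move=> f n /tilt_idealE => /(_ compS) f0; apply/tilt_idealE => //.
  apply: (perfect_reduced p_pr (tilt_perfect p_pr S) (n := n)).
  by rewrite -rmorphXn /= f0.
- apply/adically_closedP => f H; apply/tilt_idealE => //.
  have tS0 : tilt_ev 0 (tilt_map p_pr phi t) = 0 by rewrite tilt_map_ev t0 rmorph0.
  apply: (tilt_sep tS0) => n; have [b /tilt_idealE] := H n.
  move=> /(_ compS); rewrite rmorphD rmorphM rmorphXn /= => /eqP; rewrite addr_eq0 => /eqP ->.
  by exists (- tilt_map p_pr phi b); rewrite mulrN.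
Qed.

Lemma tilt_map_ev_surj (g : tilt p_pr S) n :
  exists f : A, tilt_ev n (tilt_map p_pr phi f) = tilt_ev n g.
Proof.
have [s sE] := redp_surj (tilt_ev n g); have [r rE] := phi_surj s.
have [f fE] := tilt_ev_surj p_pr semiR n (redp p R r).
by exists f; rewrite tilt_map_ev fE redp_mapE -sE -rE.
Qed.

(** In the tilt of [S] the elements vanishing at level 0 are multiples of $t$, so a lift modulo $t$
    improves by successive approximation. *)
Lemma tilt_map_surj (perfS : perfectoid p_pr S) (g : tilt p_pr S) :
  exists f : A, tilt_map p_pr phi f = g.
Proof.
have distS := distinguished_map phi dist.
have step h : exists fh : A * tilt p_pr S,
    h = tilt_map p_pr phi fh.1 + tilt_map p_pr phi t * fh.2.
  have [f fE] := tilt_map_ev_surj h 0.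
  have [|h' h'E] := tilt_ev0_divides distS perfS (f := h - tilt_map p_pr phi f).
    by rewrite rmorphB /= fE subrr.
  by exists (f, h'); rewrite -h'E addrC subrK.
have /choice [k kP] := step; pose h n := iter n (fun x => (k x).2) g.
have [f fP] := tilt_sums t0 (fun n => (k (h n)).1); exists f.
apply/eqP; rewrite -subr_eq0; apply/eqP.
apply: (tilt_sep (t := tilt_map p_pr phi t)) => [|n].
  by rewrite tilt_map_ev t0 rmorph0.
have gE : g = tilt_map p_pr phi (\sum_(m < n) t ^+ m * (k (h m)).1)
    + tilt_map p_pr phi t ^+ n * h n.
  elim: n => [|n IHn]; first by rewrite big_ord0 rmorph0 add0r expr0 mul1r.
  rewrite IHn {1}(kP (h n)) big_ord_recr rmorphD rmorphM rmorphXn exprSr.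
  by rewrite mulrDr addrA mulrA.
have [c cE] := fP n; exists (tilt_map p_pr phi c - h n).
rewrite {1}gE opprD addrA -rmorphB cE rmorphM rmorphXn /=; ring.
Qed.
(** If $\theta(w) \in J$, the image of $w$ over the tilt of [S] is $\delta u$. Lifting $u$ and
    subtracting its multiple of $\delta$ moves $w$ into $W(J^\flat)$ without changing
    $\theta(w)$. *)
Lemma untilt_tilt_ideal : perfectoid p_pr S -> untilt (tilt_ideal p_pr J) = J.
Proof.
move=> perfS; have [compS _] := perfectoid_complete perfS.
have distS := distinguished_map phi dist.
have theta_phi w : theta (witt_map p_pr (tilt_map p_pr phi) w) = phi (theta w).
  by apply: (theta_eq compS); apply: theta_rel_map; exact: theta_relP.
apply/seteqP; split=> [_ [w [wJ <-]]|x Jx].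
  apply/phi0; rewrite -theta_phi.
  have -> : witt_map p_pr (tilt_map p_pr phi) w = 0.
    by apply/witt_map_eq0 => i; apply/tilt_idealE.
  exact: theta0.
have [w wE] := theta_surj p_pr compR semiR x.
have : theta (witt_map p_pr (tilt_map p_pr phi) w) = 0.
  by rewrite theta_phi wE; apply/phi0.
move=> /(theta_kernel distS perfS) [u uE].
have [u0 u0E] := witt_map_surj (f := tilt_map p_pr phi) (tilt_map_surj perfS) u.
exists (w - witt_delta t e * u0); split=> [i|]; last first.
  by rewrite (thetaB compR) (theta_delta dist perfR) subr0.
apply/tilt_idealE => //; move: i; apply/witt_map_eq0.
by rewrite rmorphB rmorphM /= uE witt_map_delta u0E subrr.
Qed.
End Quotient.

Section Untilt.
Variables (I : set A) (D : comPzRingType) (q : {rmorphism A -> D}).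
Hypotheses (q_surj : forall y, exists f, q f = y) (q0 : forall f, q f = 0 <-> I f).
Hypotheses (perfD : perfect p D) (closI : adically_closed t I).
Local Notation deltaD := (witt_delta (q t) (witt_map p_pr q e)).

Lemma map_eq0 (w : W) : (forall i, I (w i)) <-> witt_map p_pr q w = 0.
Proof.
by split=> [H|/witt_map_eq0 H i]; [apply/witt_map_eq0 => i|]; apply/q0; exact: H.
Qed.

Lemma untiltP (w : W) : untilt I (theta w) <-> exists y, witt_map p_pr q w = deltaD * y.
Proof.
split=> [[w' [w'I ww']]|[y yE]].
  have /(theta_kernel dist perfR) [u uE] : theta (w - w') = 0.
    by rewrite (thetaB compR) ww' subrr.
  exists (witt_map p_pr q u); rewrite -[w](subrK w') uE rmorphD rmorphM /= witt_map_delta.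
  by rewrite [X in _ + X](iffLR (map_eq0 w') w'I) addr0.
have [u uE] := witt_map_surj (f := q) q_surj y.
exists (w - witt_delta t e * u); split.
  by apply/map_eq0; rewrite rmorphB rmorphM /= witt_map_delta yE uE subrr.
by rewrite (thetaB compR) (theta_delta dist perfR) subr0.
Qed.

Lemma untilt_is_ideal : is_ideal (untilt I).
Proof.
split.
- by exists 0; split; [by apply/map_eq0; rewrite rmorph0 | exact: theta0].
- move=> _ _ [w [wI <-]] [w' [w'I <-]]; exists (w + w'); split; last exact: thetaD.
  by apply/map_eq0; rewrite rmorphD /= !(iffLR (map_eq0 _)) ?addr0.
- move=> a _ [w [wI <-]]; have [b <-] := theta_surj p_pr compR semiR a.
  exists (b * w); split; last exact: thetaM.
  by apply/map_eq0; rewrite rmorphM /= (iffLR (map_eq0 w)) ?mulr0.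
Qed.

Variables (S : comPzRingType) (phi : {rmorphism R -> S}).
Hypotheses (phi_surj : forall y, exists x, phi x = y).
Hypothesis phi0 : forall x, phi x = 0 <-> untilt I x.

Lemma e_unitD : exists x, witt_map p_pr q e 0%N * x = 1.
Proof.
by have [_ [x ex] _] := dist; exists (q x); rewrite /witt_map -rmorphM ex rmorph1.
Qed.

Lemma phi_eq x y : phi x = phi y -> untilt I (x - y).
Proof. by move=> xy; apply/phi0; rewrite rmorphB xy subrr. Qed.

(** By [untiltP], separatedness of [S] says that the ideal generated by $\delta$ in $W(A/I)$ is
    $p$-adically closed. *)
Lemma untilt_complete : adically_complete (p%:R : S).
Proof.
rewrite -(rmorph_nat phi); apply: complete_quotient => //.
move=> y H; have [x xE] := phi_surj y; rewrite -xE; apply/phi0.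
have [w wE] := theta_surj p_pr compR semiR x; rewrite -wE; apply/untiltP.
apply: (delta_closed perfD e_unitD) => n.
have [c] := H n; have [r <-] := phi_surj c.
rewrite -rmorphXn -rmorphM -xE => /phi_eq; have [u <-] := theta_surj p_pr compR semiR r.
rewrite -wE -(thetaXp p_pr compR) -(thetaM compR) -(thetaB compR) => /untiltP [z zE].
by exists z, (witt_map p_pr q u); rewrite -zE rmorphB rmorphM rmorphXn rmorph_nat subrK.
Qed.

Lemma tilt_seq_root0 (f : A) n : tilt_seq f n = sharp (tilt_root n f).
Proof. by rewrite /sharp tilt_seq_root. Qed.

Lemma q_eq f g : q f = q g -> I (f - g).
Proof. by move=> fg; apply/q0; rewrite rmorphB fg subrr. Qed.

(** Since $f^{(n)}$ is the sharp of $f^{1/p^n}$, comparing heads puts $f^{1/p^n}$ into $tA + I$;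
    raise this to the power $p^n$. *)
Lemma untilt_mod_p (f : A) n r : untilt I (tilt_seq f n - p%:R * r) ->
  exists b, I (f - t ^+ (p ^ n) * b).
Proof.
have [u <-] := theta_surj p_pr compR semiR r.
rewrite tilt_seq_root0 -(theta_teich compR) -(theta_nat p_pr compR p) -(thetaM compR) -(thetaB compR).
move=> /untiltP [y /(congr1 (fun a : WittRing p_pr D => a 0%N))].
rewrite (witt_delta0 perfD) /witt_map wittB0 wittM0 witt_nat0 (perfect_p0 perfA) mul0r subr0.
have [y0 <-] := q_surj (y 0%N); rewrite /= -!rmorphM -rmorphN => /q_eq H.
exists ((- (e 0%N * y0)) ^+ (p ^ n)).
rewrite -exprMn -{1}(tilt_rootX f n) -(frob_expB p_pr (perfect_p0 perfA)).
apply/q0; rewrite rmorphXn; set z := q _.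
have -> : z = 0 by apply/q0; rewrite mulrN mulrA.
by rewrite expr0n expn_eq0 -leqn0 leqNgt prime_gt0.
Qed.

Lemma tilt_ideal_untilt : tilt_ideal p_pr (untilt I) = I.
Proof.
apply/seteqP; split=> [f H|f If n].
  have /adically_closedP cl := closI; apply: cl => n.
  have [|b] := @untilt_mod_p f n 0; first by rewrite mulr0 subr0; exact: H.
  move=> Ib.
  have le : (n <= p ^ n)%N by rewrite ltnW // ltn_expl // prime_gt1.
  by exists (- (t ^+ (p ^ n - n) * b)); rewrite mulrN mulrA -exprD subnKC.
rewrite tilt_seq_root0 -(theta_teich compR); exists (teich p_pr (tilt_root n f)).
split=> // -[|i] /=; last by apply/q0; rewrite rmorph0.
apply/q0; apply: (perfect_reduced p_pr perfD (n := (p ^ n)%N)).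
by rewrite -rmorphXn tilt_rootX; apply/q0.
Qed.

Lemma tilt_map_untilt_surj (g : tilt p_pr S) : exists f : A, tilt_map p_pr phi f = g.
Proof.
have step (n : nat) (a : A) : exists b : A, tilt_ev n (g - tilt_map p_pr phi a) = 0 ->
    tilt_ev n.+1 (g - tilt_map p_pr phi (a + t ^+ (p ^ n) * b)) = 0.
  have [n0|] := pselect (tilt_ev n (g - tilt_map p_pr phi a) = 0); last by exists 0.
  have [f fE] := tilt_map_ev_surj phi_surj (g - tilt_map p_pr phi a) n.+1.
  have fn : tilt_ev n (tilt_map p_pr phi f) = 0 by rewrite -tilt_evS fE tilt_evS.
  (* A lift $f$ vanishing at level $n$ over [S] has $f^{(n)} \in pR + J$, so it agrees with a
     multiple of $t^{p^n}$ modulo $I$. *)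
  have [r rJ] : exists r, untilt I (tilt_seq f n - p%:R * r).
    move: fn; rewrite -(redp_tilt_seq untilt_complete) (tilt_seq_qmap phi untilt_complete).
    rewrite -(rmorph0 (redp p S)) => /redp_eq [c]; have [r <-] := phi_surj c.
    rewrite subr0 -(rmorph_nat phi) -rmorphM => /phi_eq; by exists r.
  have [b bI] := untilt_mod_p rJ; exists b => _.
  have fb : tilt_map p_pr phi f = tilt_map p_pr phi (t ^+ (p ^ n) * b).
    apply/eqP; rewrite -subr_eq0 -rmorphB; apply/eqP.
    by apply/(tilt_idealE phi0 untilt_complete); rewrite tilt_ideal_untilt.
  by rewrite (rmorphD (tilt_map p_pr phi)) /= opprD addrA rmorphB /= -fb fE subrr.
have /choice [h hP] : forall na : nat * A, exists b : A,
    tilt_ev na.1 (g - tilt_map p_pr phi na.2) = 0 ->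
    tilt_ev na.1.+1 (g - tilt_map p_pr phi (na.2 + t ^+ (p ^ na.1) * b)) = 0.
  by move=> [n a]; exact: step.
have [a0 a0E] := tilt_map_ev_surj phi_surj g 0.
pose a := fix a n := if n is m.+1 then a m + t ^+ (p ^ m) * h (m, a m) else a0.
have aP n : tilt_ev n (g - tilt_map p_pr phi (a n)) = 0.
  by elim: n => [|n IHn]; [rewrite rmorphB /= a0E subrr | exact: (hP (n, a n))].
(* The correction $t^{p^n} b$ is split as $t^n \cdot t^{p^n-n} b$ to fit [tilt_sums]. *)
have [s sP] := tilt_sums t0 (fun n => t ^+ (p ^ n - n) * h (n, a n)).
have aE n : a n = a0 + \sum_(m < n) t ^+ m * (t ^+ (p ^ m - m) * h (m : nat, a m)).
  elim: n => [|n IHn]; first by rewrite big_ord0 addr0.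
  rewrite big_ord_recr /= addrA -IHn mulrA -exprD subnKC //.
  by rewrite ltnW // ltn_expl // prime_gt1.
exists (a0 + s); apply/esym/eqP; rewrite -subr_eq0; apply/eqP; apply: tilt_ext => n.
have [c cE] := sP (p ^ n)%N.
have -> : a0 + s = a (p ^ n)%N + t ^+ (p ^ n) * c by rewrite aE -cE -addrA (addrC (\sum_(m < _) _)) subrK.
rewrite (rmorphD (tilt_map p_pr phi)) /= opprD addrA rmorphB /= tilt_map_ev.
have -> : tilt_ev n (t ^+ (p ^ n) * c) = 0.
  by apply: etrans (rmorphM (tilt_ev n) _ _) _; rewrite [X in X * _](tilt_pow_ev t0) // mul0r.
rewrite !rmorph0 subr0.
by apply: tilt_ev0_le (aP (p ^ n)%N); rewrite ltnW // ltn_expl // prime_gt1.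
Qed.

Lemma untilt_perfectoid : perfectoid p_pr S.
Proof.
have compS := untilt_complete; have distS := distinguished_map phi dist.
have piE : tilt_seq t 1 ^+ p = v * p%:R by rewrite (tilt_seqS compR) -tE.
(* The image of a $p$-th root of $vp$: its $p$-th power is a unit times $p$. *)
exists (phi (tilt_seq t 1)); split.
- apply: (complete_of_exp (prime_gt0 p_pr)); rewrite -rmorphXn piE rmorphM rmorph_nat.
  by apply: complete_of_divides compS _; exists (phi v); rewrite mulrC.
- exists (phi v'); rewrite -rmorphXn piE -(rmorph_nat phi) -rmorphM; congr (phi _).
  by rewrite mulrAC vv mul1r.
- move=> y; have [s <-] := redp_surj y; have [r <-] := phi_surj s.
  have [x] := semiR (redp p R r); have [x0 <-] := redp_surj x => xE.
  by exists (redp_map p phi (redp p R x0)); rewrite -rmorphXn xE redp_mapE.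
exists (witt_delta (tilt_map p_pr phi t) (witt_map p_pr (tilt_map p_pr phi) e)).
move=> w; pose w' : WittRing p_pr (tilt p_pr S) := w; rewrite -[w]/w'.
move: w' => {}w.
split=> [w0|[u ->]]; last first.
  rewrite witt_mulE (thetaM compS); have [_ _ d0] := distS.
  by rewrite (theta_eq compS d0) mul0r.
(* A lift of $w$ has its theta in $\theta(W(I))$. Subtracting an element of $W(I)$, which dies over
   the tilt of [S], leaves a multiple of $\delta$. *)
have [w1 w1E] := witt_map_surj (f := tilt_map p_pr phi) tilt_map_untilt_surj w.
have : untilt I (theta w1).
  have : phi (theta w1) = 0.
    rewrite -w0 -w1E; apply/esym; apply: (theta_eq compS); apply: theta_rel_map.
    exact: theta_relP.
  by move=> /phi0.
move=> [w2 [w2I w21]].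
have /(theta_kernel dist perfR) [u uE] : theta (w1 - w2) = 0.
  by rewrite (thetaB compR) w21 subrr.
exists (witt_map p_pr (tilt_map p_pr phi) u); rewrite witt_mulE -w1E -[w1](subrK w2) uE.
rewrite rmorphD rmorphM /= witt_map_delta.
have -> : witt_map p_pr (tilt_map p_pr phi) w2 = 0; last by rewrite addr0.
apply/witt_map_eq0 => i; apply/(tilt_idealE phi0 compS).
by rewrite tilt_ideal_untilt.
Qed.

End Untilt.
End PerfectoidQuotients.

(** * Perfectoid rings with integral tilt *)

(** The ring is $S[X]/(aX-1)$. If $s = (aX-1)g$, then $g_k = -a^k s$ for all $k$; as $g$ is a
    polynomial, some $a^k s$ vanishes. *)
Lemma localization_exists (S : comPzRingType) (a : S) :
  (forall s, a * s = 0 -> s = 0) ->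
  exists (L : comPzRingType) (i : {rmorphism S -> L}) (b : L),
    [/\ injective i, i a * b = 1 & forall l, exists n s, i a ^+ n * l = i s].
Proof.
move=> tf; have [h|nz] := pselect (1 = 0 :> S).
  exists S, (idfun : {rmorphism S -> S}), 0; split=> [//||l]; first exact: zero_ring h _ _.
  by exists 0%N, l; rewrite expr0 mul1r.
pose N : comNzRingType := nzring nz.
pose d : {poly N} := (nz_in nz a)%:P * 'X - 1.
pose J := principal_ideal d.
pose i : {rmorphism S -> quotient_ring J} := qmap J \o (@polyC N \o @nz_in S nz).
have iaX : i a * qmap J 'X = 1.
  rewrite -[i a]/(qmap J (nz_in nz a)%:P) -rmorphM -(rmorph1 (qmap J)).
  by apply/qmap_eq; exists 1; rewrite mulr1.
exists (quotient_ring J), i, (qmap J 'X); split=> // [x y xy|l].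
  apply/eqP; rewrite -subr_eq0; apply/eqP; set s := x - y.
  have : i s = 0 by rewrite rmorphB xy subrr.
  move=> /qmap0 [g gE]; have gE' k : (nz_in nz s)%:P`_k = (d * g)`_k by rewrite -gE.
  have dE k : (d * g)`_k = a * (if k == 0%N then 0 else g`_k.-1) - g`_k.
    by rewrite mulrBl mul1r coefB -mulrA coefCM coefXM.
  have gk k : g`_k = - (a ^+ k * s).
    elim: k => [|k IHk].
      have := gE' 0%N; rewrite dE coefC /= mulr0 sub0r expr0 mul1r => sE.
      by rewrite -[s]/(nz_in nz s) sE opprK.
    have := gE' k.+1; rewrite dE coefC /= IHk => /esym/eqP; rewrite subr_eq0 => /eqP <-.
    by rewrite exprS mulrN mulrA.
  have := gk (size g); rewrite nth_default // => /esym/eqP; rewrite oppr_eq0 => /eqP.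
  by elim: (size g) => [|k IHk]; rewrite ?expr0 ?mul1r // exprS -mulrA => /tf.
have [q <-] := qmap_surj l; elim/poly_ind: q => [|q c [n [s ns]]].
  by exists 0%N, 0; rewrite !rmorph0 mulr0.
exists n.+1, (s + a ^+ n.+1 * c).
rewrite (rmorphD i) (rmorphM i) (rmorphXn i) -ns (rmorphD (qmap J)) (rmorphM (qmap J)) mulrDr.
by congr (_ + _); rewrite exprSr mulrACA iaX mulr1.
Qed.

Lemma theta_relM0 (p : nat) (p_pr : prime p) (C : comPzRingType)
    (a b : WittRing p_pr (tilt p_pr C)) : theta_rel a 0 -> theta_rel (a * b) 0.
Proof.
move=> a0; apply: theta_rel_intro => n.
have [l lE] := witt_lifts a n; have [m mE] := witt_lifts b n.
exists (l * m); split; first by rewrite !rmorphM /= lE mE.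
rewrite ghostM sub0r; apply: dividesN; apply: dividesMr.
by have := a0 n l lE; rewrite sub0r => /dividesN; rewrite opprK.
Qed.

(** * The kernel of theta over a root-closed ring *)

Section RootClosed.
Variables (p : nat) (p_pr : prime p) (C : comPzRingType).
Variables (t : tilt p_pr C) (e : WittRing p_pr (tilt p_pr C)) (pi : nat -> C) (v v' : C).
Hypotheses (vv : v * v' = 1) (tpi : sharp_seq t pi) (pi0 : pi 0%N = v * p%:R).
Hypotheses (dist : distinguished t e) (tf : torsion_free_at p C).
Hypothesis rc : forall k z, divides p%:R (z ^+ (p ^ k)) -> divides (pi k) z.

Lemma root_pow k : pi k ^+ (p ^ k) = v * p%:R.
Proof. by have := sharp_seqX 0 k tpi; rewrite add0n => ->. Qed.

Lemma p_root k : p%:R = v' * pi k ^+ (p ^ k).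
Proof. by rewrite root_pow mulrA [v' * v]mulrC vv mul1r. Qed.

Lemma root_tf k x : pi k * x = 0 -> x = 0.
Proof.
move=> x0; apply: tf; rewrite (p_root k) -(prednK (n := p ^ k)) ?expn_gt0 ?prime_gt0 //.
by rewrite exprSr -!mulrA x0 !mulr0.
Qed.

(** Replaces [tilt_ev0_divides] for rings that are not assumed perfectoid: by [rc], lifts of the
    components of $f$ can be divided by the roots [pi k]. *)
Lemma root_ev0_divides f : tilt_ev 0 f = 0 -> divides t f.
Proof.
move=> f0; have /choice [z zE] : forall k, exists z, redp p C z = tilt_ev k f.
  by move=> k; exact: redp_surj.
have /choice [q qE] : forall k, exists q, z k = pi k * q.
  move=> k; apply: rc; rewrite -[_ ^+ _]subr0; apply/redp_eq.
  by rewrite rmorphXn zE rmorph0 /= -[k in tilt_ev k]add0n tilt_evX.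
have zz k : divides p%:R (z k.+1 ^+ p - z k).
  by apply/redp_eq; rewrite rmorphXn !zE tilt_evS.
have pk k : (0 < p ^ k)%N by rewrite expn_gt0 prime_gt0.
(* Cancelling one factor [pi k] from $p$, a unit times $\pi_k^{p^k}$, leaves the exponent $p^k -
   1$. *)
have qq k : divides (pi k ^+ (p ^ k).-1) (q k.+1 ^+ p - q k).
  have [c cE] := zz k; exists (v' * c); apply/eqP; rewrite -subr_eq0; apply/eqP.
  apply: (root_tf (k := k)); rewrite mulrBr mulrBr -{1}(proj1 tpi) -exprMn -!qE cE.
  by rewrite (p_root k) -{1}(prednK (pk k)) exprS; ring.
(* The [q k] need not be compatible modulo $p$, but the $p$-th powers of the next ones are: the
   error $\pi_k^{p^{k+1}-1}$ is divisible by $\pi_k^{p^k} = vp$. *)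
have uP k : redp p C (q k.+2 ^+ p) ^+ p = redp p C (q k.+1 ^+ p).
  rewrite -rmorphXn; apply/redp_eq; have [c] := qq k.+1.
  move/eqP; rewrite subr_eq => /eqP ->; set m := _ ^+ _.
  apply: divides_trans (frobeniusD _ _ p_pr) _; rewrite addrK exprMn.
  apply: dividesMr; rewrite /m -exprM mulnC exprM (proj1 tpi).
  have le : (p ^ k <= (p ^ k.+1).-1)%N.
    rewrite -ltnS prednK ?pk // expnS -[X in (X < _)%N]mul1n ltn_pmul2r ?pk //.
    exact: prime_gt1.
  rewrite -(subnK le) exprD root_pow; do 2!apply: dividesMl; exists 1; by rewrite mulr1.
exists (mk_tilt p_pr uP); apply: tilt_ext => n; rewrite rmorphM /= mk_tilt_ev.
rewrite -(proj2 tpi) -rmorphM -(proj1 tpi) -exprMn -qE -zE; apply/esym/redp_eq.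
exact: zz.
Qed.

(** The head of an element of the kernel is $tg$, and $[t] = e^{-1}(p - \delta)$ makes the element
    $pb$ modulo $\delta$. By [theta_rel_div], [b] is again in the kernel, so the process
    iterates. *)
Lemma root_theta_kernel (w : WittRing p_pr (tilt p_pr C)) :
  theta_rel w 0 -> exists u, w = witt_delta t e * u.
Proof.
move=> w0; have [_ e_unit d0] := dist; have perfT := tilt_perfect p_pr C.
have [e' ee'] : exists e', e * e' = 1 by have [x ex] := e_unit; apply: (witt_unit perfT (x := x)).
have step (a : WittRing p_pr (tilt p_pr C)) : theta_rel a 0 ->
    exists y b, a = witt_delta t e * y + p%:R * b /\ theta_rel b 0.
  move=> a0; have [g gE] : divides t (a 0%N).
    by apply: root_ev0_divides; rewrite -(theta_rel_ev a0) rmorph0.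
  have [b aE] := witt_decomp perfT a.
  have E : a = witt_delta t e * - (e' * teich p_pr g) + p%:R * (b + e' * teich p_pr g).
    rewrite [LHS]aE gE teichM /witt_delta.
    transitivity (teich p_pr t * (e * e') * teich p_pr g + p%:R * b); last by ring.
    by rewrite ee' mulr1.
  exists (- (e' * teich p_pr g)), (b + e' * teich p_pr g); split=> //.
  apply: theta_rel_div tf _; rewrite mulr0 -[0]subr0.
  have -> : p%:R * (b + e' * teich p_pr g)
      = a - witt_delta t e * - (e' * teich p_pr g) by rewrite [X in _ = X - _]E; ring.
  by apply: theta_relB => //; exact: theta_relM0.
apply: (delta_closed perfT e_unit) => n.
suff [y [z [zE _]]] : exists y z, w = witt_delta t e * y + p%:R ^+ n * z /\ theta_rel z 0.
  by exists y, z.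
elim: n => [|n [y [z [zE /step [y' [b [bE b0]]]]]]].
  by exists 0, w; rewrite mulr0 add0r expr0 mul1r.
exists (y + p%:R ^+ n * y'), b; split=> //; rewrite zE bE exprSr; ring.
Qed.
End RootClosed.

(** * Zero divisors in a torsion-free perfectoid ring *)

Section TorsionFreeDomain.
Variables (p : nat) (p_pr : prime p) (S : comPzRingType) (perfS : perfectoid p_pr S).
Variables (t : tilt p_pr S) (e : WittRing p_pr (tilt p_pr S)) (v v' : S).
Hypotheses (vv : v * v' = 1) (tE : sharp t = v * p%:R) (dist : distinguished t e).
Let compS : adically_complete (p%:R : S) := proj1 (perfectoid_complete perfS).
Let semiS : semiperfect p S := proj2 (perfectoid_complete perfS).
Let perfT := tilt_perfect p_pr S.
Let t0 : tilt_ev 0 t = 0. Proof. by case: dist. Qed.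
Local Notation pi := (tilt_seq t).

(** In $pa = \delta b$ the heads give $t e_0 b_0 = 0$, so [b] is a multiple of $p$ and $p$ cancels
    in the Witt vectors. *)
Lemma perfectoid_torsion_free :
  (forall f, t * f = 0 -> f = 0) -> torsion_free_at p S.
Proof.
move=> t_reg s; have [a <-] := theta_surj p_pr compS semiS s => pa.
have /(theta_kernel dist perfS) [b bE] : theta (p%:R * a : WittRing p_pr (tilt p_pr S)) = 0.
  by rewrite (thetaM compS) (theta_nat p_pr compS).
have [_ [x ex] _] := dist.
have b0 : b 0%N = 0.
  apply: t_reg; have := witt_delta0 perfT t e b.
  rewrite -bE wittM0 witt_nat0 (perfect_p0 perfT) mul0r => /esym/eqP.
  rewrite oppr_eq0 => /eqP /(congr1 (fun z => z * x)); rewrite mul0r => <-.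
  by rewrite -[LHS]mulr1 -ex; ring.
have [b' b'E] := witt_decomp perfT b.
have : p%:R * (a - witt_delta t e * b') = 0.
  by rewrite mulrBr bE b'E b0 teich0; ring.
move=> /(witt_p_tf perfT) /eqP; rewrite subr_eq0 => /eqP ->.
exact: theta_delta dist perfS _.
Qed.

(** Modulo $p$, [z] is some $f^\sharp$. Then $f^{p^k}$ vanishes at level 0, so $t$ divides it, and
    perfectness makes $t^{1/p^k}$ divide $f$. *)
Lemma perfectoid_root_closed k z : divides p%:R (z ^+ (p ^ k)) -> divides (pi k) z.
Proof.
have [f fE] := tilt_ev_surj p_pr semiS 0 (redp p S z).
move: fE; rewrite -(redp_tilt_seq compS) => /esym/redp_eq [r zE] zk.
have pk : divides (pi k) p%:R.
  exists (v' * pi k ^+ (p ^ k).-1); rewrite mulrCA -exprS prednK ?expn_gt0 ?prime_gt0 //.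
  rewrite -[k in pi k]add0n (tilt_seqX compS) -/(sharp t) tE mulrA [v' * v]mulrC.
  by rewrite vv mul1r.
have [|h fh] := tilt_ev0_divides dist perfS (f := f ^+ (p ^ k)).
  rewrite rmorphXn /= -(redp_tilt_seq compS) -rmorphXn -(rmorph0 (redp p S)).
  apply/redp_eq; rewrite subr0; have -> : tilt_seq f 0 = z - p%:R * r by rewrite -zE; ring.
  have [c cE] : divides p%:R ((z - p%:R * r) ^+ (p ^ k) - z ^+ (p ^ k)).
    rewrite subrXX; apply: dividesMr; exists (- r); ring.
  by rewrite -[_ ^+ _](subrK (z ^+ (p ^ k))) cE; apply: dividesD zk; exists c.
have fE : f = tilt_root k t * tilt_root k h.
  by apply: (perfect_inj p_pr perfT (n := k)); rewrite exprMn !tilt_rootX.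
rewrite -[z](subrK (tilt_seq f 0)) zE fE (tilt_seqM compS) !(tilt_seq_root compS).
by apply: dividesD; apply: dividesMr => //; exists 1; rewrite mulr1.
Qed.

Hypothesis tf : torsion_free_at p S.

(** Regularity of $p$ lets [f] be divided by [t] again and again, and the tilt is $t$-adically
    separated. *)
Lemma sharp_eq0 (f : tilt p_pr S) : sharp f = 0 -> f = 0.
Proof.
move=> f0; apply: (tilt_sep t0) => n.
suff [g [gE _]] : exists g, f = t ^+ n * g /\ sharp g = 0 by exists g.
elim: n => [|n [g [gE g0]]]; first by exists f; rewrite expr0 mul1r.
have [|h hE] := tilt_ev0_divides dist perfS (f := g).
  by rewrite -(redp_tilt_seq compS) -/(sharp g) g0 rmorph0.
exists h; split; first by rewrite gE hE exprSr mulrA.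
apply: tf; have := g0; rewrite hE (sharpM compS) tE => /(congr1 (fun x => v' * x)).
by rewrite mulr0 mulrA mulrA [v' * v]mulrC vv mul1r.
Qed.

Lemma root_powers n s : divides (p%:R ^+ n) (s ^+ p) -> divides (pi 1 ^+ n) s.
Proof.
elim: n => [|n IHn] [c cE]; first by exists s; rewrite expr0 mul1r.
have [|s' sE] := IHn; first by exists (p%:R * c); rewrite mulrA -exprSr.
have pn (x : S) : p%:R ^+ n * x = 0 -> x = 0 by rewrite -natrX; exact: (torsion_free_expn tf).
have : v ^+ n * s' ^+ p = p%:R * c.
  apply/eqP; rewrite -subr_eq0; apply/eqP/pn.
  have pi1 : pi 1 ^+ p = v * p%:R by rewrite (tilt_seqS compS) -tE.
  by rewrite mulrBr [X in _ - X]mulrA -exprSr -cE sE exprMn exprAC pi1 exprMn; ring.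
move=> vs; have [|s2 s2E] := perfectoid_root_closed (k := 1) (z := s').
  exists (v' ^+ n * c); rewrite expn1 mulrCA -vs mulrA -exprMn [v' * v]mulrC vv.
  by rewrite expr1n mul1r.
by exists s2; rewrite sE s2E mulrA -exprSr.
Qed.

Variables (L : comPzRingType) (i : {rmorphism S -> L}) (b : L).
Hypotheses (i_inj : injective i) (pb : i p%:R * b = 1).
Hypothesis L_frac : forall l, exists n s, i p%:R ^+ n * l = i s.

Lemma localized_reg n l l' : i p%:R ^+ n * l = i p%:R ^+ n * l' -> l = l'.
Proof.
move=> /(congr1 (fun x => b ^+ n * x)); rewrite !mulrA -!exprMn [b * _]mulrC pb.
by rewrite expr1n !mul1r.
Qed.

(** A denominator $p^{n+1}$ is reduced: the numerator [s] has $p^p \mid s^p$, so $\pi_1^p = vp$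
    divides [s] by [root_powers]. *)
Lemma localized_root l r : l ^+ p = i r -> exists s, l = i s.
Proof.
have [n [s sE]] := L_frac l; move=> lr; elim: n s sE => [|n IHn] s sE.
  by exists s; rewrite -sE expr0 mul1r.
have [|s' s'E] := root_powers (n := p) (s := s).
  exists ((p%:R ^+ p) ^+ n * r); apply: i_inj.
  rewrite rmorphXn -sE exprMn lr -!(rmorphXn i) -rmorphM; congr (i _).
  by rewrite mulrA -exprS exprAC.
apply: (IHn (v * s')); apply: (@localized_reg 1).
rewrite expr1 mulrA -exprS sE s'E -rmorphM (tilt_seqS compS) -/(sharp t) tE.
by congr (i _); ring.
Qed.

Lemma localized_rootX k l r : l ^+ (p ^ k) = i r -> exists s, l = i s.
Proof.
elim: k l r => [|k IHk] l r; first by rewrite expn0 expr1; exists r.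
by rewrite expnS exprM => /IHk [s]; exact: localized_root.
Qed.

Variable y : S.

(** An analogue of the almost integral elements of $S[1/p]$, with [y] as common denominator; [y] may
    be a zero divisor. *)
Definition bounded_powers : {pred L} := fun c => `[< forall j, exists s, c ^+ j * i y = i s >].

Lemma bounded_powersP c :
  reflect (forall j, exists s, c ^+ j * i y = i s) (c \in bounded_powers).
Proof. exact: asboolP. Qed.

(* The p-th power of c^j d^k y is (c^(pj) y)(d^(pk) y) y^(p-2). *)
Lemma bounded_powers_mixed c d j k : c \in bounded_powers -> d \in bounded_powers ->
  exists s, c ^+ j * d ^+ k * i y = i s.
Proof.
move=> /bounded_powersP /(_ (j * p)%N) [r rE] /bounded_powersP /(_ (k * p)%N) [s sE].
apply: (localized_root (r := r * s * y ^+ p.-2)).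
rewrite !rmorphM rmorphXn -rE -sE !exprMn -!exprM.
have -> : i y ^+ p = i y * i y * i y ^+ p.-2.
  by rewrite -mulrA -!exprS -[p in LHS](subnKC (prime_gt1 p_pr)) subn2.
ring.
Qed.

Lemma bounded_powers_subring : subring_closed bounded_powers.
Proof.
split=> [|c d cB dB|c d cB dB]; apply/bounded_powersP => j.
- by exists y; rewrite expr1n mul1r.
- rewrite exprBn mulr_suml; elim/big_ind: _ => [|_ _ [s ->] [s' ->]|k _].
  + by exists 0; rewrite rmorph0.
  + by exists (s + s'); rewrite rmorphD.
  + have [s sE] := bounded_powers_mixed (j - k) k cB dB.
    exists (((-1) ^+ k * s) *+ 'C(j, k)).
    by rewrite rmorphMn rmorphM rmorphXn rmorphN1 -sE mulrnAl !mulrA.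
- by rewrite exprMn; exact: bounded_powers_mixed.
Qed.

Record bounded_ring := BoundedRing {
  bounded_val :> L; bounded_valP : bounded_val \in bounded_powers }.

HB.instance Definition _ := [isSub for bounded_val].
HB.instance Definition _ := [Choice of bounded_ring by <:].
HB.instance Definition _ := @GRing.SubChoice_isSubComPzRing.Build L
  bounded_powers bounded_ring bounded_powers_subring.

Definition bounded_emb : {rmorphism bounded_ring -> L} := \val.

Lemma bounded_embP (c : bounded_ring) j : exists s, bounded_emb c ^+ j * i y = i s.
Proof. by have /bounded_powersP := bounded_valP c. Qed.

Lemma bounded_in l : (forall j, exists s, l ^+ j * i y = i s) ->
  exists c : bounded_ring, bounded_emb c = l.
Proof. by move=> /bounded_powersP lB; exists (BoundedRing lB). Qed.

Lemma bounded_lift_subproof r : i r \in bounded_powers.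
Proof. by apply/bounded_powersP => j; exists (r ^+ j * y); rewrite rmorphM rmorphXn. Qed.
Definition bounded_lift (r : S) : bounded_ring := BoundedRing (bounded_lift_subproof r).
Lemma bounded_lift_additive : additive bounded_lift.
Proof. by move=> x z; apply: val_inj; rewrite rmorphB; exact: (rmorphB i). Qed.
Lemma bounded_lift_multiplicative : multiplicative bounded_lift.
Proof.
split=> [x z|]; apply: val_inj; first by rewrite rmorphM; exact: (rmorphM i).
by rewrite rmorph1; exact: (rmorph1 i).
Qed.
HB.instance Definition _ :=
  GRing.isAdditive.Build S bounded_ring bounded_lift bounded_lift_additive.
HB.instance Definition _ :=
  GRing.isMultiplicative.Build S bounded_ring bounded_lift bounded_lift_multiplicative.

Lemma bounded_lift_emb r : bounded_emb (bounded_lift r) = i r.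
Proof. by []. Qed.

Lemma bounded_torsion_free : torsion_free_at p bounded_ring.
Proof.
move=> x /(congr1 bounded_emb); rewrite rmorphM !rmorph0 rmorph_nat => x0.
apply: val_inj; rewrite -[\val x]/(bounded_emb x) -[RHS](rmorph0 bounded_emb) rmorph0.
by apply: (@localized_reg 1); rewrite expr1 rmorph_nat x0 mulr0.
Qed.

(** The $p^k$-th power of $z/\pi_k$ is $v'c$. Hence the $p^k$-th power of $(z/\pi_k)^j y$ lies in
    [S], which contains the $p$-power roots of its elements in [L]. *)
Lemma bounded_root_closed k z : divides p%:R (z ^+ (p ^ k)) -> divides (bounded_lift (pi k)) z.
Proof.
move=> [c cE]; have pk : (0 < p ^ k)%N by rewrite expn_gt0 prime_gt0.
have piE : i (pi k) ^+ (p ^ k) = i v * i p%:R.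
  rewrite -rmorphXn -rmorphM -tE /sharp; congr (i _).
  by rewrite -[k in pi k]add0n (tilt_seqX compS).
pose r := i v' * b * i (pi k) ^+ (p ^ k).-1.
have rP : i (pi k) * r = 1.
  rewrite /r mulrCA -exprS prednK // piE; transitivity (i (v * v') * (i p%:R * b)).
    by rewrite rmorphM; ring.
  by rewrite vv pb rmorph1 mulr1.
have lE : (bounded_emb z * r) ^+ (p ^ k) = i v' * bounded_emb c.
  rewrite exprMn -rmorphXn cE rmorphM rmorph_nat.
  have E : i v * i p%:R * r ^+ (p ^ k) = 1 by rewrite -piE -exprMn rP expr1n.
  transitivity (i (v * v') * (p%:R * bounded_emb c * r ^+ (p ^ k))).
    by rewrite vv rmorph1 mul1r.
  transitivity (i v' * bounded_emb c * (i v * i p%:R * r ^+ (p ^ k))); last by rewrite E mulr1.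
  by rewrite rmorphM rmorph_nat; ring.
have [j|q qE] := @bounded_in (bounded_emb z * r).
  have [s sE] := bounded_embP c j.
  apply: (@localized_rootX k _ (v' ^+ j * s * y ^+ (p ^ k).-1)).
  rewrite exprMn exprAC lE !rmorphM !rmorphXn -sE exprMn -[(p ^ k)%N in LHS](prednK pk) exprS.
  by ring.
exists q; apply: val_inj; rewrite -[LHS]/(bounded_emb z) -[RHS]/(bounded_emb _).
by rewrite rmorphM qE bounded_lift_emb mulrCA rP mulr1.
Qed.

(** If $f$ dies, then $f^{(n)} = pc$ with $c$ bounded, so $f^\sharp y = p^{p^n} c^{p^n} y$ is
    divisible by $p^{p^n}$ in [S]. *)
Lemma tilt_map_bounded_lift0 f : tilt_map p_pr bounded_lift f = 0 -> sharp f * y = 0.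
Proof.
move=> f0; apply: (complete_sep compS) => n.
have [c] : divides p%:R (bounded_lift (tilt_seq f n) - 0).
  by apply/redp_eq; rewrite -redp_mapE (redp_tilt_seq compS) -tilt_map_ev f0 !rmorph0.
rewrite subr0 => /(congr1 bounded_emb); rewrite bounded_lift_emb rmorphM rmorph_nat => cE.
have [s sE] := bounded_embP c (p ^ n); exists (p%:R ^+ (p ^ n - n) * s).
have le : (n <= p ^ n)%N by rewrite ltnW // ltn_expl // prime_gt1.
rewrite mulrA natrX -exprD subnKC //; apply: i_inj.
rewrite !rmorphM -sE rmorphXn rmorph_nat mulrA -exprMn -cE -(rmorphXn i).
by rewrite /sharp -(tilt_seqX compS f 0 n) add0n.
Qed.

(** All positive powers of $x/p^n$ kill [y], so $x/p^n$ is bounded. *)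
Lemma bounded_lift_divisible x n : x * y = 0 -> divides (p ^ n)%:R (bounded_lift x).
Proof.
move=> xy; have [j|c cE] := @bounded_in (b ^+ n * i x).
  case: j => [|j]; first by exists y; rewrite expr0 mul1r.
  by exists 0; rewrite exprMn [i x ^+ _]exprSr -!mulrA -(rmorphM i) xy !rmorph0 !mulr0.
exists c; apply: val_inj; rewrite -[LHS]/(i x) -[RHS]/(bounded_emb _) rmorphM rmorph_nat.
by rewrite cE mulrA natrX -(rmorph_nat i) -exprMn pb expr1n mul1r.
Qed.

Lemma annihilator_trivial x :
  (forall f : tilt p_pr S, sharp f * y = 0 -> f = 0) -> x * y = 0 -> x = 0.
Proof.
move=> y_reg xy; have [a aE] := theta_surj p_pr compS semiS x.
pose k : {rmorphism S -> bounded_ring} := bounded_lift.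
have ax : theta_rel (witt_map p_pr (tilt_map p_pr k) a) 0.
  apply: (theta_rel_close (r := k x)).
    by apply: theta_rel_map; rewrite -aE; exact: theta_relP.
  by move=> n; rewrite sub0r; apply: dividesN; exact: bounded_lift_divisible.
have kvv : k v * k v' = 1 by rewrite -rmorphM vv rmorph1.
have ktp : sharp_seq (tilt_map p_pr k t) (k \o pi).
  by apply: sharp_seq_map; exact: tilt_seqP.
have kpi0 : (k \o pi) 0%N = k v * p%:R by rewrite /= -/(sharp t) tE rmorphM rmorph_nat.
have [u uE] := root_theta_kernel kvv ktp kpi0 (distinguished_map k dist)
  bounded_torsion_free bounded_root_closed ax.
have k_inj : injective (tilt_map p_pr k).
  move=> f g fg; apply/eqP; rewrite -subr_eq0; apply/eqP/y_reg/tilt_map_bounded_lift0.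
  by rewrite rmorphB /= fg subrr.
have sep : adic_sep (tilt_map p_pr k t).
  by apply: tilt_sep; rewrite tilt_map_ev t0 rmorph0.
have [u' aE'] := delta_descent_complete (i := tilt_map p_pr k) perfT
  (tilt_perfect p_pr bounded_ring) k_inj (tilt_sums t0) sep uE.
by rewrite -aE aE' theta_delta.
Qed.

End TorsionFreeDomain.

Lemma perfectoid_domain (p : nat) (p_pr : prime p) (S : comPzRingType)
    (t : tilt p_pr S) (e : WittRing p_pr (tilt p_pr S)) (v v' : S) :
  perfectoid p_pr S -> v * v' = 1 -> sharp t = v * p%:R -> distinguished t e ->
  (forall f g : tilt p_pr S, f * g = 0 -> f = 0 \/ g = 0) ->
  forall x y : S, x * y = 0 -> x = 0 \/ y = 0.
Proof.
move=> perfS vv tE dist dom x y xy; have [compS semiS] := perfectoid_complete perfS.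
(* If $t = 0$, then $p = 0$ in [S] and every element is a sharp, so integrality passes directly from
   the tilt. *)
have [tz|tn] := pselect (t = 0).
  have pz : p%:R = 0 :> S.
    have -> : p%:R = sharp t * v' by rewrite tE mulrAC vv mul1r.
    by rewrite tz /sharp (tilt_seq0 p_pr compS) mul0r.
  have sharp_surj z : exists f : tilt p_pr S, sharp f = z.
    have [f fE] := tilt_ev_surj p_pr semiS 0 (redp p S z); exists f.
    move: fE; rewrite -(redp_tilt_seq compS) => /redp_eq [c].
    by rewrite pz mul0r => /eqP; rewrite subr_eq0 => /eqP.
  have [f fx] := sharp_surj x; have [g gy] := sharp_surj y.
  have [|h fgE] := tilt_ev0_divides dist perfS (f := f * g).
    by rewrite -(redp_tilt_seq compS) -/(sharp _) (sharpM compS) fx gy xy rmorph0.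
  rewrite tz mul0r in fgE; case: (dom _ _ fgE) => E; [left; rewrite -fx | right; rewrite -gy].
  - by rewrite E /sharp (tilt_seq0 p_pr compS).
  - by rewrite E /sharp (tilt_seq0 p_pr compS).
have tf : torsion_free_at p S.
  by apply: (perfectoid_torsion_free perfS dist) => f /dom [].
have [L [i [b [i_inj pb L_frac]]]] := localization_exists tf.
have ann := annihilator_trivial perfS vv tE dist tf i_inj pb L_frac.
(* Otherwise $f^\sharp y = 0$ for some $f \neq 0$. Integrality of the tilt then allows $f^\sharp$ to
   play the role of [y], and [y] that of [x]. *)
have [y_reg|] := pselect (forall f : tilt p_pr S, sharp f * y = 0 -> f = 0).
  by left; apply: ann y_reg xy.
move=> /existsNP [f /not_implyP [fy fn]]; right; apply: (ann (sharp f)); last by rewrite mulrC.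
move=> g; rewrite -(sharpM compS) => /(sharp_eq0 perfS vv tE dist tf) /dom.
by case.
Qed.

(** * Prime ideals and intersections *)

Section FunctionRing.
Variables (X : Type) (A : comPzRingType).

Definition fun_const (a : A) : X -> A := fun=> a.
Lemma fun_const_additive : additive fun_const. Proof. by []. Qed.
Lemma fun_const_multiplicative : multiplicative fun_const. Proof. by []. Qed.
HB.instance Definition _ := GRing.isAdditive.Build A (X -> A) fun_const fun_const_additive.
HB.instance Definition _ :=
  GRing.isMultiplicative.Build A (X -> A) fun_const fun_const_multiplicative.

Definition fun_ev (x : X) (F : X -> A) : A := F x.
Lemma fun_ev_additive x : additive (fun_ev x). Proof. by []. Qed.
Lemma fun_ev_multiplicative x : multiplicative (fun_ev x). Proof. by []. Qed.
HB.instance Definition _ x := GRing.isAdditive.Build (X -> A) A (fun_ev x) (fun_ev_additive x).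
HB.instance Definition _ x :=
  GRing.isMultiplicative.Build (X -> A) A (fun_ev x) (fun_ev_multiplicative x).

Lemma fun_perfect p : perfect p A -> perfect p (X -> A : comPzRingType).
Proof.
move=> [p0 inj surj]; split.
- by apply/funext => x; rewrite -[LHS]/(fun_ev x _) rmorph_nat p0.
- move=> F F0; apply/funext => x; apply: inj.
  by rewrite -[F x]/(fun_ev x F) -rmorphXn F0.
- move=> F; have /choice [G GF] := fun x => surj (F x); exists G; apply/funext => x.
  by rewrite -[LHS]/(fun_ev x _) rmorphXn -GF.
Qed.
End FunctionRing.

Section Primes.
Variables (p : nat) (p_pr : prime p) (R : comPzRingType) (perfR : perfectoid p_pr R).
Variables (t : tilt p_pr R) (e : WittRing p_pr (tilt p_pr R)) (v v' : R).
Hypotheses (vv : v * v' = 1) (tE : sharp t = v * p%:R) (dist : distinguished t e).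
Let compR : adically_complete (p%:R : R) := proj1 (perfectoid_complete perfR).
Let semiR : semiperfect p R := proj2 (perfectoid_complete perfR).
Local Notation A := (tilt p_pr R).
Local Notation W := (WittRing p_pr A).
Let perfA : perfect p A := tilt_perfect p_pr R.
Let t0 : tilt_ev 0 t = 0. Proof. by case: dist. Qed.

Lemma untilt_subset (I I' : set A) : I `<=` I' -> untilt I `<=` untilt I'.
Proof. by move=> sub x [w [wI wE]]; exists w; split=> // n; exact: sub. Qed.

Lemma prime_radical (B : comPzRingType) (I : set B) : is_prime_ideal I -> is_radical I.
Proof.
move=> [I1 IM] x; elim=> [/I1 //|n IHn]; rewrite exprS => /IM [//|]; exact: IHn.
Qed.

Lemma tilt_ideal_sharp (J : set R) (f : A) : is_prime_ideal J ->
  tilt_ideal p_pr J f <-> J (sharp f).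
Proof.
move=> /prime_radical radJ; split=> [|Jf n]; first by apply.
by apply: (radJ _ (p ^ n)%N); have := tilt_seqX compR f 0 n; rewrite add0n => ->.
Qed.

Lemma tilt_ideal_prime (J : set R) : is_prime_ideal J -> is_prime_ideal (tilt_ideal p_pr J).
Proof.
move=> primeJ; have [J1 JM] := primeJ; split.
  move=> /(tilt_ideal_sharp _ primeJ); have := sharpX compR (1 : A) 0.
  by rewrite !expr0 => ->.
move=> f g /(tilt_ideal_sharp _ primeJ); rewrite (sharpM compR) => /JM.
by case=> H; [left|right]; apply/(tilt_ideal_sharp _ primeJ).
Qed.

(** The quotient of [R] is perfectoid and its tilt is $A/Q$, which is integral, so
    [perfectoid_domain] applies. *)
Lemma untilt_prime (Q : ideal A) : is_prime_ideal Q -> adically_closed t Q ->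
  is_prime_ideal (untilt Q).
Proof.
move=> primeQ closQ; have [Q1 QM] := primeQ; have radQ := prime_radical primeQ.
have perfD := perfect_quotient perfA radQ.
have q0 := @qmap0 _ Q; have q_surj := @qmap_surj _ Q.
pose J := Ideal (untilt_is_ideal perfR q0); have phi_surj := @qmap_surj _ J.
have phi0 : forall x, qmap J x = 0 <-> untilt Q x by move=> x; exact: (@qmap0 _ J).
have perfS := untilt_perfectoid perfR vv tE dist q_surj q0 perfD closQ phi_surj phi0.
have [compS _] := perfectoid_complete perfS.
have surj := tilt_map_untilt_surj perfR dist q_surj q0 perfD closQ phi_surj phi0.
have tiltQ := tilt_ideal_untilt perfR dist q_surj q0 perfD closQ.
have kerE f : ideal_set Q f <-> tilt_map p_pr (qmap J) f = 0.
  by rewrite -(tilt_idealE perfR phi0 compS) tiltQ.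
split=> [J1|x y /phi0].
  apply: Q1; apply/kerE; have J1' : 1 = 0 :> quotient_ring J.
    by rewrite -(rmorph1 (qmap J)); apply/phi0.
  rewrite rmorph1; apply: tilt_ext => n; rewrite rmorph1 rmorph0.
  by have := congr1 (redp p (quotient_ring J)) J1'; rewrite rmorph1 rmorph0.
rewrite rmorphM => xy.
have [|||?|?] := perfectoid_domain (v := qmap J v) (v' := qmap J v') perfS _ _
  (distinguished_map (qmap J) dist) _ xy; try by [left; apply/phi0 | right; apply/phi0].
- by rewrite -rmorphM vv rmorph1.
- by rewrite /sharp (tilt_seq_qmap perfR _ compS) -/(sharp t) tE rmorphM rmorph_nat.
- move=> f g; have [f' <-] := surj f; have [g' <-] := surj g.
  by rewrite -rmorphM => /kerE /QM [] /kerE H; [left|right].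
Qed.

(** * Untilting commutes with intersections *)

Section Intersection.
Variables (X : Type) (Q : X -> ideal A).
Hypotheses (radQ : forall x, is_radical (Q x)) (closQ : forall x, adically_closed t (Q x)).

Let I : set A := [set f | forall x, ideal_set (Q x) f].
Let I_ideal : is_ideal I.
Proof.
split=> [x|f g If Ig x|f g Ig x]; [exact: ideal0 | | ].
- by apply: idealD; [exact: If | exact: Ig].
- by apply: idealMl; exact: Ig.
Qed.

Let K : set (X -> A) := [set F | forall x, ideal_set (Q x) (F x)].
Let K_ideal : is_ideal K.
Proof.
split=> [x|f g If Ig x|f g Ig x]; [exact: ideal0 | | ].
- by apply: idealD; [exact: If | exact: Ig].
- by apply: idealMl; exact: Ig.
Qed.

(** The product of the $A/Q_x$ is realised as the function ring [X -> A] modulo [K], and $A/I$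
    embeds into it. Divisibility by $\delta$ in all factors is divisibility over the product, which
    descends to $W(A/I)$. *)
Lemma untilt_bigcap r : (forall x, untilt (Q x) r) -> untilt I r.
Proof.
have [w <-] := theta_surj p_pr compR semiR r => wQ.
pose J := Ideal I_ideal; pose L := Ideal K_ideal.
pose k : {rmorphism A -> (X -> A)} := @fun_const X A.
pose cl : {rmorphism (X -> A) -> quotient_ring L} := qmap L.
have radJ : is_radical J by move=> f n If x; apply: (radQ (n := n)); exact: If.
have radL : is_radical L.
  move=> F n KF x; apply: (radQ (n := n)).
  by have := KF x; rewrite -[(F ^+ n) x]/(fun_ev x _) rmorphXn.
have gJ f : ideal_set J f -> (cl \o k) f = 0 by move=> If; apply/qmap0.
pose i := quot_lift_rmorphism gJ.
have iE f : i (qmap J f) = cl (k f) by exact: quot_liftE.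
have i_inj : injective i.
  move=> f g; have [f' <-] := qmap_surj f; have [g' <-] := qmap_surj g.
  by rewrite !iE => /qmap_eq H; apply/qmap_eq => x; exact: H.
(* Closedness of [Q x] is used here: it says that each factor is $t$-adically separated. *)
have sep : adic_sep (i (qmap J t)).
  move=> F; have [F' <-] := qmap_surj F; rewrite iE => H; apply/qmap0 => x.
  have /adically_closedP := @closQ x; apply => n; have [G] := H n.
  have [G' <-] := qmap_surj G; rewrite -rmorphXn -rmorphM => /qmap_eq /(_ x) HG.
  exists (- G' x); move: HG; rewrite -[(F' - _) x]/(fun_ev x _) rmorphB rmorphM rmorphXn.
  by rewrite mulrN.
have sums : adic_sums (qmap J t).
  move=> b; have /choice [b' bE] := fun m => @qmap_surj _ J (b m).
  have [g gP] := tilt_sums t0 b'; exists (qmap J g) => n; have [c cE] := gP n.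
  exists (qmap J c); rewrite -rmorphXn -rmorphM -cE rmorphB rmorph_sum.
  by congr (_ - _); apply: eq_bigr => m _; rewrite rmorphM rmorphXn /= bE.
have /choice [u uP] : forall x, exists u : W, forall n, ideal_set (Q x) ((w - witt_delta t e * u) n).
  move=> x; have [w' [w'Q w'E]] := wQ x.
  have /(theta_kernel dist perfR) [u uE] : theta (w - w') = 0.
    by rewrite (thetaB compR) w'E subrr.
  by exists u; rewrite -uE opprB addrC subrK.
(* The quotients chosen in the factors are assembled into one Witt vector over the function ring. *)
pose U : WittRing p_pr (X -> A) := fun n x => u x n.
have clU : witt_map p_pr cl (witt_map p_pr k w
    - witt_delta (k t) (witt_map p_pr k e) * U) = 0.
  apply/(witt_ideal_kernel L) => n x.
  have -> : (witt_map p_pr k w - witt_delta (k t) (witt_map p_pr k e) * U) n x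
      = witt_map p_pr (fun_ev x) (witt_map p_pr k w
          - witt_delta (k t) (witt_map p_pr k e) * U) n by [].
  by rewrite rmorphB rmorphM /= witt_map_delta; exact: uP.
move: clU; rewrite rmorphB rmorphM /= witt_map_delta => /eqP.
rewrite subr_eq0 => /eqP clU.
have mapE (a : W) : witt_map p_pr i (witt_map p_pr (qmap J) a)
    = witt_map p_pr cl (witt_map p_pr k a).
  by apply/funext => n; exact: iE.
apply/(untiltP perfR dist (@qmap_surj _ J) (@qmap0 _ J)).
apply: (delta_descent_complete (i := i) (u := witt_map p_pr cl U)
  (perfect_quotient perfA radJ)
  (perfect_quotient (fun_perfect X perfA) radL) i_inj sums sep).
by rewrite mapE iE clU mapE.
Qed.
End Intersection.
End Primes.

Lemma spec_ext (R : comPzRingType) (P P' : spec R) :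
  (P : set R) = P' -> P = P'.
Proof.
case: P P' => [I Ip] [I' I'p] /= E.
have II' : I = I' by apply: ideal_ext => x; rewrite E.
by subst I'; congr Spec; exact: Prop_irrelevance.
Qed.

(** Here [h] turns equations of a closed set into equations of its preimage. *)
Lemma zariski_continuous (R R' : comPzRingType) (X : set (spec R)) (Y : set (spec R'))
    (f : X -> Y) (h : set R' -> set R) :
  (forall E (P : X), (E `<=` (val (f P) : set R')) <-> (h E `<=` (val P : set R))) ->
  continuous f.
Proof.
move=> hP; apply/continuousP => _ [_ [E ->] <-].
exists (~` [set P : spec R | h E `<=` P]); first by exists (h E).
by apply/seteqP; split=> P /=; apply: contra_not => /hP.
Qed.

Theorem theoremA (p : nat) (p_pr : prime p) (R : comPzRingType)
    (perfR : perfectoid p_pr R) (charR : char0 R)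
    (v : R) (v_unit : exists w : R, v * w = 1)
    (pflat : tilt p_pr R) (pflatE : sharp pflat = v * p%:R) :
  [/\ set_bij [set J : ideal R | perfectoid p_pr (quotient_ring J)]
              [set I : set (tilt p_pr R) |
                 [/\ is_ideal I, is_radical I & adically_closed pflat I]]
              (fun J : ideal R => tilt_ideal p_pr J),
      (forall J1 J2 : ideal R,
         perfectoid p_pr (quotient_ring J1) ->
         perfectoid p_pr (quotient_ring J2) ->
         J1 `<=` J2 -> tilt_ideal p_pr J1 `<=` tilt_ideal p_pr J2)
    & exists phi : [set P : spec R | perfectoid p_pr (quotient_ring P)] ->
                   [set Q : spec (tilt p_pr R) | adically_closed pflat Q],
        homeomorphism phi /\
        forall P, (val (phi P) : set (tilt p_pr R)) = tilt_ideal p_pr (val P)].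
Proof.
have [compR semiR] := perfectoid_complete perfR; have [v' vv] := v_unit.
have [e dist] := distinguished_exists compR semiR vv pflatE.
have perfA := tilt_perfect p_pr R.
have untilt_perf (I : ideal (tilt p_pr R)) (J : ideal R) : is_radical I ->
    adically_closed pflat I -> (J : set R) = untilt I ->
    perfectoid p_pr (quotient_ring J) /\ tilt_ideal p_pr J = I.
  move=> radI closI JE; have perfD := perfect_quotient perfA radI.
  have q0 := @qmap0 _ I; have q_surj := @qmap_surj _ I; split.
    apply: (untilt_perfectoid perfR vv pflatE dist q_surj q0 perfD closI (@qmap_surj _ J)).
    by move=> x; rewrite -JE; exact: qmap0.
  by rewrite JE (tilt_ideal_untilt perfR dist q_surj q0 perfD closI).
have untiltK (J : ideal R) : perfectoid p_pr (quotient_ring J) ->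
    untilt (tilt_ideal p_pr J) = J.
  exact: (untilt_tilt_ideal perfR dist (@qmap_surj _ J) (@qmap0 _ J)).
have tiltP (J : ideal R) : perfectoid p_pr (quotient_ring J) ->
    [/\ is_ideal (tilt_ideal p_pr J), is_radical (tilt_ideal p_pr J)
      & adically_closed pflat (tilt_ideal p_pr J)].
  move=> /perfectoid_complete [compS _].
  exact: (tilt_ideal_closed perfR dist (@qmap0 _ J) compS).
split.
- split=> [J /tiltP //|J1 J2 /set_mem perf1 /set_mem perf2 E|I [idI radI closI]].
    by apply: ideal_ext; rewrite -(untiltK J1) // -(untiltK J2) // E.
  pose J := Ideal (untilt_is_ideal perfR (@qmap0 _ (Ideal idI))).
  by have [perfJ JE] := untilt_perf (Ideal idI) J radI closI erefl; exists J.
- by move=> J1 J2 _ _ J12 f fJ1 n; apply: J12; exact: fJ1.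
have /choice [phi phiE] : forall P : [set P : spec R | perfectoid p_pr (quotient_ring P)],
    exists Q : [set Q : spec (tilt p_pr R) | adically_closed pflat Q],
      (val Q : set (tilt p_pr R)) = tilt_ideal p_pr (val P).
  move=> P; have perfP := set_valP P; have [idP _ closP] := tiltP _ perfP.
  have primeP := tilt_ideal_prime perfR (spec_prime (val P)).
  by exists (exist _ (Spec (spec_ideal := Ideal idP) primeP) (mem_set closP)).
have /choice [psi psiE] : forall Q : [set Q : spec (tilt p_pr R) | adically_closed pflat Q],
    exists P : [set P : spec R | perfectoid p_pr (quotient_ring P)],
      (val P : set R) = untilt (val Q).
  move=> Q; have closQ := set_valP Q; have primeQ := spec_prime (val Q).
  pose J := Ideal (untilt_is_ideal perfR (@qmap0 _ (val Q))).
  have [perfJ _] := untilt_perf (val Q) J (prime_radical primeQ) closQ erefl.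
  have primeJ : is_prime_ideal J := untilt_prime perfR vv pflatE dist primeQ closQ.
  by exists (exist _ (Spec (spec_ideal := J) primeJ) (mem_set perfJ)).
exists phi; split=> //; split.
  apply: (zariski_continuous (h := fun E => [set x | exists f n, E f /\ x = tilt_seq f n])).
  move=> E P; rewrite phiE; split=> [sub _ [f [n [Ef ->]]]|sub f Ef n]; first exact: sub.
  by apply: sub; exists f, n.
exists psi; last split=> [P|Q].
(* The intersection of all closed primes whose untilt contains [x]. By [untilt_bigcap] its untilt
   contains [x] too, so for closed primes $Q$ the condition $x \in$ [untilt Q] is the closed
   condition [I x] $\subseteq Q$. *)
- pose I x : set (tilt p_pr R) := [set f | forall Q : spec (tilt p_pr R),
    adically_closed pflat Q -> untilt Q x -> ideal_set Q f].
  apply: (zariski_continuous (h := fun E => [set f | exists2 x, E x & I x f])).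
  move=> E Q; rewrite psiE; have closQ := set_valP Q.
  split=> [sub f [x Ex If]|sub x Ex]; first by apply: If closQ _; exact: sub.
  pose X := {Q : spec (tilt p_pr R) | adically_closed pflat Q /\ untilt Q x}.
  pose F (q : X) : ideal (tilt p_pr R) := spec_ideal (proj1_sig q).
  apply: (@untilt_subset p p_pr R [set f | forall q, ideal_set (F q) f]) => [f Ff|].
    by apply: sub; exists x => // Q' clQ' xQ'; exact: Ff (exist _ Q' (conj clQ' xQ')).
  apply: (untilt_bigcap perfR dist) => -[Q' [clQ' xQ']] //=.
  exact: prime_radical (spec_prime Q').
- apply/val_inj/spec_ext; rewrite psiE phiE; exact: untiltK (set_valP P).
- apply/val_inj/spec_ext; rewrite phiE; have primeQ := spec_prime (val Q).
  by have [] := untilt_perf (val Q) (val (psi Q)) (prime_radical primeQ) (set_valP Q) (psiE Q).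
Qed.
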